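(* Let $E\in\widetilde{\mathbb{R}}$ be the generalized number with representative $(\varepsilon)_{\varepsilon\in(0,1]}$. Let $f\in\mathcal{O}_M(\mathbb{R})$ satisfy $f(0)=0$. Let $U_0,U_1\in\mathcal{G}(\mathbb{R})$ be compactly supported, with restrictions to $\mathbb{R}\setminus\{0\}$ belonging to $\mathcal{G}^0(\mathbb{R}\setminus\{0\})$, and suppose that $U_0'$ and $U_1$ are of bounded type on $\mathbb{R}$. Then for any $T>0$ there exists a solution $U\in\mathcal{G}([0,T]\times\mathbb{R})$ to the problem $$\partial_t^2U-\partial_x^2U=E\,f(U)\ \text{ in } \mathcal{G}([0,T]\times\mathbb{R}),\qquad U|_{t=0}=U_0,\quad \partial_tU|_{t=0}=U_1\ \text{ in } \mathcal{G}(\mathbb{R}),$$ such that $$\operatorname{sing\,supp}_{\mathcal{G}^0}U\subset\{(t,x): |x|=t,\ 0\le t\le T\}.$$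
   Context: All functions are real valued. $\mathcal{O}_M(\mathbb{R})$ is the space of smooth functions on $\mathbb{R}$ each of whose derivatives (including the function itself) grows at most polynomially at infinity. Colombeau algebras. Let $X$ be either a non-empty open subset $\Omega$ of $\mathbb{R}^n$, or its closure $\overline{\Omega}$, or a relatively open subset of $\overline\Omega$; here $[0,T]\times\mathbb{R}$ is the closure of $(0,T)\times\mathbb{R}$. $\mathcal{C}^\infty(X)$ denotes the smooth functions (in the non-open case: smooth functions on the interior, all of whose derivatives extend continuously to $X$). $\mathcal{E}_M(X)$ is the set of families $(u^\varepsilon)_{\varepsilon\in(0,1]}$ in $\mathcal{C}^\infty(X)$ such that for all compact $K\subset X$ and all multi-indices $\alpha\in\mathbb{N}_0^n$ there is $b\in\mathbb{R}$ with $\sup_{K}|\partial^\alpha u^\varepsilon|=O(\varepsilon^b)$ as $\varepsilon\downarrow0$. $\mathcal{N}(X)$ is the set of families such that for all compact $K\subset X$, all $\alpha$ and all $a\ge0$, $\sup_K|\partial^\alpha u^\varepsilon|=O(\varepsilon^a)$ as $\varepsilon\downarrow0$. Then $\mathcal{G}(X)=\mathcal{E}_M(X)/\mathcal{N}(X)$. (For $X=[0,T]\times\mathbb{R}$ compact sets $K$ may reach up to the boundary $t=0$, $t=T$.) Derivatives, products, restrictions to (relatively) open subsets, the restriction to $t=0$, and the superposition $f(U)$ for $f\in\mathcal{O}_M(\mathbb{R})$ are defined by performing the operation on representatives for each $\varepsilon$ and taking the class. Generalized numbers. $\widetilde{\mathbb{R}}$ is the ring of nets $(r^\varepsilon)_{\varepsilon\in(0,1]}$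 of real numbers with $|r^\varepsilon|=O(\varepsilon^b)$ for some $b\in\mathbb{R}$, modulo the nets that are $O(\varepsilon^a)$ for every $a\ge0$; it acts on $\mathcal{G}(X)$ by multiplication of representatives. Support. The support of $U\in\mathcal{G}(X)$ is the complement of the largest (relatively) open $\omega\subset X$ with $U|_\omega=0$ in $\mathcal{G}(\omega)$. Bounded type and $\mathcal{G}^0$. $U\in\mathcal{G}(X)$ is of bounded type on $L\subset X$ if it has a representative with $\sup_{L}|u^\varepsilon|=O(1)$ as $\varepsilon\downarrow0$. $\mathcal{G}^0(X)$ is the subalgebra of those $U\in\mathcal{G}(X)$ all of whose derivatives of any order are of bounded type on all compact subsets of $X$. The $\mathcal{G}^0$-singular support $\operatorname{sing\,supp}_{\mathcal{G}^0}U$ is the complement in $X$ of the largest (relatively) open set $\omega\subset X$ such that $U|_\omega\in\mathcal{G}^0(\omega)$. *)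

(* Defs.v *)
From Stdlib Require Import Reals List ClassicalEpsilon.
From Coquelicot Require Import Coquelicot.
Import ListNotations.
Open Scope R_scope.

Notation line := R_NormedModule.
Notation plane := (prod_NormedModule R_AbsRing R_NormedModule R_NormedModule).

(** The space [V] stands for [R^n]; [dir] lists its standard basis. *)
Class Coordinates (V : NormedModule R_AbsRing) := {
  axis : Type;
  dir : axis -> V
}.

#[export] Instance R_coordinates : Coordinates line :=
  {| axis := unit; dir := fun _ => 1 |}.

Inductive tx_axis : Set := ax_t | ax_x.

#[export] Instance R2_coordinates : Coordinates plane :=
  {| axis := tx_axis;
     dir := fun i => match i with ax_t => (1, 0) | ax_x => (0, 1) end |}.

Section Colombeau.

Context {V : NormedModule R_AbsRing} {coordV : Coordinates V}.

Definition pd (i : axis) (u : V -> R) (x : V) : R :=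
  Derive (fun h : R => u (plus x (scal h (dir i)))) 0.

(** A multi-index is a word of axes; for smooth functions the order of the
    letters is irrelevant. *)
Definition pds (l : list axis) (u : V -> R) : V -> R := fold_right pd u l.

(** Functions on [X] are total functions whose values off [X] are ignored.
    The sets used are relatively open in the closure of an open set, so their
    interior is dense in them and a continuous extension to [X] is unique. *)

(** [locally x X] says that [x] is interior to [X]. *)
Definition cont_ext (X : V -> Prop) (g h : V -> R) : Prop :=
  (forall x, locally x X -> h x = g x) /\ continuous_on X h.

Definition smooth (X : V -> Prop) (u : V -> R) : Prop :=
  (forall l i x, locally x X ->
     ex_derive (fun h : R => pds l u (plus x (scal h (dir i)))) 0) /\
  continuous_on X u /\
  (forall l, exists h, cont_ext X (pds l u) h).

(** The derivative of [u] on [X], boundary points of [X] included. *)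
Definition D (X : V -> Prop) (l : list axis) (u : V -> R) : V -> R :=
  epsilon (inhabits (pds l u)) (cont_ext X (pds l u)).

Definition compact_set (K : V -> Prop) : Prop :=
  forall F : (V -> Prop) -> Prop,
    (forall O, F O -> open O) ->
    (forall x, K x -> exists O, F O /\ O x) ->
    exists s : list (V -> Prop),
      (forall O, In O s -> F O) /\ (forall x, K x -> exists O, In O s /\ O x).

Definition compact_in (X K : V -> Prop) : Prop :=
  compact_set K /\ (forall x, K x -> X x).

Definition rel_open (X w : V -> Prop) : Prop :=
  exists O, open O /\ (forall x, w x <-> X x /\ O x).

(** Families indexed by [eps]; only the indices in (0,1] matter. *)
Definition net : Type := R -> V -> R.

(** [sup_K |g eps| = O(eps^b)] as [eps] decreases to 0 *)
Definition sup_bigO (K : V -> Prop) (b : R) (g : net) : Prop :=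
  exists C, at_right 0 (fun eps =>
    forall x, K x -> Rabs (g eps x) <= C * Rpower eps b).

Definition smooth_net (X : V -> Prop) (u : net) : Prop :=
  forall eps, 0 < eps <= 1 -> smooth X (u eps).

Definition moderate (X : V -> Prop) (u : net) : Prop :=
  smooth_net X u /\
  forall K l, compact_in X K ->
    exists b, sup_bigO K b (fun eps => D X l (u eps)).

Definition negligible (X : V -> Prop) (u : net) : Prop :=
  smooth_net X u /\
  forall K l a, compact_in X K -> 0 <= a ->
    sup_bigO K a (fun eps => D X l (u eps)).

(** Elements of the quotient are equivalence classes, as sets of nets. *)
Definition cls (X : V -> Prop) (u : net) : net -> Prop :=
  fun v => moderate X v /\ negligible X (fun eps x => v eps x - u eps x).

Definition G (X : V -> Prop) (U : net -> Prop) : Prop :=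
  exists u, moderate X u /\ U = cls X u.

Definition gzero (X : V -> Prop) : net -> Prop := cls X (fun _ _ => 0).

End Colombeau.

Arguments net V : clear implicits.

(** The class in [G Y] of [F u], for [u] any representative of [U]. *)
Definition lift {V W : NormedModule R_AbsRing} {coordW : Coordinates W}
    (Y : W -> Prop) (F : net V -> net W) (U : net V -> Prop) : net W -> Prop :=
  fun w => exists u, U u /\ cls Y (F u) w.

Definition num_bigO (b : R) (r : R -> R) : Prop :=
  exists C, at_right 0 (fun eps => Rabs (r eps) <= C * Rpower eps b).

Definition num_moderate (r : R -> R) : Prop := exists b, num_bigO b r.

Definition num_negligible (r : R -> R) : Prop :=
  forall a, 0 <= a -> num_bigO a r.

Definition num_cls (r : R -> R) : (R -> R) -> Prop :=
  fun s => num_moderate s /\ num_negligible (fun eps => s eps - r eps).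

Section Operations.

Context {V : NormedModule R_AbsRing} {coordV : Coordinates V}.

Definition gderiv (X : V -> Prop) (l : list axis) : (net V -> Prop) -> net V -> Prop :=
  lift X (fun u eps => D X l (u eps)).

Definition grestrict (w : V -> Prop) : (net V -> Prop) -> net V -> Prop :=
  lift w (fun u => u).

Definition gcomp (X : V -> Prop) (f : R -> R) : (net V -> Prop) -> net V -> Prop :=
  lift X (fun u eps x => f (u eps x)).

Definition gsub (X : V -> Prop) (U1 U2 : net V -> Prop) : net V -> Prop :=
  fun w => exists u1 u2, U1 u1 /\ U2 u2 /\
    cls X (fun eps x => u1 eps x - u2 eps x) w.

Definition gscal (X : V -> Prop) (A : (R -> R) -> Prop) (U : net V -> Prop) :
    net V -> Prop :=
  fun w => exists r u, A r /\ U u /\ cls X (fun eps x => r eps * u eps x) w.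

(** The largest open set on which [U] vanishes is the union of all of them. *)
Definition gsupp (X : V -> Prop) (U : net V -> Prop) (x : V) : Prop :=
  X x /\ ~ (exists w, rel_open X w /\ w x /\ grestrict w U = gzero w).

Definition bounded_type (L : V -> Prop) (U : net V -> Prop) : Prop :=
  exists u, U u /\ exists C, at_right 0 (fun eps =>
    forall x, L x -> Rabs (u eps x) <= C).

Definition G0 (X : V -> Prop) (U : net V -> Prop) : Prop :=
  G X U /\
  forall l K, compact_in X K -> bounded_type K (gderiv X l U).

Definition singsupp_G0 (X : V -> Prop) (U : net V -> Prop) (x : V) : Prop :=
  X x /\ ~ (exists w, rel_open X w /\ w x /\ G0 w (grestrict w U)).

End Operations.

Definition real_line : R -> Prop := fun _ => True.

Definition punctured_line : R -> Prop := fun x => x <> 0.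

Definition strip (T : R) : R * R -> Prop := fun p => 0 <= fst p <= T.

Definition at_time_0 : (net plane -> Prop) -> net line -> Prop :=
  lift real_line (fun u eps x => u eps (0, x)).

Definition O_M (f : R -> R) : Prop :=
  (forall n x, ex_derive_n f n x) /\
  (forall n, exists C m, forall x, Rabs (Derive_n f n x) <= C * (1 + Rabs x) ^ m).

Definition E_eps : (R -> R) -> Prop := num_cls (fun eps => eps).

(* Main.v *)
Require Import Defs.
From Stdlib Require Import Reals List Lra Lia.
From Stdlib Require Import FunctionalExtensionality PropExtensionality ClassicalEpsilon.
From Coquelicot Require Import Coquelicot.
Import List ListNotations.
(* once more, because [D] has been shadowed *)
Import Defs.
Open Scope R_scope.

(** In the characteristic coordinates [xi = x + t] and [eta = x - t] the equation
    for a fixed index reads [D_xi D_eta v = - (eps / 4) f(v)].  Integrated over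
    the triangle between a point and the initial line [xi = eta], it becomes
    [v = A(xi) + B(eta) + (eps / 4) * triangle_int (f(v))], where [A] and [B] are
    the travelling waves of d'Alembert's formula.

    Existence.  A datum with compact support and bounded derivative is bounded
    ([data_bounded]), so the free wave is bounded on the strip, uniformly in
    [eps] for small [eps] on each compact set, and the source adds a term of
    order [eps].  Hence only the values of [f] on one fixed interval matter, and
    [f] may be replaced by a smooth function [g] of compact support that agrees
    with [f] there ([truncation]).  With [g] the integral equation is solved on
    the whole plane and for all indices by Picard iteration in a weighted norm
    ([picard_fixpoint]); the solution is smooth because its first derivatives
    are integrals of [g(v)] over characteristics ([char_sol_exists]).  On a
    compact set [g(u)] and [f(u)] coincide for small indices, so their difference
    is negligible ([truncation_negligible]) and the class of the solution for
    [g] solves the equation with [f].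

    Regularity.  The first derivative is
    [D_xi v = A'(xi) + (eps / 4) * int_eta^xi g(v(xi, s)) ds], and the integral
    runs along the line of constant [xi].  Inductively, the derivatives in [xi]
    on this line are controlled by the data at the single point [xi] and by
    lower derivatives on the same line; the same holds for [eta], and mixed
    derivatives are reduced by the equation.  Thus singularities of the data do
    not interact: if all derivatives of the data are bounded away from the
    origin, those of [v] are bounded away from the lines [xi = 0] and [eta = 0],
    which form the light cone [|x| = t] ([controlled_sol_propagated]).  The same
    induction without excluding any points, and with powers of [eps] in place of
    bounds, shows that the solution is moderate.

    Derivatives on the closed strip are continuous extensions of interior ones.
    Their calculus follows from interior calculus and density ([D_unique]);
    [is_derive_trace] shows that restriction to [t = 0] commutes with
    derivatives in [x].  All growth estimates are statements about the predicate
    [Ctl], which bounds the derivatives up to a given order; its rules for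
    products and superposition ([Ctl_mult], [Ctl_comp]) serve both the algebra of
    moderate and negligible nets and the estimates for the solution. *)

(** * Continuity on a set *)

Section ContinuousOn.

Context {V : UniformSpace}.

Lemma continuous_on_lin (X : V -> Prop) (g h : V -> R) (a b : R) :
  continuous_on X g -> continuous_on X h ->
  continuous_on X (fun x => a * g x + b * h x).
Proof.
  intros Hg Hh x Hx.
  apply (filterlim_comp_2 (G := locally (a * g x)) (H := locally (b * h x))).
  - apply (filterlim_comp _ _ _ g (Rmult a) _ (locally (g x))).
    + now apply Hg.
    + apply (filterlim_scal_r (V := R_NormedModule) a (g x)).
  - apply (filterlim_comp _ _ _ h (Rmult b) _ (locally (h x))).
    + now apply Hh.
    + apply (filterlim_scal_r (V := R_NormedModule) b (h x)).
  - apply (filterlim_plus (V := R_NormedModule) (a * g x) (b * h x)).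
Qed.

Lemma continuous_on_mult (X : V -> Prop) (g h : V -> R) :
  continuous_on X g -> continuous_on X h ->
  continuous_on X (fun x => g x * h x).
Proof.
  intros Hg Hh x Hx.
  apply (filterlim_comp_2 (G := locally (g x)) (H := locally (h x))).
  - now apply Hg.
  - now apply Hh.
  - apply (filterlim_mult (K := R_AbsRing) (g x) (h x)).
Qed.

Lemma continuous_on_comp_R (X : V -> Prop) (g : V -> R) (f : R -> R) :
  (forall y, continuous f y) -> continuous_on X g ->
  continuous_on X (fun x => f (g x)).
Proof.
  intros Hf Hg x Hx.
  apply (filterlim_comp _ _ _ g f _ (locally (g x))).
  - now apply Hg.
  - apply Hf.
Qed.

Lemma continuous_on_const (X : V -> Prop) (c : R) :
  continuous_on X (fun _ : V => c).
Proof. intros x Hx. apply filterlim_const. Qed.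

End ContinuousOn.

Lemma ex_derive_continuous_R (f : R -> R) (x : R) : ex_derive f x -> continuous f x.
Proof. apply (ex_derive_continuous (K := R_AbsRing) (V := R_NormedModule)). Qed.

(** * Derivatives on a set *)

Section Calculus.

Context {V : NormedModule R_AbsRing} {coordV : Coordinates V}.

Implicit Types (X Y : V -> Prop) (u v : V -> R).

Lemma along_0 (i : axis) (x : V) : plus x (scal (0 : R) (dir i)) = x.
Proof.
  change (plus x (scal (zero : R_AbsRing) (dir i)) = x).
  now rewrite (scal_zero_l (K := R_AbsRing)), plus_zero_r.
Qed.

Lemma locally_along (i : axis) (x : V) (P : V -> Prop) :
  locally x P -> locally 0 (fun h : R => P (plus x (scal h (dir i)))).
Proof.
  intros HP.
  assert (Hc : continuous (fun h : R => plus x (scal h (dir i))) 0).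
  { apply (continuous_plus (V := V)).
    - apply continuous_const.
    - apply (continuous_scal_l (K := R_AbsRing) (fun h : R => h) (dir i) 0).
      apply continuous_id. }
  apply Hc.
  now rewrite along_0.
Qed.

Definition has_pd (i : axis) u (x : V) : Prop :=
  ex_derive (fun h : R => u (plus x (scal h (dir i)))) 0.

Lemma pd_is_derive (i : axis) u (x : V) :
  has_pd i u x ->
  is_derive (fun h : R => u (plus x (scal h (dir i)))) 0 (pd i u x).
Proof. intros H. now apply Derive_correct. Qed.

Lemma is_derive_pd (i : axis) u (x : V) (d : R) :
  is_derive (fun h : R => u (plus x (scal h (dir i)))) 0 d ->
  has_pd i u x /\ pd i u x = d.
Proof.
  intros H. split.
  - now exists d.
  - now apply is_derive_unique.
Qed.

Lemma pds_app (l1 l2 : list axis) u : pds (l1 ++ l2) u = pds l1 (pds l2 u).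
Proof. unfold pds. apply fold_right_app. Qed.

Lemma pd_locally (i : axis) u v (x : V) :
  locally x (fun y => u y = v y) -> pd i u x = pd i v x.
Proof.
  intros H. unfold pd. apply Derive_ext_loc.
  exact (locally_along i x _ H).
Qed.

Lemma has_pd_locally (i : axis) u v (x : V) :
  locally x (fun y => u y = v y) -> has_pd i u x -> has_pd i v x.
Proof.
  intros H. unfold has_pd. apply ex_derive_ext_loc.
  exact (locally_along i x _ H).
Qed.

Lemma pds_locally (l : list axis) u v (x : V) :
  locally x (fun y => u y = v y) -> locally x (fun y => pds l u y = pds l v y).
Proof.
  revert x. induction l as [|i l IH]; intros x H; [exact H|].
  apply locally_locally in H.
  apply filter_imp with (2 := H). intros y Hy.
  cbn. apply pd_locally. now apply IH.
Qed.

(** Boundary points of such an [X] are limits of interior ones, so that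
    continuous functions on [X] are determined by their interior values. *)
Definition dense_interior X : Prop :=
  forall x, X x -> forall P, locally x P -> exists y, P y /\ locally y X.

(** Approaching a point of [X] through the interior gives the same limit as
    approaching it through [X], and limits are unique. *)
Lemma continuous_on_unique X (g h : V -> R) :
  dense_interior X -> continuous_on X g -> continuous_on X h ->
  (forall x, locally x X -> g x = h x) -> forall x, X x -> g x = h x.
Proof.
  intros HX Hg Hh E x Hx.
  set (F := within (fun y => locally y X) (locally x)).
  assert (HF : ProperFilter' F).
  { constructor.
    - intros H. destruct (HX x Hx _ H) as (y & Hy & Hy'). now apply Hy.
    - apply within_filter. apply locally_filter. }
  apply (filterlim_locally_unique (K := R_AbsRing) (V := R_NormedModule) (F := F) h).
  - apply (filterlim_within_ext _ g); [exact E|].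
    intros P HP. apply (Hg x Hx) in HP. unfold filtermap, within in *.
    apply filter_imp with (2 := HP). intros y Hy Hy'. apply Hy.
    now apply locally_singleton.
  - intros P HP. apply (Hh x Hx) in HP. unfold filtermap, within in *.
    apply filter_imp with (2 := HP). intros y Hy Hy'. apply Hy.
    now apply locally_singleton.
Qed.

(** ** Smoothness by recursion on the first derivative taken *)

(** [smooth] quantifies over words whose head is the last derivative taken;
    peeling off the first one instead turns closure properties into
    inductions on the order. *)
Fixpoint Cn X (n : nat) u : Prop :=
  (exists h, cont_ext X u h) /\
  match n with
  | O => True
  | S m => forall i, (forall x, locally x X -> has_pd i u x) /\ Cn X m (pd i u)
  end.

Lemma Cn_0 X n u : Cn X n u -> exists h, cont_ext X u h.
Proof. destruct n; cbn; tauto. Qed.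

Lemma Cn_pred X n u : Cn X (S n) u -> Cn X n u.
Proof.
  revert u. induction n as [|n IH]; intros u [H0 H]; split; try easy.
  intros i. destruct (H i) as [H1 H2]. split; [easy|]. now apply IH.
Qed.

Lemma Cn_le X n m u : (m <= n)%nat -> Cn X n u -> Cn X m u.
Proof. induction 1; [easy|]. intros H'. apply IHle. now apply Cn_pred. Qed.

Lemma eq_interior_locally X u v (x : V) :
  (forall y, locally y X -> u y = v y) -> locally x X ->
  locally x (fun y => u y = v y).
Proof.
  intros E Hx. apply locally_locally in Hx.
  now apply filter_imp with (2 := Hx).
Qed.

Lemma Cn_ext X n u v :
  (forall y, locally y X -> u y = v y) -> Cn X n u -> Cn X n v.
Proof.
  revert u v. induction n as [|n IH]; intros u v E [[h [Hh Hc]] H]; split; try easy.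
  1, 2: exists h; split; [intros x Hx; rewrite <- E; auto | easy].
  intros i. destruct (H i) as [H1 H2]. split.
  - intros x Hx. apply (has_pd_locally i u v); auto.
    now apply eq_interior_locally with X.
  - apply (IH (pd i u)); [|easy].
    intros y Hy. apply pd_locally. now apply eq_interior_locally with X.
Qed.

Lemma Cn_pds X n l u : Cn X (n + length l) u -> Cn X n (pds l u).
Proof.
  revert u. induction l as [|j l IH] using rev_ind; intros u H.
  - now rewrite Nat.add_0_r in H.
  - rewrite pds_app. apply IH. rewrite length_app in H. cbn in H.
    rewrite Nat.add_1_r, Nat.add_succ_r in H. now destruct H as [_ H]; apply H.
Qed.

Lemma smooth_iff_Cn X u : smooth X u <-> continuous_on X u /\ forall n, Cn X n u.
Proof.
  split.
  - intros (H1 & H2 & H3). split; [exact H2|]. intros n. clear H2.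
    revert u H1 H3. induction n as [|n IH]; intros u H1 H3; split; try exact I.
    1, 2: exact (H3 []).
    intros i. split; [exact (H1 [] i)|].
    apply IH; intros l; specialize (H1 (l ++ [i])); specialize (H3 (l ++ [i]));
      rewrite pds_app in *; easy.
  - intros [H1 H2]. repeat split; [|easy|].
    + intros l i. specialize (H2 (S (length l))).
      assert (H := Cn_pds X 1 l u H2). destruct H as [_ H]. apply H.
    + intros l. exact (Cn_0 X 0 _ (Cn_pds X 0 l u (H2 (length l)))).
Qed.

(** The formula for the derivative is proved together with the regularity,
    because the induction on the order needs it. *)
Lemma Cn_lin X n u v (a b : R) :
  Cn X n u -> Cn X n v ->
  Cn X n (fun x => a * u x + b * v x) /\
  forall i x, (0 < n)%nat -> locally x X ->
    pd i (fun x => a * u x + b * v x) x = a * pd i u x + b * pd i v x.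
Proof.
  assert (K : forall u v i x, has_pd i u x -> has_pd i v x ->
    has_pd i (fun x => a * u x + b * v x) x /\
    pd i (fun x => a * u x + b * v x) x = a * pd i u x + b * pd i v x).
  { clear. intros u v i x Hu Hv. apply is_derive_pd.
    apply (is_derive_plus (V := R_NormedModule)).
    - apply (is_derive_scal (fun h : R => u (plus x (scal h (dir i)))) 0 a).
      now apply pd_is_derive.
    - apply (is_derive_scal (fun h : R => v (plus x (scal h (dir i)))) 0 b).
      now apply pd_is_derive. }
  revert u v. induction n as [|n IH]; intros u v Hu Hv.
  all: assert (C0 : exists h, cont_ext X (fun x => a * u x + b * v x) h).
  1, 3: destruct (Cn_0 _ _ _ Hu) as (h & Hh & Ch); destruct (Cn_0 _ _ _ Hv) as (k & Hk & Ck);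
    exists (fun x => a * h x + b * k x); split;
    [ intros x Hx; now rewrite Hh, Hk | now apply continuous_on_lin ].
  - repeat split; try easy; intros; lia.
  - destruct Hu as [_ Hu], Hv as [_ Hv]. split.
    + split; [exact C0|]. intros i.
      destruct (Hu i) as [Du Su], (Hv i) as [Dv Sv]. split.
      * intros x Hx. apply K; auto.
      * apply Cn_ext with (2 := proj1 (IH _ _ Su Sv)).
        intros x Hx. symmetry. apply K; auto.
    + intros i x _ Hx. apply K; [now apply Hu | now apply Hv].
Qed.

Lemma Cn_mult X n u v :
  Cn X n u -> Cn X n v ->
  Cn X n (fun x => u x * v x) /\
  forall i x, (0 < n)%nat -> locally x X ->
    pd i (fun x => u x * v x) x = pd i u x * v x + u x * pd i v x.
Proof.
  assert (K : forall u v i x, has_pd i u x -> has_pd i v x ->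
    has_pd i (fun x => u x * v x) x /\
    pd i (fun x => u x * v x) x = pd i u x * v x + u x * pd i v x).
  { clear. intros u v i x Hu Hv. apply is_derive_pd.
    apply pd_is_derive in Hu. apply pd_is_derive in Hv.
    assert (H := is_derive_mult _ _ _ _ _ Hu Hv Rmult_comm).
    cbn -[plus scal] in H. rewrite !along_0 in H. exact H. }
  revert u v. induction n as [|n IH]; intros u v Hu Hv.
  all: assert (C0 : exists h, cont_ext X (fun x => u x * v x) h).
  1, 3: destruct (Cn_0 _ _ _ Hu) as (h & Hh & Ch); destruct (Cn_0 _ _ _ Hv) as (k & Hk & Ck);
    exists (fun x => h x * k x); split;
    [ intros x Hx; now rewrite Hh, Hk | now apply continuous_on_mult ].
  - repeat split; try easy; intros; lia.
  - assert (Hu' := Cn_pred _ _ _ Hu). assert (Hv' := Cn_pred _ _ _ Hv).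
    destruct Hu as [_ Hu], Hv as [_ Hv]. split.
    + split; [exact C0|]. intros i.
      destruct (Hu i) as [Du Su], (Hv i) as [Dv Sv]. split.
      * intros x Hx. apply K; auto.
      * assert (H1 := proj1 (IH _ _ Su Hv')). assert (H2 := proj1 (IH _ _ Hu' Sv)).
        apply Cn_ext with (2 := proj1 (Cn_lin X n _ _ 1 1 H1 H2)).
        intros x Hx. rewrite (proj2 (K u v i x (Du x Hx) (Dv x Hx))). ring.
    + intros i x _ Hx. apply K; [now apply Hu | now apply Hv].
Qed.

Lemma Cn_const X n (c : R) : Cn X n (fun _ => c).
Proof.
  assert (C0 : forall c : R, exists h, cont_ext X (fun _ => c) h).
  { intros d. exists (fun _ => d). split; [easy|]. apply continuous_on_const. }
  revert c. induction n as [|n IH]; intros c; split; try easy.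
  intros i. assert (K : forall x, has_pd i (fun _ => c) x /\ pd i (fun _ => c) x = 0).
  { intros x. apply is_derive_pd. apply (is_derive_const (K := R_AbsRing) (V := R_NormedModule) c). }
  split.
  - intros x _. apply K.
  - apply Cn_ext with (2 := IH 0). intros y _. symmetry. apply K.
Qed.

(** ** The operators [D X l] *)

Lemma D_spec X l u : smooth X u -> cont_ext X (pds l u) (D X l u).
Proof.
  intros (_ & _ & H). unfold D. apply epsilon_spec. apply H.
Qed.

(** The choice made in [D] is harmless: every continuous extension of the
    interior derivative agrees with it.  All rules of calculus on [X] follow
    from their interior versions in this way. *)
Lemma D_unique X l u (h : V -> R) :
  dense_interior X -> smooth X u -> continuous_on X h ->
  (forall x, locally x X -> h x = pds l u x) ->
  forall x, X x -> D X l u x = h x.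
Proof.
  intros HX Hu Hh E. destruct (D_spec X l u Hu) as [E' C'].
  apply continuous_on_unique; try easy.
  intros x Hx. now rewrite E, E'.
Qed.

Lemma D_interior X l u x : smooth X u -> locally x X -> D X l u x = pds l u x.
Proof. intros Hu. now apply D_spec. Qed.

Lemma D_continuous_on X l u : smooth X u -> continuous_on X (D X l u).
Proof. intros Hu. now apply D_spec. Qed.

Lemma smooth_continuous_on X u : smooth X u -> continuous_on X u.
Proof. now intros (_ & H & _). Qed.

Lemma smooth_Cn X u n : smooth X u -> Cn X n u.
Proof. intros H. now apply smooth_iff_Cn. Qed.

Lemma D_nil X u x : dense_interior X -> smooth X u -> X x -> D X [] u x = u x.
Proof.
  intros HX Hu Hx. apply D_unique with (1 := HX) (2 := Hu); try easy.
  now apply smooth_continuous_on.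
Qed.

Lemma smooth_D X l u : smooth X u -> smooth X (D X l u).
Proof.
  intros Hu. apply smooth_iff_Cn. split.
  - now apply D_continuous_on.
  - intros n. apply (Cn_ext X n (pds l u)).
    + intros y Hy. symmetry. now apply D_interior.
    + apply Cn_pds. now apply smooth_Cn.
Qed.

(** The interior derivatives of [D X l2 u] and of [pds l2 u] agree because
    these functions coincide near every interior point. *)
Lemma D_app X l1 l2 u x :
  dense_interior X -> smooth X u -> X x ->
  D X (l1 ++ l2) u x = D X l1 (D X l2 u) x.
Proof.
  intros HX Hu Hx. assert (H2 := smooth_D X l2 u Hu).
  apply D_unique with (1 := HX) (2 := Hu); try easy.
  - now apply D_continuous_on.
  - intros y Hy. rewrite D_interior by easy. rewrite pds_app.
    apply (locally_singleton y (fun y => pds l1 (D X l2 u) y = pds l1 (pds l2 u) y)).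
    apply pds_locally. apply eq_interior_locally with X; [|easy].
    intros z Hz. now apply D_interior.
Qed.

(** Passing to a smaller set, be it the strip inside the plane or an open part
    of the strip, does not change derivatives, boundary values included. *)
Lemma D_sub X Y l u :
  dense_interior X -> (forall x, X x -> Y x) -> smooth Y u ->
  smooth X u /\ forall x, X x -> D X l u x = D Y l u x.
Proof.
  intros HX HXY Hu.
  assert (Hloc : forall x, locally x X -> locally x Y).
  { intros x Hx. now apply filter_imp with (2 := Hx). }
  assert (HS : smooth X u).
  { apply smooth_iff_Cn. split.
    - apply continuous_on_subset with (1 := HXY). now apply smooth_continuous_on.
    - intros n. assert (H := smooth_Cn Y u n Hu). clear Hu. revert u H.
      induction n as [|n IH]; intros u [[h [Eh Ch]] H]; split; try easy.
      1, 2: exists h; split; [auto | now apply continuous_on_subset with Y].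
      intros i. destruct (H i) as [H1 H2]. split; auto. }
  split; [exact HS|].
  apply D_unique; try easy.
  - apply continuous_on_subset with Y; [easy|]. now apply D_continuous_on.
  - intros x Hx. apply D_interior; auto.
Qed.

Lemma D_ext X l u v x :
  dense_interior X -> smooth X u -> smooth X v ->
  (forall y, X y -> u y = v y) -> X x -> D X l u x = D X l v x.
Proof.
  intros HX Hu Hv E Hx. apply D_unique; try easy.
  - now apply D_continuous_on.
  - intros y Hy. rewrite D_interior by easy. symmetry.
    apply (locally_singleton y (fun y => pds l u y = pds l v y)).
    apply pds_locally. apply eq_interior_locally with X; [|easy].
    intros z Hz. apply E. now apply locally_singleton.
Qed.

Lemma smooth_ext X u v :
  smooth X u -> (forall y, X y -> u y = v y) -> smooth X v.
Proof.
  intros Hu E. apply smooth_iff_Cn. split.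
  - apply continuous_on_ext with u; [easy|]. now apply smooth_continuous_on.
  - intros n. apply Cn_ext with u.
    + intros y Hy. apply E. now apply locally_singleton.
    + now apply smooth_Cn.
Qed.

Lemma smooth_const X (c : R) : smooth X (fun _ => c).
Proof.
  apply smooth_iff_Cn. split; [apply continuous_on_const|]. intros n. apply Cn_const.
Qed.

Lemma smooth_lin X u v (a b : R) :
  smooth X u -> smooth X v -> smooth X (fun x => a * u x + b * v x).
Proof.
  intros Hu Hv. apply smooth_iff_Cn. split.
  - apply continuous_on_lin; now apply smooth_continuous_on.
  - intros n. apply Cn_lin; now apply smooth_Cn.
Qed.

Lemma smooth_plus X u v : smooth X u -> smooth X v -> smooth X (fun x => u x + v x).
Proof.
  intros Hu Hv. apply smooth_ext with (fun x => 1 * u x + 1 * v x).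
  - now apply smooth_lin.
  - intros; ring.
Qed.

Lemma smooth_minus X u v : smooth X u -> smooth X v -> smooth X (fun x => u x - v x).
Proof.
  intros Hu Hv. apply smooth_ext with (fun x => 1 * u x + -1 * v x).
  - now apply smooth_lin.
  - intros; ring.
Qed.

Lemma smooth_mult X u v : smooth X u -> smooth X v -> smooth X (fun x => u x * v x).
Proof.
  intros Hu Hv. apply smooth_iff_Cn. split.
  - apply continuous_on_mult; now apply smooth_continuous_on.
  - intros n. apply Cn_mult; now apply smooth_Cn.
Qed.

Lemma smooth_scal X u (a : R) : smooth X u -> smooth X (fun x => a * u x).
Proof. intros Hu. apply smooth_mult; [apply smooth_const | exact Hu]. Qed.

Lemma D_const X i l (c : R) x :
  dense_interior X -> X x -> D X (l ++ [i]) (fun _ => c) x = 0.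
Proof.
  intros HX Hx. apply (D_unique X (l ++ [i]) (fun _ => c) (fun _ => 0) HX); try easy.
  - apply smooth_const.
  - apply continuous_on_const.
  - intros y Hy. rewrite pds_app. cbn.
    assert (E : forall (j : axis) (d : R), pd j (fun _ => d) = fun _ => 0).
    { intros j d. apply functional_extensionality. intros z.
      unfold pd. apply Derive_const. }
    rewrite E. clear - E.
    assert (Z : pds l (fun _ => 0) = fun _ => 0).
    { induction l as [|j l IH]; [easy|].
      change (pd j (pds l (fun _ => 0)) = fun _ => 0). rewrite IH. apply E. }
    now rewrite Z.
Qed.

Lemma D_lin X l u v (a b : R) x :
  dense_interior X -> smooth X u -> smooth X v -> X x ->
  D X l (fun x => a * u x + b * v x) x = a * D X l u x + b * D X l v x.
Proof.
  intros HX. revert u v x. induction l as [|i l IH] using rev_ind; intros u v x Hu Hv Hx.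
  - rewrite !D_nil; try easy. now apply smooth_lin.
  - assert (Hs := smooth_lin X u v a b Hu Hv).
    rewrite !D_app by easy.
    rewrite <- IH by (try apply smooth_D; assumption).
    apply D_ext; [exact HX | now apply smooth_D | apply smooth_lin; now apply smooth_D | | exact Hx].
    apply D_unique; [exact HX | exact Hs | |].
    + apply continuous_on_lin; now apply D_continuous_on.
    + intros y Hy. rewrite !D_interior by easy. symmetry.
      apply (Cn_lin X 1 u v a b); [now apply smooth_Cn | now apply smooth_Cn | lia | exact Hy].
Qed.

Lemma D_minus X l u v x :
  dense_interior X -> smooth X u -> smooth X v -> X x ->
  D X l (fun x => u x - v x) x = D X l u x - D X l v x.
Proof.
  intros HX Hu Hv Hx.
  rewrite (D_ext X l _ (fun x => 1 * u x + -1 * v x)); try easy.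
  - rewrite D_lin by easy. ring.
  - now apply smooth_minus.
  - now apply smooth_lin.
  - intros; ring.
Qed.

Lemma D_mult X i u v x :
  dense_interior X -> smooth X u -> smooth X v -> X x ->
  D X [i] (fun x => u x * v x) x = D X [i] u x * v x + u x * D X [i] v x.
Proof.
  intros HX Hu Hv Hx.
  apply (D_unique X [i] (fun x => u x * v x) (fun x => D X [i] u x * v x + u x * D X [i] v x));
    try easy.
  - now apply smooth_mult.
  - apply smooth_continuous_on. apply smooth_plus; apply smooth_mult; try easy; now apply smooth_D.
  - intros y Hy. rewrite !D_interior by easy. symmetry.
    apply (Cn_mult X 1 u v); try apply smooth_Cn; try easy; lia.
Qed.

(** ** Superposition *)

Lemma ex_derive_n_Derive (f : R -> R) :
  (forall k y, ex_derive_n f k y) -> forall k y, ex_derive_n (Derive f) k y.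
Proof.
  intros Hf [|k] y; [exact I|].
  apply ex_derive_ext with (Derive_n f (S k)).
  - intros t. rewrite <- (Nat.add_1_r k). symmetry. apply (Derive_n_comp f k 1).
  - exact (Hf (S (S k)) y).
Qed.

(** Chain rule and induction on the order; [Derive f] satisfies the same
    hypothesis as [f]. *)
Lemma Cn_comp X n (f : R -> R) u :
  (forall k y, ex_derive_n f k y) -> Cn X n u ->
  Cn X n (fun x => f (u x)) /\
  forall i x, (0 < n)%nat -> locally x X ->
    pd i (fun x => f (u x)) x = Derive f (u x) * pd i u x.
Proof.
  assert (K : forall f u i x, ex_derive f (u x) -> has_pd i u x ->
    has_pd i (fun x => f (u x)) x /\
    pd i (fun x => f (u x)) x = Derive f (u x) * pd i u x).
  { clear. intros f u i x Hf Hu. apply is_derive_pd.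
    apply pd_is_derive in Hu. rewrite Rmult_comm.
    apply (is_derive_comp f (fun h : R => u (plus x (scal h (dir i))))); [|exact Hu].
    rewrite along_0. now apply Derive_correct. }
  revert f. induction n as [|n IH]; intros f Hf Hu.
  all: assert (C0 : exists h, cont_ext X (fun x => f (u x)) h).
  1, 3: destruct (Cn_0 _ _ _ Hu) as (h & Hh & Ch);
    exists (fun x => f (h x)); split;
    [ intros x Hx; now rewrite Hh
    | apply continuous_on_comp_R; [|easy]; intros y;
      apply ex_derive_continuous_R; apply (Hf 1%nat) ].
  - repeat split; try easy; intros; lia.
  - assert (Hu' := Cn_pred _ _ _ Hu). destruct Hu as [_ Hu]. split.
    + split; [exact C0|]. intros i. destruct (Hu i) as [Du Su]. split.
      * intros x Hx. apply K; [apply (Hf 1%nat) | auto].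
      * assert (Hf' := ex_derive_n_Derive f Hf).
        assert (H1 := proj1 (IH (Derive f) Hf' Hu')).
        apply Cn_ext with (2 := proj1 (Cn_mult X n _ _ H1 Su)).
        intros x Hx. symmetry. apply K; [apply (Hf 1%nat) | auto].
    + intros i x _ Hx. apply K; [apply (Hf 1%nat) | now apply Hu].
Qed.

Lemma smooth_comp X (f : R -> R) u :
  (forall k y, ex_derive_n f k y) -> smooth X u -> smooth X (fun x => f (u x)).
Proof.
  intros Hf Hu. apply smooth_iff_Cn. split.
  - apply continuous_on_comp_R; [|now apply smooth_continuous_on]. intros y.
    apply ex_derive_continuous_R. apply (Hf 1%nat).
  - intros n. apply Cn_comp; [easy | now apply smooth_Cn].
Qed.

Lemma D_comp X i (f : R -> R) u x :
  dense_interior X -> (forall k y, ex_derive_n f k y) -> smooth X u -> X x ->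
  D X [i] (fun x => f (u x)) x = Derive f (u x) * D X [i] u x.
Proof.
  intros HX Hf Hu Hx.
  apply (D_unique X [i] (fun x => f (u x)) (fun x => Derive f (u x) * D X [i] u x)); try easy.
  - now apply smooth_comp.
  - apply smooth_continuous_on. apply smooth_mult; [|now apply smooth_D].
    apply smooth_comp; [|easy]. now apply ex_derive_n_Derive.
  - intros y Hy. rewrite D_interior by easy. symmetry.
    apply (Cn_comp X 1 f u); try apply smooth_Cn; try easy; lia.
Qed.

End Calculus.

(** * Growth in eps *)

Lemma at_right_0_lt (r : R) : 0 < r -> at_right 0 (fun e => 0 < e < r).
Proof.
  intros Hr. exists (mkposreal r Hr). intros y Hy H0. cbn in Hy.
  unfold ball, AbsRing_ball, abs, minus, plus, opp in Hy. cbn in Hy.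
  apply Rabs_def2 in Hy. lra.
Qed.

Lemma Rpower_anti (e a b : R) : 0 < e <= 1 -> a <= b -> Rpower e b <= Rpower e a.
Proof.
  intros He Hab. unfold Rpower.
  assert (Hl : ln e <= 0).
  { rewrite <- ln_1. apply ln_le; lra. }
  destruct (Req_dec (b * ln e) (a * ln e)) as [->|Hne]; [lra|].
  left. apply exp_increasing. nra.
Qed.

Section Growth.

Context {V : NormedModule R_AbsRing}.

Implicit Types (K : V -> Prop) (g h : net V).

Lemma sup_bigO_pos K b g :
  sup_bigO K b g -> exists C, 0 <= C /\ at_right 0 (fun e => 0 < e < 1 /\
    forall x, K x -> Rabs (g e x) <= C * Rpower e b).
Proof.
  intros [C HC]. exists (Rabs C). split; [apply Rabs_pos|].
  assert (H1 := at_right_0_lt 1 Rlt_0_1).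
  apply filter_imp with (2 := filter_and _ _ HC H1).
  intros e [H He]. split; [easy|]. intros x Hx.
  apply Rle_trans with (1 := H x Hx). apply Rmult_le_compat_r.
  - left. apply exp_pos.
  - apply Rle_abs.
Qed.

Lemma sup_bigO_anti K a b g : a <= b -> sup_bigO K b g -> sup_bigO K a g.
Proof.
  intros Hab H. destruct (sup_bigO_pos _ _ _ H) as (C & HC & H').
  exists C. apply filter_imp with (2 := H'). intros e [He H1] x Hx.
  apply Rle_trans with (1 := H1 x Hx). apply Rmult_le_compat_l; [easy|].
  apply Rpower_anti; lra.
Qed.

Lemma sup_bigO_plus K b g h :
  sup_bigO K b g -> sup_bigO K b h -> sup_bigO K b (fun e x => g e x + h e x).
Proof.
  intros [C1 H1] [C2 H2]. exists (C1 + C2).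
  apply filter_imp with (2 := filter_and _ _ H1 H2). intros e [G1 G2] x Hx.
  apply Rle_trans with (1 := Rabs_triang _ _). specialize (G1 x Hx). specialize (G2 x Hx). lra.
Qed.

Lemma sup_bigO_mult K a b g h :
  sup_bigO K a g -> sup_bigO K b h -> sup_bigO K (a + b) (fun e x => g e x * h e x).
Proof.
  intros H1 H2. destruct (sup_bigO_pos _ _ _ H1) as (C1 & _ & G1).
  destruct (sup_bigO_pos _ _ _ H2) as (C2 & _ & G2). exists (C1 * C2).
  apply filter_imp with (2 := filter_and _ _ G1 G2). intros e [[_ G1'] [_ G2']] x Hx.
  rewrite Rabs_mult, Rpower_plus.
  replace (C1 * C2 * (Rpower e a * Rpower e b)) with ((C1 * Rpower e a) * (C2 * Rpower e b)) by ring.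
  apply Rmult_le_compat; auto using Rabs_pos.
Qed.

Lemma sup_bigO_le K b g h :
  at_right 0 (fun e => forall x, K x -> Rabs (g e x) <= Rabs (h e x)) ->
  sup_bigO K b h -> sup_bigO K b g.
Proof.
  intros H [C HC]. exists C.
  apply filter_imp with (2 := filter_and _ _ H HC). intros e [G1 G2] x Hx.
  apply Rle_trans with (1 := G1 x Hx). now apply G2.
Qed.

Lemma sup_bigO_const K (c : R) : sup_bigO K 0 (fun _ _ => c).
Proof.
  exists (Rabs c). apply filter_imp with (2 := at_right_0_lt 1 Rlt_0_1).
  intros e He x _. rewrite Rpower_O by lra. lra.
Qed.

Lemma sup_bigO_0_iff K g :
  sup_bigO K 0 g <-> exists C, at_right 0 (fun e => forall x, K x -> Rabs (g e x) <= C).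
Proof.
  split; intros [C HC]; exists C;
    apply filter_imp with (2 := filter_and _ _ HC (at_right_0_lt 1 Rlt_0_1)).
  - intros e [H He] x Hx. specialize (H x Hx). rewrite Rpower_O in H; lra.
  - intros e [H He] x Hx. specialize (H x Hx). rewrite Rpower_O; lra.
Qed.

(** Moderate growth and boundedness are handled together: the exponents that
    are allowed form a set [Q], which is everything or just [{0}]. *)
Definition rates (Q : R -> Prop) : Prop :=
  Q 0 /\ (forall a b, Q a -> Q b -> Q (a + b)) /\ (forall a b, Q a -> Q b -> Q (Rmin a b)).

Definition any_rate (b : R) : Prop := True.
Definition rate_0 (b : R) : Prop := b = 0.

Lemma rates_any : rates any_rate.
Proof. now repeat split. Qed.

Lemma rates_0 : rates rate_0.
Proof.
  unfold rate_0. split; [easy|]. split; intros a b -> ->; [ring|].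
  apply Rmin_left; lra.
Qed.

Definition grows (Q : R -> Prop) K g : Prop := exists b, Q b /\ sup_bigO K b g.

Definition vanishes K g : Prop := forall a, 0 <= a -> sup_bigO K a g.

Lemma grows_plus Q K g h :
  rates Q -> grows Q K g -> grows Q K h -> grows Q K (fun e x => g e x + h e x).
Proof.
  intros (_ & _ & HQ) (a & Ha & Ga) (b & Hb & Gb). exists (Rmin a b). split; [auto|].
  apply sup_bigO_plus; eapply sup_bigO_anti; try eassumption;
    [apply Rmin_l | apply Rmin_r].
Qed.

Lemma grows_mult Q K g h :
  rates Q -> grows Q K g -> grows Q K h -> grows Q K (fun e x => g e x * h e x).
Proof.
  intros (_ & HQ & _) (a & Ha & Ga) (b & Hb & Gb). exists (a + b). split; [auto|].
  now apply sup_bigO_mult.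
Qed.

Lemma grows_const Q K c : rates Q -> grows Q K (fun _ _ => c).
Proof. intros [H _]. exists 0. split; [easy|]. apply sup_bigO_const. Qed.

Lemma grows_le Q K g h :
  at_right 0 (fun e => forall x, K x -> Rabs (g e x) <= Rabs (h e x)) ->
  grows Q K h -> grows Q K g.
Proof. intros H (b & Hb & G). exists b. split; [easy|]. now apply sup_bigO_le with h. Qed.

Lemma vanishes_plus K g h :
  vanishes K g -> vanishes K h -> vanishes K (fun e x => g e x + h e x).
Proof. intros H1 H2 a Ha. apply sup_bigO_plus; auto. Qed.

(** A factor of size [eps ^ b] is compensated by an arbitrarily high power,
    whatever the sign of [b]. *)
Lemma vanishes_mult K g h :
  vanishes K g -> grows any_rate K h -> vanishes K (fun e x => g e x * h e x).
Proof.
  intros Hg (b & _ & Hh) a Ha.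
  apply sup_bigO_anti with (Rmax 0 (a - b) + b).
  - unfold Rmax. destruct (Rle_dec 0 (a - b)); lra.
  - apply sup_bigO_mult; [|easy]. apply Hg. apply Rmax_l.
Qed.

Lemma vanishes_le K g h :
  at_right 0 (fun e => forall x, K x -> Rabs (g e x) <= Rabs (h e x)) ->
  vanishes K h -> vanishes K g.
Proof. intros H G a Ha. apply sup_bigO_le with h; auto. Qed.

Lemma grows_subset Q K K' g : (forall x, K x -> K' x) -> grows Q K' g -> grows Q K g.
Proof.
  intros HK (b & Hb & C & HC). exists b. split; [easy|]. exists C.
  apply filter_imp with (2 := HC). auto.
Qed.

Lemma eventually_eq_le K g h :
  (forall e, 0 < e <= 1 -> forall x, K x -> g e x = h e x) ->
  at_right 0 (fun e => forall x, K x -> Rabs (g e x) <= Rabs (h e x)).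
Proof.
  intros E. apply filter_imp with (2 := at_right_0_lt 1 Rlt_0_1).
  intros e He x Hx. rewrite E; [lra | lra | easy].
Qed.

End Growth.

(** * Growth of all derivatives *)

Section Control.

Context {V : NormedModule R_AbsRing} {coordV : Coordinates V}.
Variables (X : V -> Prop) (HX : dense_interior X).

Implicit Types (P : net V -> Prop) (J : axis -> Prop) (u v g h : net V).

(** Restricting the axes matters because along a characteristic line only the
    derivatives in the transversal direction are controlled, and bounding the
    order allows for inductions over the equation. *)
Definition Ctl P J (n : nat) u : Prop :=
  forall l, Forall J l -> (length l <= n)%nat -> P (fun e => D X l (u e)).

(** Derivatives on [X] are only determined on [X], and nets are only smooth for
    indices in [(0,1]]; conditions on them must not look elsewhere. *)
Definition on_values P : Prop :=
  forall g h, (forall e, 0 < e <= 1 -> forall x, X x -> g e x = h e x) -> P g -> P h.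

Definition additive P : Prop :=
  forall g h, P g -> P h -> P (fun e x => g e x + h e x).

Definition pairing P1 P2 P3 : Prop :=
  forall g h, P1 g -> P2 h -> P3 (fun e x => g e x * h e x).

Lemma smooth_net_D l u : smooth_net X u -> smooth_net X (fun e => D X l (u e)).
Proof. intros H e He. apply smooth_D. now apply H. Qed.

Lemma smooth_net_plus u v :
  smooth_net X u -> smooth_net X v -> smooth_net X (fun e x => u e x + v e x).
Proof. intros H1 H2 e He. apply smooth_plus; auto. Qed.

Lemma smooth_net_mult u v :
  smooth_net X u -> smooth_net X v -> smooth_net X (fun e x => u e x * v e x).
Proof. intros H1 H2 e He. apply smooth_mult; auto. Qed.

Lemma smooth_net_minus u v :
  smooth_net X u -> smooth_net X v -> smooth_net X (fun e x => u e x - v e x).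
Proof. intros H1 H2 e He. apply smooth_minus; auto. Qed.

Lemma Ctl_ext P J n u v :
  on_values P -> smooth_net X u ->
  (forall e, 0 < e <= 1 -> forall x, X x -> u e x = v e x) ->
  Ctl P J n u -> Ctl P J n v.
Proof.
  intros HP Hu E H l Hl Hn. apply HP with (2 := H l Hl Hn).
  intros e He x Hx. assert (Sv : smooth X (v e)) by (apply smooth_ext with (u e); auto).
  apply D_ext; auto.
Qed.

Lemma Ctl_le P J n m u : (m <= n)%nat -> Ctl P J n u -> Ctl P J m u.
Proof. intros Hmn H l Hl Hm. apply H; [easy | lia]. Qed.

Lemma Ctl_imp P P' J J' n u :
  (forall g, P g -> P' g) -> (forall i, J' i -> J i) -> Ctl P J n u -> Ctl P' J' n u.
Proof.
  intros HP HJ H l Hl Hm. apply HP. apply H; [|easy].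
  now apply Forall_impl with J'.
Qed.

Lemma Ctl_value P J n u :
  on_values P -> smooth_net X u -> Ctl P J n u -> P u.
Proof.
  intros HP Hu H. apply HP with (2 := H [] (Forall_nil J) (Nat.le_0_l n)).
  intros e He x Hx. apply D_nil; auto.
Qed.

Lemma Ctl_0 P J u : on_values P -> smooth_net X u -> P u -> Ctl P J 0 u.
Proof.
  intros HP Hu H [|i l] Hl Hn; [|cbn in Hn; lia].
  apply HP with (2 := H). intros e He x Hx. symmetry. apply D_nil; auto.
Qed.

Lemma Ctl_D P J n m l u :
  on_values P -> smooth_net X u -> Forall J l -> (n + length l <= m)%nat ->
  Ctl P J m u -> Ctl P J n (fun e => D X l (u e)).
Proof.
  intros HP Hu Hl Hm H l' Hl' Hn.
  apply HP with (fun e => D X (l' ++ l) (u e)).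
  - intros e He x Hx. apply D_app; auto.
  - apply H; [now apply Forall_app|]. rewrite length_app. lia.
Qed.

Lemma Ctl_S P J n u :
  on_values P -> smooth_net X u -> P u ->
  (forall i, J i -> Ctl P J n (fun e => D X [i] (u e))) -> Ctl P J (S n) u.
Proof.
  intros HP Hu H0 H l. destruct l as [|i l] using rev_ind; intros Hl Hn.
  - apply HP with (2 := H0). intros e He x Hx. symmetry. apply D_nil; auto.
  - clear IHl. rewrite length_app in Hn. cbn in Hn.
    apply Forall_app in Hl. destruct Hl as [Hl Hi].
    apply HP with (fun e => D X l (D X [i] (u e))).
    + intros e He x Hx. symmetry. apply D_app; auto.
    + apply H; [now inversion Hi | easy | lia].
Qed.

Lemma Ctl_plus P J n u v :
  on_values P -> additive P -> smooth_net X u -> smooth_net X v ->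
  Ctl P J n u -> Ctl P J n v -> Ctl P J n (fun e x => u e x + v e x).
Proof.
  intros HP HA Hu Hv H1 H2 l Hl Hn.
  apply HP with (2 := HA _ _ (H1 l Hl Hn) (H2 l Hl Hn)).
  intros e He x Hx. assert (Su := Hu e He). assert (Sv := Hv e He).
  rewrite (D_ext X l (fun x => u e x + v e x) (fun x => 1 * u e x + 1 * v e x)); try easy.
  - rewrite D_lin by easy. ring.
  - now apply smooth_plus.
  - now apply smooth_lin.
  - intros; ring.
Qed.

(** Leibniz rule, one derivative at a time.  The three predicates allow for
    products within one growth class as well as for products of negligible and
    moderate nets. *)
Lemma Ctl_mult P1 P2 P3 J n u v :
  on_values P1 -> on_values P2 -> on_values P3 -> additive P3 -> pairing P1 P2 P3 ->
  smooth_net X u -> smooth_net X v ->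
  Ctl P1 J n u -> Ctl P2 J n v -> Ctl P3 J n (fun e x => u e x * v e x).
Proof.
  intros L1 L2 L3 A3 HM. revert u v. induction n as [|n IH]; intros u v Hu Hv H1 H2.
  - apply Ctl_0; [easy | now apply smooth_net_mult |].
    apply HM; eapply Ctl_value; eassumption.
  - assert (H0 : P3 (fun e x => u e x * v e x)).
    { apply HM; eapply Ctl_value; eassumption. }
    apply Ctl_S; [easy | now apply smooth_net_mult | easy |].
    intros i Hi.
    assert (Hi' : Forall J [i]) by (constructor; [easy | constructor]).
    assert (Su := smooth_net_D [i] u Hu). assert (Sv := smooth_net_D [i] v Hv).
    assert (C1 : Ctl P3 J n (fun e x => D X [i] (u e) x * v e x)).
    { apply IH; try easy.
      - apply Ctl_D with (S n); try easy; cbn; lia.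
      - apply Ctl_le with (S n); [lia | easy]. }
    assert (C2 : Ctl P3 J n (fun e x => u e x * D X [i] (v e) x)).
    { apply IH; try easy.
      - apply Ctl_le with (S n); [lia | easy].
      - apply Ctl_D with (S n); try easy; cbn; lia. }
    apply Ctl_ext with (fun e x => D X [i] (u e) x * v e x + u e x * D X [i] (v e) x); try easy.
    + apply smooth_net_plus; now apply smooth_net_mult.
    + intros e He x Hx. symmetry. apply D_mult; auto.
    + apply Ctl_plus; try easy; now apply smooth_net_mult.
Qed.

Lemma smooth_net_comp (f : R -> R) u :
  (forall k y, ex_derive_n f k y) -> smooth_net X u -> smooth_net X (fun e x => f (u e x)).
Proof. intros Hf Hu e He. apply smooth_comp; auto. Qed.

Lemma Derive_n_Derive (f : R -> R) k x : Derive_n (Derive f) k x = Derive_n f (S k) x.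
Proof. rewrite <- (Nat.add_1_r k). apply (Derive_n_comp f k 1). Qed.

(** Faa di Bruno's formula without its combinatorics: one derivative turns
    [f(u)] into the product of [f'(u)] and a derivative of [u], to which the
    induction hypothesis for [f'] and the product rule apply. *)
Lemma Ctl_comp P J n (f : R -> R) u :
  on_values P -> additive P -> pairing P P P -> smooth_net X u ->
  (forall k y, ex_derive_n f k y) ->
  (forall k, (k <= n)%nat -> P (fun e x => Derive_n f k (u e x))) ->
  Ctl P J n u -> Ctl P J n (fun e x => f (u e x)).
Proof.
  intros LP AP MP Hu. revert f. induction n as [|n IH]; intros f Hf HPf H.
  - apply Ctl_0; [easy | now apply smooth_net_comp | apply (HPf 0%nat); lia].
  - apply Ctl_S; [easy | now apply smooth_net_comp | apply (HPf 0%nat); lia |].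
    intros i Hi.
    assert (Hf' := ex_derive_n_Derive f Hf).
    assert (Hi' : Forall J [i]) by (constructor; [easy | constructor]).
    apply Ctl_ext with (fun e x => Derive f (u e x) * D X [i] (u e) x); try easy.
    + apply smooth_net_mult; [now apply smooth_net_comp | now apply smooth_net_D].
    + intros e He x Hx. symmetry. apply D_comp; auto.
    + apply Ctl_mult with P P; try easy.
      * now apply smooth_net_comp.
      * now apply smooth_net_D.
      * apply IH; [easy| |apply Ctl_le with (S n); [lia | easy]].
        intros k Hk. apply LP with (fun e x => Derive_n f (S k) (u e x)).
        -- intros. symmetry. apply Derive_n_Derive.
        -- apply HPf. lia.
      * apply Ctl_D with (S n); try easy; cbn; lia.
Qed.

Lemma on_values_grows Q K : (forall x, K x -> X x) -> on_values (grows Q K).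
Proof.
  intros HK g h E. apply grows_le. apply eventually_eq_le.
  intros e He x Hx. symmetry. auto.
Qed.

Lemma on_values_vanishes K : (forall x, K x -> X x) -> on_values (vanishes K).
Proof.
  intros HK g h E. apply vanishes_le. apply eventually_eq_le.
  intros e He x Hx. symmetry. auto.
Qed.

Lemma additive_grows Q K : rates Q -> additive (grows Q K).
Proof. intros HQ g h. now apply grows_plus. Qed.

Lemma additive_vanishes K : additive (vanishes K).
Proof. intros g h. now apply vanishes_plus. Qed.

Lemma pairing_grows Q K : rates Q -> pairing (grows Q K) (grows Q K) (grows Q K).
Proof. intros HQ g h. now apply grows_mult. Qed.

Lemma pairing_vanishes K : pairing (vanishes K) (grows any_rate K) (vanishes K).
Proof. intros g h. apply vanishes_mult. Qed.

Definition all_axes (i : axis) : Prop := True.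

Lemma Forall_all_axes (l : list axis) : Forall all_axes l.
Proof. induction l; now constructor. Qed.

Lemma moderate_iff u :
  moderate X u <-> smooth_net X u /\
    forall K n, compact_in X K -> Ctl (grows any_rate K) all_axes n u.
Proof.
  split; intros [H1 H2]; split; try easy.
  - intros K n HK l _ _. destruct (H2 K l HK) as [b Hb]. now exists b.
  - intros K l HK. destruct (H2 K _ HK l (Forall_all_axes l) (le_n _)) as (b & _ & Hb).
    now exists b.
Qed.

Lemma negligible_iff u :
  negligible X u <-> smooth_net X u /\
    forall K n, compact_in X K -> Ctl (vanishes K) all_axes n u.
Proof.
  split; intros [H1 H2]; split; try easy.
  - intros K n HK l _ _ a Ha. now apply H2.
  - intros K l a HK Ha. now apply (H2 K _ HK l (Forall_all_axes l) (le_n _)).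
Qed.

Lemma negligible_mult u v :
  negligible X u -> moderate X v -> negligible X (fun e x => u e x * v e x).
Proof.
  rewrite !moderate_iff, !negligible_iff. intros [Su Cu] [Sv Cv]. split.
  - now apply smooth_net_mult.
  - intros K n HK.
    apply Ctl_mult with (vanishes K) (grows any_rate K); auto;
      try (apply on_values_vanishes; apply HK); try (apply on_values_grows; apply HK).
    + apply additive_vanishes.
    + apply pairing_vanishes.
Qed.

Lemma negligible_plus u v :
  negligible X u -> negligible X v -> negligible X (fun e x => u e x + v e x).
Proof.
  rewrite !negligible_iff. intros [Su Cu] [Sv Cv]. split.
  - now apply smooth_net_plus.
  - intros K n HK. apply Ctl_plus; auto.
    + apply on_values_vanishes; apply HK.
    + apply additive_vanishes.
Qed.

Lemma negligible_ext u v :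
  negligible X u -> (forall e, 0 < e <= 1 -> forall x, X x -> u e x = v e x) -> negligible X v.
Proof.
  intros [Su Cu] E. assert (Sv : smooth_net X v).
  { intros e He. apply smooth_ext with (u e); auto. }
  split; [easy|]. intros K l a HK Ha.
  apply sup_bigO_le with (2 := Cu K l a HK Ha). apply eventually_eq_le.
  intros e He x Hx. apply HK in Hx. symmetry. apply D_ext; auto.
Qed.

(** Multiplication by a generalized number is multiplication by a net of
    constant functions. *)
Lemma moderate_num (r : R -> R) : num_moderate r -> moderate X (fun e _ => r e).
Proof.
  intros [b [C HC]]. split; [intros e He; apply smooth_const|]. intros K l HK.
  destruct l as [|i l] using rev_ind.
  - exists b. exists C.
    apply filter_imp with (2 := filter_and _ _ HC (at_right_0_lt 1 Rlt_0_1)).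
    intros e [H He] x Hx. rewrite D_nil; auto; [apply smooth_const | now apply HK].
  - exists 0. apply sup_bigO_le with (2 := sup_bigO_const K 0).
    apply eventually_eq_le. intros e He x Hx. apply D_const; [easy | now apply HK].
Qed.

Lemma vanishes_0 (K : V -> Prop) : vanishes K (fun _ _ => 0).
Proof.
  intros a Ha. exists 0. apply filter_forall. intros e x _. rewrite Rabs_R0. lra.
Qed.

Lemma negligible_num (r : R -> R) : num_negligible r -> negligible X (fun e _ => r e).
Proof.
  intros H. split; [intros e He; apply smooth_const|]. intros K l a HK Ha.
  destruct l as [|i l] using rev_ind.
  - destruct (H a Ha) as [C HC]. exists C.
    apply filter_imp with (2 := filter_and _ _ HC (at_right_0_lt 1 Rlt_0_1)).
    intros e [H' He] x Hx. rewrite D_nil; auto; [apply smooth_const | now apply HK].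
  - apply sup_bigO_le with (2 := vanishes_0 K a Ha).
    apply eventually_eq_le. intros e He x Hx. apply D_const; [easy | now apply HK].
Qed.

Lemma negligible_scal u (c : R) : negligible X u -> negligible X (fun e x => c * u e x).
Proof.
  intros Hu. apply negligible_ext with (fun e x => u e x * c).
  - apply (negligible_mult u (fun _ _ => c)); [easy|]. apply moderate_num.
    exists 0. exists (Rabs c). apply filter_imp with (2 := at_right_0_lt 1 Rlt_0_1).
    intros e He. rewrite Rpower_O; lra.
  - intros; ring.
Qed.

Lemma negligible_minus u v :
  negligible X u -> negligible X v -> negligible X (fun e x => u e x - v e x).
Proof.
  intros Hu Hv. apply negligible_ext with (fun e x => u e x + -1 * v e x).
  - apply negligible_plus; [easy|]. now apply negligible_scal.
  - intros; ring.
Qed.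

Lemma moderate_D l u : moderate X u -> moderate X (fun e => D X l (u e)).
Proof.
  intros [Su Cu]. split; [now apply smooth_net_D|]. intros K l' HK.
  destruct (Cu K (l' ++ l) HK) as [b Hb]. exists b.
  apply sup_bigO_le with (2 := Hb). apply eventually_eq_le.
  intros e He x Hx. apply HK in Hx. symmetry. apply D_app; auto.
Qed.

(** Derivatives, and below superposition, respect equality of classes, so that
    the operations on classes can be computed with one representative. *)
Lemma negligible_D_diff l u v :
  moderate X u -> moderate X v -> negligible X (fun e x => u e x - v e x) ->
  negligible X (fun e x => D X l (u e) x - D X l (v e) x).
Proof.
  intros [Su _] [Sv _] [_ C]. split.
  - apply smooth_net_minus; now apply smooth_net_D.
  - intros K l' a HK Ha. apply sup_bigO_le with (2 := C K (l' ++ l) a HK Ha).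
    apply eventually_eq_le. intros e He x Hx. apply HK in Hx.
    assert (Du := smooth_D X l _ (Su e He)). assert (Dv := smooth_D X l _ (Sv e He)).
    rewrite !D_minus, !D_app; auto.
Qed.

(** ** Superposition with functions of polynomial growth *)

Lemma O_M_Derive (f : R -> R) : O_M f -> O_M (Derive f).
Proof.
  intros [H1 H2]. split; [now apply ex_derive_n_Derive|].
  intros n. destruct (H2 (S n)) as (C & m & H). exists C, m.
  intros x. rewrite Derive_n_Derive. apply H.
Qed.

Lemma grows_pow Q K g m : rates Q -> grows Q K g -> grows Q K (fun e x => g e x ^ m).
Proof.
  intros HQ Hg. induction m as [|m IH]; cbn.
  - now apply grows_const.
  - now apply grows_mult.
Qed.

Lemma grows_abs Q K g : grows Q K g -> grows Q K (fun e x => Rabs (g e x)).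
Proof.
  apply grows_le. apply filter_forall. intros e x _. rewrite Rabs_Rabsolu. lra.
Qed.

Lemma grows_O_M Q K (f : R -> R) n u :
  rates Q -> O_M f -> grows Q K u -> grows Q K (fun e x => Derive_n f n (u e x)).
Proof.
  intros HQ [_ Hf] Hu. destruct (Hf n) as (C & m & H).
  apply grows_le with (fun e x => C * (1 + Rabs (u e x)) ^ m).
  - apply filter_forall. intros e x _. apply Rle_trans with (1 := H _). apply Rle_abs.
  - apply grows_mult with (g := fun _ _ => C); [easy | now apply grows_const |].
    apply grows_pow with (g := fun e x => 1 + Rabs (u e x)); [easy|].
    apply grows_plus with (g := fun _ _ => 1); [easy | now apply grows_const |].
    now apply grows_abs.
Qed.

Lemma moderate_comp (f : R -> R) u : O_M f -> moderate X u -> moderate X (fun e x => f (u e x)).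
Proof.
  rewrite !moderate_iff. intros Hf [Su Cu]. split.
  - apply smooth_net_comp; [apply Hf | easy].
  - intros K n HK. assert (LP := on_values_grows any_rate K (proj2 HK)).
    apply Ctl_comp; auto; try apply Hf.
    + apply additive_grows, rates_any.
    + apply pairing_grows, rates_any.
    + intros k _. apply grows_O_M; [apply rates_any | easy |].
      now apply Ctl_value with all_axes n; auto.
Qed.

Lemma O_M_lipschitz (f : R -> R) :
  O_M f -> exists C m, forall x y,
    Rabs (f x - f y) <= Rabs (x - y) * (C * (1 + (Rabs x + Rabs y)) ^ m).
Proof.
  intros Hf. destruct (proj2 Hf 1%nat) as (C & m & H). exists C, m. intros x y.
  destruct (MVT_gen f y x (Derive f)) as (c & Hc & E).
  - intros z _. apply Derive_correct. apply (proj1 Hf 1%nat).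
  - intros z _. apply continuity_pt_filterlim.
    apply ex_derive_continuous_R. apply (proj1 Hf 1%nat).
  - rewrite E, Rabs_mult, Rmult_comm. apply Rmult_le_compat_l; [apply Rabs_pos|].
    apply Rle_trans with (1 := H c).
    assert (HC : 0 <= C).
    { specialize (H 0). rewrite Rabs_R0, Rplus_0_r, pow1 in H.
      assert (H' := Rabs_pos (Derive_n f 1 0)). lra. }
    apply Rmult_le_compat_l; [easy|]. apply pow_incr. split.
    + assert (H' := Rabs_pos c). lra.
    + apply Rplus_le_compat_l. revert Hc. unfold Rmin, Rmax.
      destruct (Rle_dec y x); unfold Rabs; repeat destruct Rcase_abs; lra.
Qed.

(** Mean value theorem: the Lipschitz constant of [f] between the two values
    grows polynomially, hence is moderate. *)
Lemma vanishes_comp_diff K (f : R -> R) u v :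
  O_M f -> grows any_rate K u -> grows any_rate K v ->
  vanishes K (fun e x => u e x - v e x) ->
  vanishes K (fun e x => f (u e x) - f (v e x)).
Proof.
  intros Hf Hu Hv H. destruct (O_M_lipschitz f Hf) as (C & m & L).
  apply vanishes_le with (fun e x => (u e x - v e x) * (C * (1 + (Rabs (u e x) + Rabs (v e x))) ^ m)).
  - apply filter_forall. intros e x _. apply Rle_trans with (1 := L _ _).
    rewrite Rabs_mult. apply Rmult_le_compat_l; [apply Rabs_pos | apply Rle_abs].
  - apply vanishes_mult; [easy|]. assert (HQ := rates_any).
    apply grows_mult with (g := fun _ _ => C); [easy | now apply grows_const |].
    apply grows_pow with (g := fun e x => 1 + (Rabs (u e x) + Rabs (v e x))); [easy|].
    apply grows_plus with (g := fun _ _ => 1); [easy | now apply grows_const |].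
    apply grows_plus; [easy | |]; now apply grows_abs.
Qed.

(** Every derivative of [f(u) - f(v)] is handled through
    [D(f(u) - f(v)) = (f'(u) - f'(v)) Du + f'(v) (Du - Dv)]. *)
Lemma Ctl_comp_diff K n (f : R -> R) u v :
  (forall x, K x -> X x) -> smooth_net X u -> smooth_net X v -> O_M f ->
  Ctl (grows any_rate K) all_axes n u -> Ctl (grows any_rate K) all_axes n v ->
  Ctl (vanishes K) all_axes n (fun e x => u e x - v e x) ->
  Ctl (vanishes K) all_axes n (fun e x => f (u e x) - f (v e x)).
Proof.
  intros HK Su Sv. assert (LN := on_values_vanishes K HK).
  assert (LM := on_values_grows any_rate K HK). assert (RA := rates_any).
  revert f. induction n as [|n IH]; intros f Hf Cu Cv C.
  all: assert (Sf : smooth_net X (fun e x => f (u e x) - f (v e x)))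
    by (apply smooth_net_minus; apply smooth_net_comp; try apply Hf; easy).
  all: assert (P0 : vanishes K (fun e x => f (u e x) - f (v e x)))
    by (apply vanishes_comp_diff; try easy; eapply Ctl_value; eauto; now apply smooth_net_minus).
  - now apply Ctl_0.
  - apply Ctl_S; try easy. intros i _.
    assert (Hf' := O_M_Derive f Hf).
    assert (Sfu : smooth_net X (fun e x => Derive f (u e x))) by (apply smooth_net_comp; [apply Hf' | easy]).
    assert (Sfv : smooth_net X (fun e x => Derive f (v e x))) by (apply smooth_net_comp; [apply Hf' | easy]).
    assert (Du := smooth_net_D [i] u Su). assert (Dv := smooth_net_D [i] v Sv).
    apply Ctl_ext with (fun e x =>
      (Derive f (u e x) - Derive f (v e x)) * D X [i] (u e) x +
      (D X [i] (u e) x - D X [i] (v e) x) * Derive f (v e x)); try easy.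
    + apply smooth_net_plus; apply smooth_net_mult; try easy; now apply smooth_net_minus.
    + intros e He x Hx.
      rewrite D_minus; auto; try (apply smooth_comp; auto; apply Hf).
      rewrite !D_comp; auto; try apply Hf. ring.
    + apply Ctl_plus; try easy.
      * apply additive_vanishes.
      * apply smooth_net_mult; try easy; now apply smooth_net_minus.
      * apply smooth_net_mult; try easy; now apply smooth_net_minus.
      * apply Ctl_mult with (vanishes K) (grows any_rate K); try easy.
        -- apply additive_vanishes.
        -- apply pairing_vanishes.
        -- now apply smooth_net_minus.
        -- apply IH; try easy; apply Ctl_le with (S n); try easy; lia.
        -- apply Ctl_D with (S n); try easy; [apply Forall_all_axes | cbn; lia].
      * apply Ctl_mult with (vanishes K) (grows any_rate K); try easy.
        -- apply additive_vanishes.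
        -- apply pairing_vanishes.
        -- now apply smooth_net_minus.
        -- apply Ctl_ext with (fun e => D X [i] (fun x => u e x - v e x)); try easy.
           ++ apply (smooth_net_D [i] (fun e x => u e x - v e x)). now apply smooth_net_minus.
           ++ intros e He x Hx. apply D_minus; auto.
           ++ apply (Ctl_D _ _ _ (S n) [i] (fun e x => u e x - v e x)); try easy;
                [now apply smooth_net_minus | apply Forall_all_axes | cbn; lia].
        -- apply Ctl_comp; try easy.
           ++ now apply additive_grows.
           ++ now apply pairing_grows.
           ++ apply Hf'.
           ++ intros k _. apply grows_O_M; try easy. eapply Ctl_value; eauto.
           ++ apply Ctl_le with (S n); try easy; lia.
Qed.

Lemma negligible_comp_diff (f : R -> R) u v :
  O_M f -> moderate X u -> moderate X v -> negligible X (fun e x => u e x - v e x) ->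
  negligible X (fun e x => f (u e x) - f (v e x)).
Proof.
  rewrite !moderate_iff, !negligible_iff. intros Hf [Su Cu] [Sv Cv] [_ C]. split.
  - apply smooth_net_minus; apply smooth_net_comp; try apply Hf; easy.
  - intros K n HK. apply Ctl_comp_diff; auto. apply HK.
Qed.

(** ** Classes *)

Lemma negligible_0 : negligible X (fun _ _ => 0).
Proof.
  split; [intros e He; apply smooth_const|]. intros K l a HK Ha.
  apply sup_bigO_le with (2 := vanishes_0 K a Ha).
  apply eventually_eq_le. intros e He x Hx. apply HK in Hx.
  destruct l as [|i l] using rev_ind.
  - rewrite D_nil; auto. apply smooth_const.
  - now apply D_const.
Qed.

Lemma negligible_refl u : smooth_net X u -> negligible X (fun e x => u e x - u e x).
Proof.
  intros _. apply negligible_ext with (1 := negligible_0). intros; ring.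
Qed.

Lemma negligible_sym u v :
  negligible X (fun e x => u e x - v e x) -> negligible X (fun e x => v e x - u e x).
Proof.
  intros H. apply negligible_ext with (1 := negligible_scal _ (-1) H). intros; ring.
Qed.

Lemma negligible_trans v u w :
  negligible X (fun e x => u e x - v e x) -> negligible X (fun e x => v e x - w e x) ->
  negligible X (fun e x => u e x - w e x).
Proof.
  intros H1 H2. apply negligible_ext with (1 := negligible_plus _ _ H1 H2). intros; ring.
Qed.

Lemma cls_refl u : moderate X u -> cls X u u.
Proof. intros H. split; [easy|]. apply negligible_refl. apply H. Qed.

Lemma cls_eq u v : negligible X (fun e x => u e x - v e x) -> cls X u = cls X v.
Proof.
  intros H. apply functional_extensionality. intros w. apply propositional_extensionality.
  split; intros [Hw Hn]; split; try easy.
  - now apply negligible_trans with u.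
  - apply negligible_trans with v; [easy | now apply negligible_sym].
Qed.

End Control.

Lemma lift_cls {V W : NormedModule R_AbsRing} {coordV : Coordinates V} {coordW : Coordinates W}
    (X : V -> Prop) (Y : W -> Prop) (F : net V -> net W) (u : net V) :
  dense_interior X -> dense_interior Y -> moderate X u ->
  (forall u', cls X u u' -> negligible Y (fun e x => F u' e x - F u e x)) ->
  lift Y F (cls X u) = cls Y (F u).
Proof.
  intros HX HY Hu HF. apply functional_extensionality. intros w.
  apply propositional_extensionality. split.
  - intros (u' & Hu' & Hw). now rewrite <- (cls_eq Y HY _ _ (HF u' Hu')).
  - intros Hw. exists u. split; [now apply cls_refl | easy].
Qed.

(** * Smooth functions on the whole line and on the whole plane *)

Section Whole.

Context {V : NormedModule R_AbsRing} {coordV : Coordinates V}.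

Definition whole : V -> Prop := fun _ => True.

Implicit Types u v : V -> R.

Lemma locally_whole (x : V) : locally x whole.
Proof. now apply filter_forall. Qed.

Lemma dense_whole : dense_interior whole.
Proof.
  intros x _ P HP. exists x. split; [now apply locally_singleton | apply locally_whole].
Qed.

Lemma continuous_on_whole u : continuous_on whole u <-> forall x, continuous u x.
Proof.
  split; intros H.
  - intros x. apply continuous_continuous_on with whole; [apply locally_whole | easy].
  - now apply continuous_on_forall.
Qed.

Lemma Cn_whole_continuous n u : Cn whole n u -> forall x, continuous u x.
Proof.
  intros H x. destruct (Cn_0 _ _ _ H) as (h & E & C).
  apply continuous_ext with h; [intros y; apply E, locally_whole|].
  now apply continuous_on_whole.
Qed.

Lemma Cn_whole_0 u : (forall x, continuous u x) -> Cn whole 0 u.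
Proof.
  intros H. split; [|easy]. exists u. split; [easy|]. now apply continuous_on_whole.
Qed.

Lemma Cn_whole_S n u :
  (forall x, continuous u x) ->
  (forall i, (forall x, has_pd i u x) /\ Cn whole n (pd i u)) -> Cn whole (S n) u.
Proof.
  intros H H'. split.
  - exists u. split; [easy|]. now apply continuous_on_whole.
  - intros i. split; [intros x _; apply H' | apply H'].
Qed.

Lemma Cn_whole_pd n u i x : Cn whole (S n) u -> has_pd i u x.
Proof. intros [_ H]. apply H, locally_whole. Qed.

Lemma Cn_whole_ext n u v : (forall x, u x = v x) -> Cn whole n u -> Cn whole n v.
Proof. intros E. apply Cn_ext. auto. Qed.

Lemma smooth_whole u : smooth whole u <-> forall n, Cn whole n u.
Proof.
  rewrite smooth_iff_Cn. split; [easy|]. intros H. split; [|easy].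
  apply continuous_on_whole. now apply Cn_whole_continuous with 0%nat.
Qed.

Lemma D_whole l u x : smooth whole u -> D whole l u x = pds l u x.
Proof. intros H. apply D_interior; [easy | apply locally_whole]. Qed.

Lemma smooth_whole_pd i u : smooth whole u -> smooth whole (pd i u).
Proof.
  rewrite !smooth_whole. intros H n. now apply (H (S n)).
Qed.

Lemma smooth_whole_has_pd i u x : smooth whole u -> has_pd i u x.
Proof. rewrite smooth_whole. intros H. now apply (Cn_whole_pd 0). Qed.

Lemma smooth_whole_continuous u x : smooth whole u -> continuous u x.
Proof. rewrite smooth_whole. intros H. now apply (Cn_whole_continuous 0). Qed.

End Whole.

(** ** Functions on the line *)

Definition ax1 : @axis line R_coordinates := tt.

Lemma is_derive_shift (u : R -> R) (x d : R) :
  is_derive u x d <-> is_derive (fun h : R => u (plus x (scal h 1))) 0 d.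
Proof.
  split; intros H.
  - rewrite <- (Rmult_1_l d).
    apply (is_derive_comp u (fun h : R => plus x (scal h 1))).
    + replace (plus x (scal 0 1)) with x; [easy|].
      unfold plus, scal; cbn; unfold mult; cbn; ring.
    + unfold plus, scal; cbn; unfold mult; cbn. auto_derive; [easy | ring].
  - assert (H' : is_derive (fun y : R => u (plus x (scal (y - x) 1))) x (1 * d)).
    { apply (is_derive_comp (fun h : R => u (plus x (scal h 1))) (fun y => y - x)).
      - now rewrite Rminus_diag.
      - auto_derive; [easy | ring]. }
    rewrite Rmult_1_l in H'. apply is_derive_ext with (2 := H').
    intros t. f_equal. unfold plus, scal; cbn; unfold mult; cbn; ring.
Qed.

Lemma has_pd_line (u : line -> R) (x : R) : has_pd ax1 u x <-> ex_derive u x.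
Proof.
  split; intros [d Hd]; exists d; [apply (proj2 (is_derive_shift u x d)) | apply (proj1 (is_derive_shift u x d))]; exact Hd.
Qed.

Lemma pd_line (u : line -> R) (x : R) : has_pd ax1 u x -> pd ax1 u x = Derive u x.
Proof.
  intros H. symmetry. apply is_derive_unique, is_derive_shift. now apply pd_is_derive in H.
Qed.

Lemma smooth_line_iff (u : line -> R) :
  smooth (V := line) whole u <-> forall k x, ex_derive_n u k x.
Proof.
  split.
  - intros H k. revert u H. assert (K : forall k u, smooth (V := line) whole u ->
      (forall x, Derive_n u k x = pds (repeat ax1 k) u x) /\ smooth (V := line) whole (pds (repeat ax1 k) u)).
    { clear. induction k as [|k IH]; intros u H; [easy|].
      destruct (IH u H) as [E S]. split.
      - intros x. cbn -[pd]. change (Derive (Derive_n u k) x = pd ax1 (pds (repeat ax1 k) u) x).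
        rewrite pd_line.
        + now apply Derive_ext.
        + now apply smooth_whole_has_pd.
      - now apply smooth_whole_pd. }
    intros u H x. destruct k as [|k]; [easy|]. cbn.
    apply ex_derive_ext with (pds (repeat ax1 k) u).
    + intros t. symmetry. now apply K.
    + apply has_pd_line, smooth_whole_has_pd. now apply K.
  - intros H. apply smooth_whole. intros n. revert u H.
    induction n as [|n IH]; intros u H.
    all: assert (C : forall x, continuous u x)
      by (intros x; apply ex_derive_continuous_R; apply (H 1%nat)).
    + now apply Cn_whole_0.
    + apply Cn_whole_S; [easy|]. intros [].
      assert (P : forall x, has_pd ax1 u x) by (intros x; apply has_pd_line, (H 1%nat)).
      split; [easy|]. apply Cn_whole_ext with (Derive u).
      * intros x. symmetry. now apply pd_line.
      * apply IH. now apply ex_derive_n_Derive.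
Qed.

Lemma smooth_line_ex_derive (u : line -> R) x : smooth whole u -> ex_derive u x.
Proof. intros H. apply has_pd_line. now apply smooth_whole_has_pd. Qed.

Lemma D_line_1 (u : line -> R) x : smooth whole u -> D (V := line) whole [ax1] u x = Derive u x.
Proof.
  intros H. rewrite D_whole by easy. apply pd_line. now apply smooth_whole_has_pd.
Qed.

Lemma smooth_line_Derive (u : line -> R) : smooth whole u -> smooth whole (Derive u).
Proof. rewrite !smooth_line_iff. apply ex_derive_n_Derive. Qed.

(** ** Functions on the plane *)

Notation Dtx := (D (coordV := R2_coordinates)).
Notation Dt := (Dtx whole [ax_t]).
Notation Dx := (Dtx whole [ax_x]).

Lemma is_derive_shift_t (u : plane -> R) (x y d : R) :
  is_derive (fun s : R => u (s, y)) x d <->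
  is_derive (fun h : R => u (plus (x, y) (scal h (dir ax_t)))) 0 d.
Proof.
  rewrite (is_derive_shift (fun s => u (s, y))).
  split; apply is_derive_ext; intros h; f_equal;
    unfold plus, scal, dir; cbn; unfold prod_plus, prod_scal; cbn;
    unfold plus, scal; cbn; unfold mult; cbn; f_equal; ring.
Qed.

Lemma is_derive_shift_x (u : plane -> R) (x y d : R) :
  is_derive (fun s : R => u (x, s)) y d <->
  is_derive (fun h : R => u (plus (x, y) (scal h (dir ax_x)))) 0 d.
Proof.
  rewrite (is_derive_shift (fun s => u (x, s))).
  split; apply is_derive_ext; intros h; f_equal;
    unfold plus, scal, dir; cbn; unfold prod_plus, prod_scal; cbn;
    unfold plus, scal; cbn; unfold mult; cbn; f_equal; ring.
Qed.

Lemma pd_t_is_derive (u : plane -> R) (x y : R) :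
  has_pd ax_t u (x, y) -> is_derive (fun s : R => u (s, y)) x (pd ax_t u (x, y)).
Proof.
  intros H. apply (proj2 (is_derive_shift_t u x y _)). exact (pd_is_derive ax_t u (x, y) H).
Qed.

Lemma pd_x_is_derive (u : plane -> R) (x y : R) :
  has_pd ax_x u (x, y) -> is_derive (fun s : R => u (x, s)) y (pd ax_x u (x, y)).
Proof.
  intros H. apply (proj2 (is_derive_shift_x u x y _)). exact (pd_is_derive ax_x u (x, y) H).
Qed.

Lemma is_derive_pd_t (u : plane -> R) (x y d : R) :
  is_derive (fun s : R => u (s, y)) x d -> has_pd ax_t u (x, y) /\ pd ax_t u (x, y) = d.
Proof.
  intros H. apply is_derive_pd. exact (proj1 (is_derive_shift_t u x y d) H).
Qed.

Lemma is_derive_pd_x (u : plane -> R) (x y d : R) :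
  is_derive (fun s : R => u (x, s)) y d -> has_pd ax_x u (x, y) /\ pd ax_x u (x, y) = d.
Proof.
  intros H. apply is_derive_pd. exact (proj1 (is_derive_shift_x u x y d) H).
Qed.

Lemma continuous_pair {T : UniformSpace} (a b : T -> R) (x : T) :
  continuous a x -> continuous b x ->
  continuous (U := plane) (fun y => (a y, b y)) x.
Proof.
  intros Ha Hb.
  apply (continuous_comp_2 (X := plane) a b (fun a b => (a, b)) x Ha Hb).
  apply (continuous_ext (U := plane) (fun p => p)); [now intros []|].
  apply continuous_id.
Qed.

Lemma continuous_fst_plane (p : plane) : continuous (fun p : plane => fst p) p.
Proof. destruct p as [x y]. exact (continuous_fst (U := R_UniformSpace) (V := R_UniformSpace) x y). Qed.

Lemma continuous_snd_plane (p : plane) : continuous (fun p : plane => snd p) p.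
Proof. destruct p as [x y]. exact (continuous_snd (U := R_UniformSpace) (V := R_UniformSpace) x y). Qed.

Lemma continuous_2d (u : plane -> R) (x y : R) :
  continuous u (x, y) -> continuity_2d_pt (fun x y => u (x, y)) x y.
Proof.
  intros H. apply continuity_2d_pt_filterlim.
  apply (continuous_ext u (fun z : plane => u (fst z, snd z))); [now intros []|exact H].
Qed.

(** ** Linear changes of variables *)

(** The chain rule only needs partial derivatives of which one is continuous. *)
Lemma is_derive_along_line (u ut ux : plane -> R) (x y a b : R) :
  (forall x y : R, is_derive (fun s : R => u (s, y)) x (ut (x, y))) ->
  (forall x y : R, is_derive (fun s : R => u (x, s)) y (ux (x, y))) ->
  (forall p, continuous ut p) ->
  is_derive (fun h : R => u (x + h * a, y + h * b)) 0 (a * ut (x, y) + b * ux (x, y)).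
Proof.
  intros Ht Hx Hc.
  assert (F : differentiable_pt_lim (fun x y => u (x, y)) x y (ut (x, y)) (ux (x, y))).
  { apply filterdiff_differentiable_pt_lim.
    apply (is_derive_filterdiff (fun x y => u (x, y)) x y (fun x y => ut (x, y)) (ux (x, y))).
    - apply filter_forall. intros p. apply Ht.
    - apply Hx.
    - apply (continuous_ext ut (fun z : plane => ut (fst z, snd z)));
        [now intros [] | apply Hc]. }
  apply is_derive_Reals. rewrite (Rmult_comm a), (Rmult_comm b).
  apply (derivable_pt_lim_comp_2d (fun x y => u (x, y)) (fun h => x + h * a) (fun h => y + h * b)).
  - replace (x + 0 * a) with x by ring. now replace (y + 0 * b) with y by ring.
  - apply is_derive_Reals. auto_derive; [easy | ring].
  - apply is_derive_Reals. auto_derive; [easy | ring].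
Qed.

(** Affine maps, described by what the chain rule needs: the axis [i] is mapped
    to the direction [(a i, b i)]. *)
Definition linear_coords {W : NormedModule R_AbsRing} {coordW : Coordinates W}
    (L : W -> plane) (a b : axis -> R) : Prop :=
  (forall w, continuous L w) /\
  forall i w (h : R), L (plus w (scal h (dir i))) =
    (fst (L w) + h * a i, snd (L w) + h * b i).

Section LinearChange.

Context {W : NormedModule R_AbsRing} {coordW : Coordinates W}.
Variables (L : W -> plane) (a b : @axis W coordW -> R).
Hypothesis HL : linear_coords L a b.

Lemma pd_linear_change (u : plane -> R) i w :
  Cn (coordV := R2_coordinates) whole 1 u ->
  has_pd i (fun w => u (L w)) w /\
  pd i (fun w => u (L w)) w = a i * pd (coordV := R2_coordinates) ax_t u (L w) + b i * pd (coordV := R2_coordinates) ax_x u (L w).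
Proof.
  intros Hu. apply is_derive_pd. destruct HL as [_ HL'].
  apply is_derive_ext with (fun h => u (fst (L w) + h * a i, snd (L w) + h * b i)).
  - intros h. now rewrite HL'.
  - rewrite (surjective_pairing (L w)). cbn [fst snd]. apply is_derive_along_line.
    + intros x y. apply pd_t_is_derive. exact (Cn_whole_pd 0 u ax_t (x, y) Hu).
    + intros x y. apply pd_x_is_derive. exact (Cn_whole_pd 0 u ax_x (x, y) Hu).
    + apply (Cn_whole_continuous 0). apply Hu.
Qed.

(** Both partial derivatives of [u] are again composed with [L], so that the
    induction on the order goes through. *)
Lemma Cn_linear_change n (u : plane -> R) : Cn (coordV := R2_coordinates) whole n u -> Cn whole n (fun w => u (L w)).
Proof.
  revert u. induction n as [|n IH]; intros u Hu.
  all: assert (C : forall w, continuous (fun w => u (L w)) w)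
    by (intros w; apply continuous_comp; [apply HL | exact (Cn_whole_continuous _ _ Hu (L w))]).
  - now apply Cn_whole_0.
  - apply Cn_whole_S; [easy|]. intros i.
    assert (H1 : Cn (coordV := R2_coordinates) whole 1 u) by (apply Cn_le with (2 := Hu); lia).
    split; [intros w; now apply pd_linear_change|].
    apply Cn_whole_ext with (fun w => a i * pd (coordV := R2_coordinates) ax_t u (L w) + b i * pd (coordV := R2_coordinates) ax_x u (L w)).
    + intros w. symmetry. now apply pd_linear_change.
    + apply (Cn_lin whole n (fun w => pd (coordV := R2_coordinates) ax_t u (L w)) (fun w => pd (coordV := R2_coordinates) ax_x u (L w)));
        apply IH; now apply Hu.
Qed.

Lemma smooth_linear_change (u : plane -> R) : smooth (coordV := R2_coordinates) whole u -> smooth whole (fun w => u (L w)).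
Proof. rewrite !smooth_whole. intros H n. now apply Cn_linear_change. Qed.

Lemma D_linear_change (u : plane -> R) i w :
  smooth (coordV := R2_coordinates) whole u ->
  D whole [i] (fun w => u (L w)) w =
  a i * Dt u (L w) + b i * Dx u (L w).
Proof.
  intros H. rewrite !D_whole; [|easy | easy | now apply smooth_linear_change].
  apply pd_linear_change. now apply smooth_whole.
Qed.

End LinearChange.

(** In the coordinates [(xi, eta) = (x + t, x - t)] the wave operator is a
    mixed second derivative.  The plane of pairs [(xi, eta)] keeps the axis
    names: [ax_t] is the direction of [xi], [ax_x] that of [eta]. *)
Definition char_coords (p : plane) : plane := (snd p + fst p, snd p - fst p).

Definition swap (p : plane) : plane := (snd p, fst p).

Definition to_diag (p : plane) : plane := (fst p, fst p).

Lemma linear_char_coords :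
  linear_coords (W := plane) char_coords (fun _ => 1)
    (fun i => match i with ax_t => -1 | ax_x => 1 end).
Proof.
  split.
  - intros p. apply continuous_pair.
    + apply (continuous_plus (V := R_NormedModule));
        [apply continuous_snd_plane | apply continuous_fst_plane].
    + apply (continuous_minus (V := R_NormedModule));
        [apply continuous_snd_plane | apply continuous_fst_plane].
  - intros [] [t x] h; unfold char_coords, plus, scal, dir; cbn; unfold plus, scal; cbn;
      unfold mult; cbn; f_equal; ring.
Qed.

Lemma linear_swap :
  linear_coords (W := plane) swap (fun i => match i with ax_t => 0 | ax_x => 1 end)
    (fun i => match i with ax_t => 1 | ax_x => 0 end).
Proof.
  split.
  - intros p. apply continuous_pair; [apply continuous_snd_plane | apply continuous_fst_plane].
  - intros [] [t x] h; unfold swap, plus, scal, dir; cbn; unfold plus, scal; cbn;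
      unfold mult; cbn; f_equal; ring.
Qed.

Lemma linear_to_diag :
  linear_coords (W := plane) to_diag (fun i => match i with ax_t => 1 | ax_x => 0 end)
    (fun i => match i with ax_t => 1 | ax_x => 0 end).
Proof.
  split.
  - intros p. apply continuous_pair; apply continuous_fst_plane.
  - intros [] [t x] h; unfold to_diag, plus, scal, dir; cbn; unfold plus, scal; cbn;
      unfold mult; cbn; f_equal; ring.
Qed.

Lemma Cn_fst n : Cn whole n (fun p : plane => fst p).
Proof.
  destruct n as [|n].
  - apply Cn_whole_0, continuous_fst_plane.
  - apply Cn_whole_S; [apply continuous_fst_plane|]. intros [].
    + assert (K : forall p : plane, has_pd ax_t (fun p : plane => fst p) p /\
        pd ax_t (fun p : plane => fst p) p = 1).
      { intros [x y]. apply is_derive_pd_t. cbn. auto_derive; easy. }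
      split; [apply K|]. apply Cn_whole_ext with (fun _ => 1); [|apply Cn_const].
      intros p. symmetry. apply K.
    + assert (K : forall p : plane, has_pd ax_x (fun p : plane => fst p) p /\
        pd ax_x (fun p : plane => fst p) p = 0).
      { intros [x y]. apply is_derive_pd_x. cbn. auto_derive; easy. }
      split; [apply K|]. apply Cn_whole_ext with (fun _ => 0); [|apply Cn_const].
      intros p. symmetry. apply K.
Qed.

Lemma smooth_fst : smooth whole (fun p : plane => fst p).
Proof. apply smooth_whole, Cn_fst. Qed.

Lemma D_fst i (p : plane) :
  D whole [i] (fun p : plane => fst p) p = match i with ax_t => 1 | ax_x => 0 end.
Proof.
  rewrite D_whole by apply smooth_fst. destruct p as [x y], i; cbn.
  - apply is_derive_pd_t. cbn. auto_derive; easy.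
  - apply is_derive_pd_x. cbn. auto_derive; easy.
Qed.

Lemma smooth_line_fst (a : line -> R) : smooth whole a -> smooth whole (fun p : plane => a (fst p)).
Proof.
  intros Ha. apply (smooth_comp whole a); [now apply smooth_line_iff | apply smooth_fst].
Qed.

Lemma D_line_fst (a : line -> R) i (p : plane) :
  smooth whole a ->
  D whole [i] (fun p : plane => a (fst p)) p = match i with ax_t => Derive a (fst p) | ax_x => 0 end.
Proof.
  intros Ha. rewrite (D_comp whole i a (fun p : plane => fst p)).
  - rewrite D_fst. destruct i; ring.
  - apply dense_whole.
  - now apply smooth_line_iff.
  - apply smooth_fst.
  - easy.
Qed.

(** * Integration along characteristics *)

Lemma ex_RInt_cont (f : R -> R) (a b : R) : (forall x, continuous f x) -> ex_RInt f a b.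
Proof. intros H. apply (ex_RInt_continuous (V := R_CompleteNormedModule)). auto. Qed.

Lemma abs_RInt_bound (f : R -> R) (a b M : R) :
  (forall x, continuous f x) ->
  (forall t, Rmin a b <= t <= Rmax a b -> Rabs (f t) <= M) ->
  Rabs (RInt f a b) <= Rabs (b - a) * M.
Proof.
  intros Hc HM. destruct (Rle_dec a b) as [Hab|Hab].
  - rewrite Rmin_left, Rmax_right in HM by easy. rewrite (Rabs_pos_eq (b - a)) by lra.
    apply abs_RInt_le_const; [easy | now apply ex_RInt_cont | easy].
  - rewrite Rmin_right, Rmax_left in HM by lra.
    rewrite <- opp_RInt_swap by now apply ex_RInt_cont. unfold opp; cbn.
    rewrite Rabs_Ropp, (Rabs_left (b - a)) by lra. replace (- (b - a)) with (a - b) by ring.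
    apply abs_RInt_le_const; [lra | now apply ex_RInt_cont | easy].
Qed.

Lemma RInt_Chasles_R (f : R -> R) (a b c : R) :
  (forall x, continuous f x) -> RInt f a b + RInt f b c = RInt f a c.
Proof. intros H. apply (RInt_Chasles (V := R_CompleteNormedModule)); now apply ex_RInt_cont. Qed.

Lemma RInt_minus_R (f g : R -> R) (a b : R) :
  (forall x, continuous f x) -> (forall x, continuous g x) ->
  RInt (fun x => f x - g x) a b = RInt f a b - RInt g a b.
Proof.
  intros Hf Hg. apply (RInt_minus (V := R_CompleteNormedModule)); now apply ex_RInt_cont.
Qed.

Lemma is_derive_RInt_R (f : R -> R) (a x : R) :
  (forall x, continuous f x) -> is_derive (fun x => RInt f a x) x (f x).
Proof.
  intros Hf. apply (is_derive_RInt f (fun x => RInt f a x) a x); [|easy].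
  apply filter_forall. intros y. apply (RInt_correct (V := R_CompleteNormedModule)).
  now apply ex_RInt_cont.
Qed.

Lemma continuous_slice_r (G : plane -> R) (x s : R) :
  (forall p, continuous G p) -> continuous (fun s => G (x, s)) s.
Proof.
  intros H. apply (continuous_comp (fun s => (x, s) : plane) G); [|apply H].
  apply continuous_pair; [apply continuous_const | apply continuous_id].
Qed.

(** The diagonal is the initial line [t = 0]; the path of integration is the
    characteristic of constant [xi] from there to [p]. *)
Definition char_int (G : plane -> R) (p : plane) : R :=
  RInt (fun s => G (fst p, s)) (snd p) (fst p).

Lemma char_int_ext (G G' : plane -> R) p : (forall q, G q = G' q) -> char_int G p = char_int G' p.
Proof. intros E. apply RInt_ext. auto. Qed.

Lemma char_int_diag (G : plane -> R) x : char_int G (x, x) = 0.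
Proof. unfold char_int. cbn. apply (RInt_point (V := R_CompleteNormedModule)). Qed.

(** Moving [p] changes the two end points, which costs the local size of [G],
    and the line of integration, which is controlled by uniform continuity. *)
Lemma char_int_continuous (G : plane -> R) :
  (forall p, continuous G p) -> forall p, continuous (char_int G) p.
Proof.
  intros HG [x y].
  assert (C : forall x y, continuity_2d_pt (fun x y => G (x, y)) x y)
    by (intros; now apply continuous_2d).
  apply (continuous_ext (fun z : plane => (fun x y => char_int G (x, y)) (fst z) (snd z)));
    [now intros []|].
  apply (proj1 (continuity_2d_pt_filterlim (fun x y => char_int G (x, y)) x y)).
  intros eps.
  set (k := Rabs (x - y) + 1).
  assert (Hk : 0 < k) by (unfold k; assert (H := Rabs_pos (x - y)); lra).
  assert (He : 0 < eps / (3 * k)) by (apply Rdiv_lt_0_compat; [apply eps | lra]).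
  destruct (uniform_continuity_2d (fun x y => G (x, y)) (x - 1) (x + 1)
    (Rmin x y) (Rmax x y) (fun u v _ _ => C u v) (mkposreal _ He)) as [d0 H0].
  destruct (C x y (mkposreal 1 Rlt_0_1)) as [d1 H1].
  destruct (C x x (mkposreal 1 Rlt_0_1)) as [d2 H2]. cbn in H0, H1, H2.
  set (M := Rabs (G (x, y)) + Rabs (G (x, x)) + 1).
  assert (HM : 0 < M).
  { unfold M. assert (A := Rabs_pos (G (x, y))). assert (B := Rabs_pos (G (x, x))). lra. }
  assert (Hd : 0 < Rmin (Rmin 1 d0) (Rmin (Rmin d1 d2) (eps / (3 * M)))).
  { assert (0 < eps / (3 * M)) by (apply Rdiv_lt_0_compat; [apply eps | lra]).
    destruct d0, d1, d2; cbn. repeat apply Rmin_pos; lra. }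
  exists (mkposreal _ Hd). intros u v Hu Hv. cbn in Hu, Hv.
  assert (Hu' : Rabs (u - x) < 1 /\ Rabs (u - x) < d0 /\ Rabs (u - x) < d1 /\
    Rabs (u - x) < d2 /\ Rabs (u - x) < eps / (3 * M)).
  { revert Hu. unfold Rmin. repeat destruct Rle_dec; lra. }
  assert (Hv' : Rabs (v - y) < d1 /\ Rabs (v - y) < eps / (3 * M)).
  { revert Hv. unfold Rmin. repeat destruct Rle_dec; lra. }
  clear Hu Hv. unfold char_int. cbn [fst snd].
  assert (Cu : forall s, continuous (fun s => G (u, s)) s) by (intros; now apply continuous_slice_r).
  assert (Cx : forall s, continuous (fun s => G (x, s)) s) by (intros; now apply continuous_slice_r).
  assert (E : RInt (fun s => G (u, s)) v u - RInt (fun s => G (x, s)) y x =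
    RInt (fun s => G (u, s)) v y + RInt (fun s => G (u, s) - G (x, s)) y x +
    RInt (fun s => G (u, s)) x u).
  { rewrite RInt_minus_R by easy.
    rewrite <- (RInt_Chasles_R (fun s => G (u, s)) v y u) by easy.
    rewrite <- (RInt_Chasles_R (fun s => G (u, s)) y x u) by easy. lra. }
  change (Rabs (RInt (fun s : R => G (u, s)) v u - RInt (fun s : R => G (x, s)) y x) < eps).
  rewrite E. clear E.
  assert (B1 : Rabs (RInt (fun s => G (u, s)) v y) <= Rabs (y - v) * M).
  { apply abs_RInt_bound; [easy|]. intros t Ht.
    assert (Hty : Rabs (t - y) <= Rabs (v - y)).
    { revert Ht. unfold Rmin, Rmax. destruct (Rle_dec v y); unfold Rabs; repeat destruct Rcase_abs; lra. }
    specialize (H1 u t). assert (H1' : Rabs (G (u, t) - G (x, y)) < 1) by (apply H1; lra).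
    assert (B := Rabs_triang_inv (G (u, t)) (G (x, y))).
    unfold M. assert (B' := Rabs_pos (G (x, x))). lra. }
  assert (B2 : Rabs (RInt (fun s => G (u, s) - G (x, s)) y x) <= Rabs (x - y) * (eps / (3 * k))).
  { apply abs_RInt_bound.
    - intros s. apply (continuous_minus (V := R_NormedModule)); auto.
    - intros t Ht. left. rewrite Rmin_comm, Rmax_comm in Ht. apply H0.
      + split; lra.
      + exact Ht.
      + revert Hu'. unfold Rabs. destruct Rcase_abs; lra.
      + exact Ht.
      + apply Hu'.
      + rewrite Rminus_diag, Rabs_R0. apply d0. }
  assert (B3 : Rabs (RInt (fun s => G (u, s)) x u) <= Rabs (u - x) * M).
  { apply abs_RInt_bound; [easy|]. intros t Ht.
    assert (Htx : Rabs (t - x) <= Rabs (u - x)).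
    { revert Ht. unfold Rmin, Rmax. destruct (Rle_dec x u); unfold Rabs; repeat destruct Rcase_abs; lra. }
    specialize (H2 u t). assert (H2' : Rabs (G (u, t) - G (x, x)) < 1) by (apply H2; lra).
    assert (B := Rabs_triang_inv (G (u, t)) (G (x, x))).
    unfold M. assert (B' := Rabs_pos (G (x, y))). lra. }
  assert (T := Rabs_triang (RInt (fun s => G (u, s)) v y + RInt (fun s => G (u, s) - G (x, s)) y x)
    (RInt (fun s => G (u, s)) x u)).
  assert (T' := Rabs_triang (RInt (fun s => G (u, s)) v y) (RInt (fun s => G (u, s) - G (x, s)) y x)).
  assert (E1 : Rabs (y - v) * M < eps / 3).
  { rewrite Rabs_minus_sym. replace (eps / 3) with (eps / (3 * M) * M) by (field; lra).
    apply Rmult_lt_compat_r; [easy | apply Hv']. }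
  assert (E3 : Rabs (u - x) * M < eps / 3).
  { replace (eps / 3) with (eps / (3 * M) * M) by (field; lra).
    apply Rmult_lt_compat_r; [easy | apply Hu']. }
  assert (E2 : Rabs (x - y) * (eps / (3 * k)) <= eps / 3).
  { replace (eps / 3) with (k * (eps / (3 * k))) by (field; lra).
    apply Rmult_le_compat_r; [lra | unfold k; lra]. }
  lra.
Qed.

Lemma pd_x_char_int (G : plane -> R) (p : plane) :
  (forall p, continuous G p) ->
  has_pd ax_x (char_int G) p /\ pd ax_x (char_int G) p = - G p.
Proof.
  intros HG. destruct p as [x y]. apply is_derive_pd_x. unfold char_int. cbn [fst snd].
  assert (C : forall s, continuous (fun s => G (x, s)) s) by (intros; now apply continuous_slice_r).
  apply is_derive_ext with (fun s => - RInt (fun s => G (x, s)) x s).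
  - intros s. apply (opp_RInt_swap (V := R_CompleteNormedModule) (fun s => G (x, s))).
    now apply ex_RInt_cont.
  - apply (is_derive_opp (V := R_NormedModule)). exact (is_derive_RInt_R (fun s => G (x, s)) x y C).
Qed.

(** The boundary term is the value on the diagonal, where solutions of the Cauchy
    problem are determined by their data. *)
Lemma pd_t_char_int (G : plane -> R) (p : plane) :
  (forall p, continuous G p) -> (forall p, has_pd ax_t G p) ->
  (forall p, continuous (pd ax_t G) p) ->
  has_pd ax_t (char_int G) p /\
  pd ax_t (char_int G) p = G (to_diag p) + char_int (pd (coordV := R2_coordinates) ax_t G) p.
Proof.
  intros CG HG CG'. destruct p as [x y]. apply is_derive_pd_t.
  unfold char_int, to_diag. cbn [fst snd].
  assert (DG : forall x s, is_derive (fun x => G (x, s)) x (pd (coordV := R2_coordinates) ax_t G (x, s))).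
  { intros u v. apply pd_t_is_derive. apply HG. }
  assert (C2 : forall u v, continuity_2d_pt (fun u v : R => Derive (fun z : R => G (z, v)) u) u v).
  { intros u v. apply continuity_2d_pt_ext with (fun u v : R => pd (coordV := R2_coordinates) ax_t G (u, v)).
    - intros; symmetry; now apply is_derive_unique.
    - now apply continuous_2d. }
  assert (Cs : forall x s, continuous (fun s => G (x, s)) s) by (intros; now apply continuous_slice_r).
  assert (E := is_derive_RInt_param_bound_comp (fun z s => G (z, s)) (fun _ => y) (fun z => z) x 0 1).
  cbv beta in E.
  replace (G (x, x) + RInt (fun s => pd (coordV := R2_coordinates) ax_t G (x, s)) y x)
    with (RInt (fun t => Derive (fun u => G (u, t)) x) y x + - G (x, y) * 0 + G (x, x) * 1).
  - apply E; clear E.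
    + apply filter_forall. intros z. now apply ex_RInt_cont.
    + exists (mkposreal 1 Rlt_0_1). apply filter_forall. intros z. now apply ex_RInt_cont.
    + exists (mkposreal 1 Rlt_0_1). apply filter_forall. intros z. now apply ex_RInt_cont.
    + apply (is_derive_const (K := R_AbsRing) (V := R_NormedModule) y).
    + apply (is_derive_id (K := R_AbsRing)).
    + exists (mkposreal 1 Rlt_0_1). apply filter_forall. intros z t _.
      exists (pd (coordV := R2_coordinates) ax_t G (z, t)). apply DG.
    + intros t _. apply C2.
    + exists (mkposreal 1 Rlt_0_1). intros u v _ _. apply C2.
    + exists (mkposreal 1 Rlt_0_1). intros u v _ _. apply C2.
    + apply continuity_pt_filterlim. apply Cs.
    + apply continuity_pt_filterlim. apply Cs.
  - rewrite (RInt_ext (fun t => Derive (fun u => G (u, t)) x) (fun s => pd (coordV := R2_coordinates) ax_t G (x, s))).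
    + ring.
    + intros t _. now apply is_derive_unique.
Qed.

Lemma Cn_pd_t_char_int (G : plane -> R) (p : plane) :
  Cn whole 1 G ->
  has_pd ax_t (char_int G) p /\
  pd ax_t (char_int G) p = G (to_diag p) + char_int (pd (coordV := R2_coordinates) ax_t G) p.
Proof.
  intros HG. apply pd_t_char_int.
  - exact (Cn_whole_continuous 1 G HG).
  - intros q. exact (Cn_whole_pd 0 G ax_t q HG).
  - apply (Cn_whole_continuous 0). apply HG.
Qed.

Lemma Cn_char_int n (G : plane -> R) : Cn whole n G -> Cn whole n (char_int G).
Proof.
  revert G. induction n as [|n IH]; intros G HG;
    assert (CG := Cn_whole_continuous _ G HG);
    assert (C := char_int_continuous G CG).
  - now apply Cn_whole_0.
  - assert (HG1 : Cn whole 1 G) by (apply Cn_le with (2 := HG); lia).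
    assert (HG0 := Cn_pred _ _ _ HG).
    apply Cn_whole_S; [easy|]. intros []; split.
    + intros p. now apply Cn_pd_t_char_int.
    + apply Cn_whole_ext with (fun p => 1 * G (to_diag p) + 1 * char_int (pd (coordV := R2_coordinates) ax_t G) p).
      * intros p. rewrite !Rmult_1_l. symmetry. now apply Cn_pd_t_char_int.
      * apply (Cn_lin whole n (fun p : plane => G (to_diag p)) (char_int (pd (coordV := R2_coordinates) ax_t G)) 1 1).
        -- exact (Cn_linear_change to_diag _ _ linear_to_diag n G HG0).
        -- apply IH. apply HG.
    + intros p. now apply pd_x_char_int.
    + apply Cn_whole_ext with (fun p => -1 * G p + 0 * G p).
      * intros p. rewrite (proj2 (pd_x_char_int G p CG)). ring.
      * now apply (Cn_lin whole n G G (-1) 0).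
Qed.

Lemma smooth_char_int (G : plane -> R) : smooth whole G -> smooth whole (char_int G).
Proof. rewrite !smooth_whole. intros H n. now apply Cn_char_int. Qed.

Lemma D_t_char_int (G : plane -> R) p :
  smooth whole G ->
  D whole [ax_t] (char_int G) p = G (to_diag p) + char_int (Dt G) p.
Proof.
  intros HG. rewrite D_whole by now apply smooth_char_int. cbn -[pd].
  rewrite (proj2 (Cn_pd_t_char_int G p (smooth_Cn _ _ 1 HG))). f_equal.
  apply char_int_ext. intros q. symmetry. now apply (D_whole (coordV := R2_coordinates) [ax_t]).
Qed.

Lemma D_x_char_int (G : plane -> R) p :
  smooth whole G -> D whole [ax_x] (char_int G) p = - G p.
Proof.
  intros HG. rewrite D_whole by now apply smooth_char_int.
  apply (pd_x_char_int G p). intros q. now apply smooth_whole_continuous.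
Qed.

(** * The Cauchy problem in characteristic coordinates *)

Lemma continuous_swap p : continuous swap p.
Proof. apply linear_swap. Qed.

Lemma swap_swap p : swap (swap p) = p.
Proof. now destruct p. Qed.

(** Integral over the characteristic triangle between [p] and the diagonal. *)
Definition triangle_int (G : plane -> R) (p : plane) : R :=
  - char_int (fun q => char_int G (swap q)) (swap p).

Lemma continuous_comp_swap (G : plane -> R) :
  (forall p, continuous G p) -> forall p, continuous (fun q => G (swap q)) p.
Proof. intros H p. apply (continuous_comp swap G); [apply continuous_swap | apply H]. Qed.

Lemma triangle_int_continuous (G : plane -> R) :
  (forall p, continuous G p) -> forall p, continuous (triangle_int G) p.
Proof.
  intros H p. unfold triangle_int. apply (continuous_opp (V := R_NormedModule)).
  apply (continuous_comp_swap (char_int (fun q => char_int G (swap q)))).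
  apply char_int_continuous. apply continuous_comp_swap. now apply char_int_continuous.
Qed.

Lemma triangle_int_diag (G : plane -> R) x : triangle_int G (x, x) = 0.
Proof. unfold triangle_int. change (swap (x, x)) with (x, x). rewrite char_int_diag. ring. Qed.

Lemma pd_comp_swap_t (u : plane -> R) (p : plane) :
  has_pd ax_x u (swap p) ->
  has_pd ax_t (fun q => u (swap q)) p /\ pd ax_t (fun q => u (swap q)) p = pd ax_x u (swap p).
Proof.
  destruct p as [x y]. intros H. apply is_derive_pd_t.
  exact (pd_x_is_derive u y x H).
Qed.

Lemma pd_comp_swap_x (u : plane -> R) (p : plane) :
  has_pd ax_t u (swap p) ->
  has_pd ax_x (fun q => u (swap q)) p /\ pd ax_x (fun q => u (swap q)) p = pd ax_t u (swap p).
Proof.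
  destruct p as [x y]. intros H. apply is_derive_pd_x.
  exact (pd_t_is_derive u y x H).
Qed.

Lemma pd_opp i (u : plane -> R) p :
  has_pd i u p -> has_pd i (fun q => - u q) p /\ pd i (fun q => - u q) p = - pd i u p.
Proof.
  intros H. apply is_derive_pd. apply (is_derive_opp (V := R_NormedModule)).
  exact (pd_is_derive i u p H).
Qed.

Lemma pd_t_triangle_int (G : plane -> R) p :
  (forall p, continuous G p) ->
  has_pd ax_t (triangle_int G) p /\ pd ax_t (triangle_int G) p = char_int G p.
Proof.
  intros H. unfold triangle_int.
  set (F := fun q => char_int G (swap q)).
  assert (CF : forall q, continuous F q) by (apply continuous_comp_swap; now apply char_int_continuous).
  destruct (pd_x_char_int F (swap p) CF) as [H1 E1].
  destruct (pd_comp_swap_t (char_int F) p H1) as [H2 E2].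
  destruct (pd_opp ax_t (fun q => char_int F (swap q)) p H2) as [H3 E3].
  split; [exact H3|]. rewrite E3, E2, E1. unfold F. rewrite swap_swap. ring.
Qed.

(** Symmetric to the previous one, although the inner integral is only
    differentiable in the variable that is not integrated out there. *)
Lemma pd_x_triangle_int (G : plane -> R) p :
  (forall p, continuous G p) ->
  has_pd ax_x (triangle_int G) p /\
  pd ax_x (triangle_int G) p = char_int (fun q => G (swap q)) (swap p).
Proof.
  intros H. unfold triangle_int.
  set (F := fun q => char_int G (swap q)).
  assert (CF : forall q, continuous F q) by (apply continuous_comp_swap; now apply char_int_continuous).
  assert (DF : forall q, has_pd ax_t F q /\ pd ax_t F q = - G (swap q)).
  { intros q. destruct (pd_x_char_int G (swap q) H) as [H1 E1].
    destruct (pd_comp_swap_t (char_int G) q H1) as [H2 E2]. split; [exact H2|].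
    rewrite <- E1. exact E2. }
  assert (CD : forall q, continuous (fun q => - G (swap q)) q).
  { intros q. apply (continuous_opp (V := R_NormedModule)). now apply continuous_comp_swap. }
  destruct (pd_t_char_int F (swap p) CF) as [H1 E1].
  - apply DF.
  - intros q. apply continuous_ext with (2 := CD q). intros r. symmetry. apply DF.
  - destruct (pd_comp_swap_x (char_int F) p H1) as [H2 E2].
    destruct (pd_opp ax_x (fun q => char_int F (swap q)) p H2) as [H3 E3].
    split; [exact H3|]. rewrite E3, E2, E1.
    rewrite (char_int_ext _ (fun q => - G (swap q))) by apply DF.
    unfold F. change (swap (to_diag (swap p))) with (snd p, snd p).
    rewrite char_int_diag. unfold char_int.
    rewrite (RInt_opp (V := R_CompleteNormedModule)).
    + unfold opp; cbn. ring.
    + apply ex_RInt_cont. intros s. apply (continuous_slice_r (fun q => G (swap q))).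
      now apply continuous_comp_swap.
Qed.

Lemma char_int_minus (G G' : plane -> R) p :
  (forall p, continuous G p) -> (forall p, continuous G' p) ->
  char_int (fun q => G q - G' q) p = char_int G p - char_int G' p.
Proof.
  intros H H'. apply RInt_minus_R; intros s; now apply continuous_slice_r.
Qed.

Lemma triangle_int_minus (G G' : plane -> R) p :
  (forall p, continuous G p) -> (forall p, continuous G' p) ->
  triangle_int (fun q => G q - G' q) p = triangle_int G p - triangle_int G' p.
Proof.
  intros H H'. unfold triangle_int.
  rewrite (char_int_ext _ (fun q => char_int G (swap q) - char_int G' (swap q))).
  - rewrite char_int_minus; [ring | |]; apply continuous_comp_swap; now apply char_int_continuous.
  - intros q. now apply char_int_minus.
Qed.

Lemma char_int_bound (G : plane -> R) p M :
  (forall p, continuous G p) ->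
  (forall t, Rmin (fst p) (snd p) <= t <= Rmax (fst p) (snd p) -> Rabs (G (fst p, t)) <= M) ->
  Rabs (char_int G p) <= Rabs (fst p - snd p) * M.
Proof.
  intros H HM. apply abs_RInt_bound.
  - intros s. now apply continuous_slice_r.
  - intros t Ht. apply HM. now rewrite Rmin_comm, Rmax_comm.
Qed.

(** ** Picard iteration *)

(** Integration along a characteristic divides this weight by [lam], whence a
    contraction on the whole plane, no matter how large [c] and the Lipschitz
    constant are. *)
Definition weight (lam : R) (p : plane) : R := exp (lam * Rabs (fst p - snd p)).

Lemma weight_ge_1 lam p : 0 < lam -> 1 <= weight lam p.
Proof.
  intros Hl. unfold weight. rewrite <- exp_0 at 1.
  assert (0 <= lam * Rabs (fst p - snd p)) by (apply Rmult_le_pos; [lra | apply Rabs_pos]).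
  destruct (Req_dec 0 (lam * Rabs (fst p - snd p))) as [<-|]; [lra|].
  left. apply exp_increasing. lra.
Qed.

Lemma weight_le p d : Rabs (fst p - snd p) <= d -> weight 1 p <= exp d.
Proof.
  unfold weight. intros [H | H].
  - left. apply exp_increasing. rewrite Rmult_1_l. exact H.
  - right. rewrite Rmult_1_l. now apply f_equal.
Qed.

Lemma weight_swap lam p : weight lam (swap p) = weight lam p.
Proof. unfold weight. cbn. now rewrite Rabs_minus_sym. Qed.

Lemma is_RInt_exp (a b l c : R) : l <> 0 ->
  is_RInt (fun s => exp (l * (s - c))) a b ((exp (l * (b - c)) - exp (l * (a - c))) / l).
Proof.
  intros Hl.
  replace ((exp (l * (b - c)) - exp (l * (a - c))) / l)
    with (minus ((fun s => exp (l * (s - c)) / l) b) ((fun s => exp (l * (s - c)) / l) a)).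
  - apply (is_RInt_derive (V := R_CompleteNormedModule) (fun s => exp (l * (s - c)) / l)).
    + intros x _. auto_derive; [easy|]. unfold Rminus. field. easy.
    + intros x _. apply ex_derive_continuous_R.
      auto_derive. easy.
  - unfold minus, plus, opp; cbn. field. easy.
Qed.

(** Both orientations are needed, as the points with [t < 0] are included. *)
Lemma abs_RInt_exp_bound (g : R -> R) (a b C lam : R) :
  0 < lam -> 0 <= C -> (forall s, continuous g s) ->
  (forall s, Rabs (g s) <= C * exp (lam * Rabs (b - s))) ->
  Rabs (RInt g a b) <= C / lam * exp (lam * Rabs (b - a)).
Proof.
  intros Hl HC Hg HB.
  assert (HCl : 0 <= C / lam).
  { apply Rmult_le_pos; [easy|]. left. now apply Rinv_0_lt_compat. }
  destruct (Rle_dec a b) as [Hab|Hab].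
  - apply Rle_trans with (C * ((exp (- lam * (b - b)) - exp (- lam * (a - b))) / - lam)).
    + apply (norm_RInt_le (V := R_NormedModule) g (fun s => C * exp (- lam * (s - b))) a b); [easy| | |].
      * intros s Hs. apply Rle_trans with (1 := HB s). rewrite (Rabs_pos_eq (b - s)) by lra.
        right. do 2 f_equal. ring.
      * apply (RInt_correct (V := R_CompleteNormedModule)). now apply ex_RInt_cont.
      * apply (is_RInt_scal (V := R_NormedModule)). apply is_RInt_exp. lra.
    + rewrite (Rabs_pos_eq (b - a)) by lra. rewrite Rminus_diag, Rmult_0_r, exp_0.
      replace (- lam * (a - b)) with (lam * (b - a)) by ring.
      replace (C * ((1 - exp (lam * (b - a))) / - lam)) with (C / lam * (exp (lam * (b - a)) - 1))
        by (field; lra).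
      apply Rmult_le_compat_l; [easy | lra].
  - rewrite <- (opp_RInt_swap (V := R_CompleteNormedModule)) by now apply ex_RInt_cont.
    unfold opp; cbn. rewrite Rabs_Ropp.
    apply Rle_trans with (C * ((exp (lam * (a - b)) - exp (lam * (b - b))) / lam)).
    + apply (norm_RInt_le (V := R_NormedModule) g (fun s => C * exp (lam * (s - b))) b a); [lra| | |].
      * intros s Hs. apply Rle_trans with (1 := HB s). rewrite (Rabs_minus_sym b), (Rabs_pos_eq (s - b)) by lra.
        lra.
      * apply (RInt_correct (V := R_CompleteNormedModule)). now apply ex_RInt_cont.
      * apply (is_RInt_scal (V := R_NormedModule)). apply is_RInt_exp. lra.
    + rewrite (Rabs_minus_sym b), (Rabs_pos_eq (a - b)) by lra.
      rewrite Rminus_diag, Rmult_0_r, exp_0.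
      replace (C * ((exp (lam * (a - b)) - 1) / lam)) with (C / lam * (exp (lam * (a - b)) - 1))
        by (field; lra).
      apply Rmult_le_compat_l; [easy | lra].
Qed.

Lemma char_int_weight (G : plane -> R) C lam :
  0 < lam -> 0 <= C -> (forall p, continuous G p) ->
  (forall p, Rabs (G p) <= C * weight lam p) ->
  forall p, Rabs (char_int G p) <= C / lam * weight lam p.
Proof.
  intros Hl HC Hc HG [x y]. apply (abs_RInt_exp_bound (fun s => G (x, s))); try easy.
  - intros s. now apply continuous_slice_r.
Qed.

Lemma triangle_int_weight (G : plane -> R) C lam :
  0 < lam -> 0 <= C -> (forall p, continuous G p) ->
  (forall p, Rabs (G p) <= C * weight lam p) ->
  forall p, Rabs (triangle_int G p) <= C / lam / lam * weight lam p.
Proof.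
  intros Hl HC Hc HG p. unfold triangle_int. rewrite Rabs_Ropp, <- weight_swap.
  apply char_int_weight; [easy | | |].
  - apply Rmult_le_pos; [easy|]. left. now apply Rinv_0_lt_compat.
  - apply continuous_comp_swap. now apply char_int_continuous.
  - intros q. rewrite <- weight_swap. now apply char_int_weight.
Qed.

Lemma continuous_weight lam p : continuous (weight lam) p.
Proof.
  unfold weight. apply (continuous_comp (fun p : plane => lam * Rabs (fst p - snd p)) exp).
  - apply (continuous_scal_r (V := R_NormedModule) lam (fun p : plane => Rabs (fst p - snd p))).
    apply (continuous_comp (fun p : plane => fst p - snd p) Rabs).
    + apply (continuous_minus (V := R_NormedModule));
        [apply continuous_fst_plane | apply continuous_snd_plane].
    + apply continuous_Rabs.
  - apply continuous_exp.
Qed.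

Section Picard.

Variables (f : R -> R) (v0 : plane -> R) (c B L : R).
Hypothesis Hv0 : forall p, continuous v0 p.
Hypothesis Hc : 0 <= c.
Hypothesis HB : forall s, Rabs (f s) <= B.
Hypothesis HL : forall s t, Rabs (f s - f t) <= L * Rabs (s - t).

Lemma lipschitz_continuous s : continuous f s.
Proof.
  apply (filterlim_locally f (f s)). intros eps.
  assert (HL1 : 0 < Rabs L + 1) by (assert (H := Rabs_pos L); lra).
  assert (Hd : 0 < eps / (Rabs L + 1)) by (apply Rdiv_lt_0_compat; [apply eps | easy]).
  exists (mkposreal _ Hd). intros t Ht. change (Rabs (t - s) < eps / (Rabs L + 1)) in Ht.
  change (Rabs (f t - f s) < eps). apply Rle_lt_trans with (1 := HL t s).
  apply Rle_lt_trans with (Rabs (t - s) * (Rabs L + 1)).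
  - rewrite Rmult_comm. apply Rmult_le_compat_l; [apply Rabs_pos|].
    assert (H := Rle_abs L). lra.
  - apply Rmult_lt_compat_r with (r := Rabs L + 1) in Ht; [|easy].
    replace (pos eps) with (eps / (Rabs L + 1) * (Rabs L + 1)) by (field; lra). easy.
Qed.

Fixpoint picard (n : nat) : plane -> R :=
  match n with
  | O => v0
  | S m => fun p => v0 p + c * triangle_int (fun q => f (picard m q)) p
  end.

Lemma continuous_f_comp (v : plane -> R) :
  (forall p, continuous v p) -> forall p, continuous (fun q => f (v q)) p.
Proof. intros H p. apply (continuous_comp v f); [apply H | apply lipschitz_continuous]. Qed.

Lemma picard_continuous n p : continuous (picard n) p.
Proof.
  revert p. induction n as [|n IH]; intros p; [apply Hv0|].
  apply (continuous_plus (V := R_NormedModule) v0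
    (fun p => c * triangle_int (fun q => f (picard n q)) p)); [apply Hv0|].
  apply (continuous_scal_r (K := R_AbsRing) (V := R_NormedModule) c
    (triangle_int (fun q => f (picard n q))) p).
  apply triangle_int_continuous. now apply continuous_f_comp.
Qed.

Let lam := 2 * c * Rabs L + 1.
Let C := c * B / lam / lam.

Lemma lam_pos : 0 < lam.
Proof.
  unfold lam. assert (H := Rmult_le_pos _ _ Hc (Rabs_pos L)). lra.
Qed.

Lemma B_pos : 0 <= B.
Proof. apply Rle_trans with (2 := HB 0), Rabs_pos. Qed.

Lemma C_pos : 0 <= C.
Proof.
  assert (H := lam_pos). assert (H' := B_pos). unfold C.
  repeat apply Rmult_le_pos; try easy; left; now apply Rinv_0_lt_compat.
Qed.

(** [lam] is chosen such that [c * L / lam ^ 2] is at most [1 / 2]. *)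
Lemma contraction (v w : plane -> R) K :
  (forall p, continuous v p) -> (forall p, continuous w p) -> 0 <= K ->
  (forall p, Rabs (v p - w p) <= K * weight lam p) ->
  forall p, Rabs (c * triangle_int (fun q => f (v q)) p - c * triangle_int (fun q => f (w q)) p)
    <= K / 2 * weight lam p.
Proof.
  intros Cv Cw HK H p. assert (Hl := lam_pos).
  rewrite <- Rmult_minus_distr_l, <- triangle_int_minus by now apply continuous_f_comp.
  rewrite Rabs_mult, (Rabs_pos_eq c) by easy.
  assert (W := weight_ge_1 lam p Hl).
  apply Rle_trans with (c * (Rabs L * K / lam / lam * weight lam p)).
  - apply Rmult_le_compat_l; [easy|]. apply triangle_int_weight; [easy | | |].
    + apply Rmult_le_pos; [apply Rabs_pos | easy].
    + intros q. apply (continuous_minus (V := R_NormedModule)); now apply continuous_f_comp.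
    + intros q. apply Rle_trans with (1 := HL _ _).
      apply Rle_trans with (Rabs L * Rabs (v q - w q)).
      * apply Rmult_le_compat_r; [apply Rabs_pos | apply Rle_abs].
      * rewrite Rmult_assoc. apply Rmult_le_compat_l; [apply Rabs_pos | apply H].
  - rewrite <- Rmult_assoc. apply Rmult_le_compat_r; [lra|].
    assert (E : c * Rabs L <= lam * lam / 2).
    { assert (E1 : 2 * (c * Rabs L) = lam - 1) by (unfold lam; ring).
      assert (H1 := Rmult_le_pos _ _ Hc (Rabs_pos L)).
      assert (H2 : 1 <= lam) by lra. clear - E1 H1 H2. clearbody lam. nra. }
    replace (c * (Rabs L * K / lam / lam)) with (c * Rabs L * (K / (lam * lam))) by (field; lra).
    replace (K / 2) with (lam * lam / 2 * (K / (lam * lam))) by (field; lra).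
    apply Rmult_le_compat_r; [|easy]. apply Rmult_le_pos; [easy|].
    left. apply Rinv_0_lt_compat. nra.
Qed.

Lemma picard_step n p : Rabs (picard (S n) p - picard n p) <= C * (/ 2) ^ n * weight lam p.
Proof.
  revert p. induction n as [|n IH]; intros p.
  - replace (picard 1 p - picard 0 p) with (c * triangle_int (fun q => f (v0 q)) p) by (cbn; ring).
    cbn [pow]. rewrite Rmult_1_r.
    rewrite Rabs_mult, (Rabs_pos_eq c) by easy.
    apply Rle_trans with (c * (B / lam / lam * weight lam p)).
    + apply Rmult_le_compat_l; [easy|]. apply triangle_int_weight.
      * apply lam_pos.
      * apply B_pos.
      * now apply continuous_f_comp.
      * intros q. apply Rle_trans with (1 := HB _).
        assert (H := weight_ge_1 lam q lam_pos). assert (H' := B_pos). nra.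
    + right. unfold C, Rdiv. ring.
  - assert (E : picard (S (S n)) p - picard (S n) p =
      c * triangle_int (fun q => f (picard (S n) q)) p -
      c * triangle_int (fun q => f (picard n q)) p).
    { change (v0 p + c * triangle_int (fun q => f (picard (S n) q)) p -
        (v0 p + c * triangle_int (fun q => f (picard n q)) p) =
        c * triangle_int (fun q => f (picard (S n) q)) p -
        c * triangle_int (fun q => f (picard n q)) p). ring. }
    rewrite E.
    apply Rle_trans with (C * (/ 2) ^ n / 2 * weight lam p).
    + apply contraction; [apply picard_continuous | apply picard_continuous | | exact IH].
      apply Rmult_le_pos; [apply C_pos | apply pow_le; lra].
    + right. cbn. field.
Qed.

Lemma picard_diff n k p :
  Rabs (picard (n + k) p - picard n p) <= 2 * C * (/ 2) ^ n * (1 - (/ 2) ^ k) * weight lam p.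
Proof.
  induction k as [|k IH].
  - rewrite Nat.add_0_r, Rminus_diag, Rabs_R0. cbn. lra.
  - rewrite Nat.add_succ_r. assert (H := picard_step (n + k) p). rewrite pow_add in H.
    replace (picard (S (n + k)) p - picard n p) with
      ((picard (S (n + k)) p - picard (n + k) p) + (picard (n + k) p - picard n p)) by ring.
    apply Rle_trans with (1 := Rabs_triang _ _).
    apply Rle_trans with (1 := Rplus_le_compat _ _ _ _ H IH). right. cbn. field.
Qed.

(** The geometric series of the steps is summed exactly in [picard_diff]. *)
Lemma picard_dist n m p : (n <= m)%nat ->
  Rabs (picard m p - picard n p) <= 2 * C * (/ 2) ^ n * weight lam p.
Proof.
  intros H. replace m with (n + (m - n))%nat by lia.
  apply Rle_trans with (1 := picard_diff _ _ _).
  apply Rmult_le_compat_r; [assert (W := weight_ge_1 lam p lam_pos); lra|].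
  rewrite <- (Rmult_1_r (2 * C * (/ 2) ^ n)) at 2.
  assert (H1 : 0 <= (/ 2) ^ (m - n)) by (apply pow_le; lra).
  assert (H2 : 0 <= (/ 2) ^ n) by (apply pow_le; lra).
  assert (H3 := C_pos).
  apply Rmult_le_compat_l; [|lra]. apply Rmult_le_pos; lra.
Qed.

Lemma half_pow_small (K e : R) : 0 < e -> 0 <= K -> exists n, K * (/ 2) ^ n < e.
Proof.
  intros He HK. destruct (pow_lt_1_zero (/ 2)) with (y := e / (K + 1)) as [N HN].
  - rewrite Rabs_pos_eq; lra.
  - apply Rdiv_lt_0_compat; lra.
  - exists N. specialize (HN N (le_n N)). rewrite Rabs_pos_eq in HN by (apply pow_le; lra).
    apply Rle_lt_trans with ((K + 1) * (/ 2) ^ N).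
    + apply Rmult_le_compat_r; [apply pow_le|]; lra.
    + apply Rmult_lt_compat_l with (r := K + 1) in HN; [|lra].
      replace ((K + 1) * (e / (K + 1))) with e in HN by (field; lra). easy.
Qed.

Definition picard_lim (p : plane) : R := real (Lim_seq (fun n => picard n p)).

Lemma picard_lim_dist n p : Rabs (picard_lim p - picard n p) <= 2 * C * (/ 2) ^ n * weight lam p.
Proof.
  assert (W := weight_ge_1 lam p lam_pos). assert (HC := C_pos).
  assert (H : ex_finite_lim_seq (fun n => picard n p)).
  { apply ex_lim_seq_cauchy_corr. intros eps.
    destruct (half_pow_small (4 * C * weight lam p) eps) as [N HN].
    - apply eps.
    - apply Rmult_le_pos; lra.
    - exists N. intros m k Hm Hk.
      replace (picard m p - picard k p) with
        ((picard m p - picard N p) - (picard k p - picard N p)) by ring.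
      apply Rle_lt_trans with (1 := Rabs_triang _ _). rewrite Rabs_Ropp.
      assert (H1 := picard_dist N m p Hm). assert (H2 := picard_dist N k p Hk). lra. }
  apply Lim_seq_correct' in H. fold (picard_lim p) in H.
  apply (is_lim_seq_le_loc (fun m => Rabs (picard m p - picard n p))
    (fun _ => 2 * C * (/ 2) ^ n * weight lam p)
    (Finite (Rabs (picard_lim p - picard n p))) (Finite (2 * C * (/ 2) ^ n * weight lam p))).
  - exists n. intros m Hm. now apply picard_dist.
  - apply (is_lim_seq_abs _ (Finite (picard_lim p - picard n p))).
    apply is_lim_seq_minus'; [exact H | apply is_lim_seq_const].
  - apply is_lim_seq_const.
Qed.

(** The weight is locally bounded, so the iterates converge locally
    uniformly. *)
Lemma picard_lim_continuous p : continuous picard_lim p.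
Proof.
  apply (filterlim_locally picard_lim (picard_lim p)). intros eps.
  assert (W := weight_ge_1 lam p lam_pos). assert (HC := C_pos).
  destruct (half_pow_small (2 * C * (weight lam p + 1)) (eps / 3)) as [n Hn].
  - assert (H := cond_pos eps). lra.
  - apply Rmult_le_pos; lra.
  - assert (Hp : 0 <= (/ 2) ^ n) by (apply pow_le; lra).
    assert (H1 := proj1 (filterlim_locally (weight lam) (weight lam p)) (continuous_weight lam p) (mkposreal 1 Rlt_0_1)).
    assert (He : 0 < eps / 3) by (assert (H := cond_pos eps); lra).
    assert (H2 := proj1 (filterlim_locally (picard n) (picard n p)) (picard_continuous n p) (mkposreal _ He)).
    apply filter_imp with (2 := filter_and _ _ H1 H2). intros q [G1 G2].
    change (Rabs (weight lam q - weight lam p) < 1) in G1.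
    change (Rabs (picard n q - picard n p) < eps / 3) in G2.
    change (Rabs (picard_lim q - picard_lim p) < eps).
    replace (picard_lim q - picard_lim p) with
      ((picard_lim q - picard n q) + (picard n q - picard n p) - (picard_lim p - picard n p)) by ring.
    assert (D1 := picard_lim_dist n q). assert (D2 := picard_lim_dist n p).
    assert (T1 := Rabs_triang (picard_lim q - picard n q + (picard n q - picard n p))
      (- (picard_lim p - picard n p))). rewrite Rabs_Ropp in T1.
    assert (T2 := Rabs_triang (picard_lim q - picard n q) (picard n q - picard n p)).
    assert (K : forall z, z <= weight lam p + 1 -> 2 * C * (/ 2) ^ n * z <= eps / 3).
    { intros z Hz. apply Rle_trans with (2 := Rlt_le _ _ Hn).
      replace (2 * C * (weight lam p + 1) * (/ 2) ^ n)
        with (2 * C * (/ 2) ^ n * (weight lam p + 1)) by ring.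
      apply Rmult_le_compat_l; [|easy]. apply Rmult_le_pos; lra. }
    assert (K1 := K (weight lam q)). assert (K2 := K (weight lam p)).
    apply Rabs_def2 in G1. unfold Rminus in *. lra.
Qed.

(** The two sides are limits of consecutive iterates. *)
Theorem picard_fixpoint p :
  picard_lim p = v0 p + c * triangle_int (fun q => f (picard_lim q)) p.
Proof.
  apply Rminus_diag_uniq. apply Rabs_eq_0.
  apply Rle_antisym; [|apply Rabs_pos]. apply Rnot_lt_le. intros H.
  assert (W := weight_ge_1 lam p lam_pos). assert (HC := C_pos).
  destruct (half_pow_small (4 * C * weight lam p) _ H) as [n Hn].
  - apply Rmult_le_pos; lra.
  - revert Hn. apply Rle_not_lt. rewrite <- Rabs_Rabsolu in H.
    assert (D1 := picard_lim_dist (S n) p).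
    assert (D2 := contraction picard_lim (picard n) (2 * C * (/ 2) ^ n)
      picard_lim_continuous (picard_continuous n)).
    lapply D2; [clear D2; intros D2 | apply Rmult_le_pos; [lra | apply pow_le; lra]].
    specialize (D2 (picard_lim_dist n) p).
    assert (E : picard (S n) p = v0 p + c * triangle_int (fun q => f (picard n q)) p) by easy.
    rewrite E in D1. cbn [pow] in D1.
    assert (T := Rabs_triang (picard_lim p - (v0 p + c * triangle_int (fun q => f (picard n q)) p))
      (- (c * triangle_int (fun q => f (picard_lim q)) p - c * triangle_int (fun q => f (picard n q)) p))).
    rewrite Rabs_Ropp in T.
    replace (picard_lim p - (v0 p + c * triangle_int (fun q : plane => f (picard n q)) p) + _)
      with (picard_lim p - (v0 p + c * triangle_int (fun q : plane => f (picard_lim q)) p)) in T by ring.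
    assert (P : 0 <= C * (/ 2) ^ n * weight lam p).
    { apply Rmult_le_pos; [apply Rmult_le_pos; [easy | apply pow_le; lra] | lra]. }
    nra.
Qed.

End Picard.

(** ** Existence and smoothness *)

(** The equation [D_xi D_eta v = - c f(v)], integrated once in each of the two
    directions, with the Cauchy data that [A(xi) + B(eta)] has on the diagonal. *)
Record char_sol (c : R) (f A B : R -> R) (v : plane -> R) : Prop := {
  char_sol_smooth : smooth whole v;
  char_sol_t : forall p, Dt v p =
    Derive A (fst p) + c * char_int (fun q => f (v q)) p;
  char_sol_x : forall p, Dx v p =
    Derive B (snd p) + c * char_int (fun q => f (v (swap q))) (swap p);
  char_sol_diag : forall x, v (x, x) = A x + B x
}.

Lemma smooth_free (A B : line -> R) :
  smooth whole A -> smooth whole B -> smooth whole (fun p : plane => A (fst p) + B (snd p)).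
Proof.
  intros HA HB. apply smooth_plus; [now apply smooth_line_fst|].
  apply (smooth_linear_change swap _ _ linear_swap (fun p : plane => B (fst p))).
  now apply smooth_line_fst.
Qed.

Lemma has_pd_free (A B : line -> R) (p : plane) :
  smooth whole A -> smooth whole B ->
  let v0 := fun p : plane => A (fst p) + B (snd p) in
  (has_pd ax_t v0 p /\ pd ax_t v0 p = Derive A (fst p)) /\
  (has_pd ax_x v0 p /\ pd ax_x v0 p = Derive B (snd p)).
Proof.
  intros HA HB v0. destruct p as [x y]. cbn [fst snd]. unfold v0.
  assert (EA := Derive_correct _ _ (smooth_line_ex_derive A x HA)).
  assert (EB := Derive_correct _ _ (smooth_line_ex_derive B y HB)).
  split.
  - apply is_derive_pd_t. cbn [fst snd]. rewrite <- (Rplus_0_r (Derive A x)).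
    apply (is_derive_plus (V := R_NormedModule) A (fun _ => B y) x (Derive A x) 0); [exact EA|].
    apply (is_derive_const (K := R_AbsRing) (V := R_NormedModule)).
  - apply is_derive_pd_x. cbn [fst snd]. rewrite <- (Rplus_0_l (Derive B y)).
    apply (is_derive_plus (V := R_NormedModule) (fun _ => A x) B y 0 (Derive B y)); [|exact EB].
    apply (is_derive_const (K := R_AbsRing) (V := R_NormedModule)).
Qed.

Lemma pd_plus_scal i (u v : plane -> R) (c : R) p :
  has_pd i u p -> has_pd i v p ->
  has_pd i (fun q => u q + c * v q) p /\
  pd i (fun q => u q + c * v q) p = pd i u p + c * pd i v p.
Proof.
  intros Hu Hv. apply is_derive_pd. apply (is_derive_plus (V := R_NormedModule)).
  - exact (pd_is_derive i u p Hu).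
  - apply (is_derive_scal (fun h : R => v (plus p (scal h (dir i)))) 0 c).
    exact (pd_is_derive i v p Hv).
Qed.

(** The fixed point of the integral equation is at first only continuous.  Its
    derivatives are integrals of [f(v)] along single characteristics, hence as
    regular as [v] itself, and [v] is smooth by induction on the order. *)
Lemma char_sol_exists (c M L : R) (f : R -> R) (A B : line -> R) :
  0 <= c -> (forall k y, ex_derive_n f k y) ->
  (forall s, Rabs (f s) <= M) -> (forall s t, Rabs (f s - f t) <= L * Rabs (s - t)) ->
  smooth whole A -> smooth whole B ->
  exists v, char_sol c f A B v /\
    forall p, Rabs (v p - (A (fst p) + B (snd p))) <=
      c * (M * weight 1 p).
Proof.
  intros Hc Sf HM HL SA SB.
  set (v0 := fun p : plane => A (fst p) + B (snd p)).
  assert (S0 : smooth whole v0) by now apply smooth_free.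
  assert (C0 : forall p, continuous v0 p) by (intros; now apply smooth_whole_continuous).
  set (v := picard_lim f v0 c).
  assert (E : forall p, v p = v0 p + c * triangle_int (fun q => f (v q)) p)
    by (exact (picard_fixpoint f v0 c M L C0 Hc HM HL)).
  assert (Cv : forall p, continuous v p) by (exact (picard_lim_continuous f v0 c M L C0 Hc HM HL)).
  clearbody v.
  set (G := fun q => f (v q)).
  assert (Cf : forall y, continuous f y).
  { intros y. apply ex_derive_continuous_R. apply (Sf 1%nat). }
  assert (CG : forall p, continuous G p).
  { intros p. apply (continuous_comp v f); auto. }
  assert (Et : forall p, has_pd ax_t v p /\ pd ax_t v p = Derive A (fst p) + c * char_int G p).
  { intros p. destruct (proj1 (has_pd_free A B p SA SB)) as [H1 E1].
    destruct (pd_t_triangle_int G p CG) as [H2 E2].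
    destruct (pd_plus_scal ax_t _ _ c p H1 H2) as [H3 E3].
    assert (EE : locally p (fun q => v0 q + c * triangle_int G q = v q))
      by (apply filter_forall; intros q; symmetry; apply E).
    split; [exact (has_pd_locally (coordV := R2_coordinates) ax_t _ _ p EE H3)|].
    rewrite <- (pd_locally (coordV := R2_coordinates) ax_t _ _ p EE). rewrite E1, E2 in E3. exact E3. }
  assert (Ex : forall p, has_pd ax_x v p /\
    pd ax_x v p = Derive B (snd p) + c * char_int (fun q => G (swap q)) (swap p)).
  { intros p. destruct (proj2 (has_pd_free A B p SA SB)) as [H1 E1].
    destruct (pd_x_triangle_int G p CG) as [H2 E2].
    destruct (pd_plus_scal ax_x _ _ c p H1 H2) as [H3 E3].
    assert (EE : locally p (fun q => v0 q + c * triangle_int G q = v q))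
      by (apply filter_forall; intros q; symmetry; apply E).
    split; [exact (has_pd_locally (coordV := R2_coordinates) ax_x _ _ p EE H3)|].
    rewrite <- (pd_locally (coordV := R2_coordinates) ax_x _ _ p EE). rewrite E1, E2 in E3. exact E3. }
  (* each derivative of [v] is as smooth as [v] itself *)
  assert (Sv : forall n, Cn whole n v).
  { induction n as [|n IH]; [now apply Cn_whole_0|].
    assert (SG : Cn whole n G) by (apply (Cn_comp whole n f v Sf IH)).
    apply Cn_whole_S; [exact Cv|]. intros []; split.
    - apply Et.
    - apply Cn_whole_ext with (fun p => 1 * Derive A (fst p) + c * char_int G p).
      + intros p. rewrite (proj2 (Et p)). exact (f_equal (fun z => z + c * char_int G p) (Rmult_1_l (Derive A (fst p)))).
      + apply (Cn_lin whole n (fun p : plane => Derive A (fst p)) (char_int G) 1 c).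
        * apply smooth_Cn. apply smooth_line_fst. now apply smooth_line_Derive.
        * now apply Cn_char_int.
    - apply Ex.
    - apply Cn_whole_ext with
        (fun p => 1 * Derive B (fst (swap p)) + c * char_int (fun q => G (swap q)) (swap p)).
      + intros p. rewrite (proj2 (Ex p)). cbn [swap fst]. ring.
      + apply (Cn_linear_change swap _ _ linear_swap n
          (fun p => 1 * Derive B (fst p) + c * char_int (fun q => G (swap q)) p)).
        apply (Cn_lin whole n (fun p : plane => Derive B (fst p)) (char_int (fun q => G (swap q))) 1 c).
        * apply smooth_Cn. apply smooth_line_fst. now apply smooth_line_Derive.
        * apply Cn_char_int. exact (Cn_linear_change swap _ _ linear_swap n G SG). }
  apply smooth_whole in Sv. exists v. split; [split|].
  - exact Sv.
  - intros p. rewrite D_whole by exact Sv. apply (Et p).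
  - intros p. rewrite D_whole by exact Sv. apply (Ex p).
  - intros x. rewrite E, triangle_int_diag. unfold v0. cbn. ring.
  - intros p. rewrite E. unfold v0.
    replace (_ - _) with (c * triangle_int (fun q => f (v q)) p) by ring.
    rewrite Rabs_mult, (Rabs_pos_eq c) by easy. apply Rmult_le_compat_l; [easy|].
    replace (M * weight 1 p) with (M / 1 / 1 * weight 1 p) by field.
    assert (M0 : 0 <= M) by (apply Rle_trans with (2 := HM 0), Rabs_pos).
    apply triangle_int_weight; [lra | exact M0 | exact CG |]. intros q.
    apply Rle_trans with (1 := HM _). rewrite <- (Rmult_1_r M) at 1.
    apply Rmult_le_compat_l; [exact M0 | apply weight_ge_1; lra].
Qed.

Lemma Dt_swap (u : plane -> R) p : smooth whole u ->
  Dt (fun q => u (swap q)) p =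
  Dx u (swap p).
Proof.
  intros Su. refine (eq_trans (D_linear_change swap _ _ linear_swap u ax_t p Su) _). cbv beta iota. ring.
Qed.

Lemma Dx_swap (u : plane -> R) p : smooth whole u ->
  Dx (fun q => u (swap q)) p =
  Dt u (swap p).
Proof.
  intros Su. refine (eq_trans (D_linear_change swap _ _ linear_swap u ax_x p Su) _). cbv beta iota. ring.
Qed.

Lemma smooth_swap (u : plane -> R) : smooth whole u -> smooth whole (fun p => u (swap p)).
Proof. apply (smooth_linear_change swap _ _ linear_swap). Qed.

(** Time reversal exchanges the two families of characteristics. *)
Lemma char_sol_swap c f A B v :
  char_sol c f A B v -> char_sol c f B A (fun p => v (swap p)).
Proof.
  intros [S Et Ex Ed]. split.
  - now apply smooth_swap.
  - intros p. rewrite (Dt_swap v p S), Ex. now rewrite swap_swap.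
  - intros p. rewrite (Dx_swap v p S), Et.
    rewrite (char_int_ext (fun q => f (v (swap (swap q)))) (fun q => f (v q)));
      [reflexivity | intros q; now rewrite swap_swap].
  - intros x. change (v (x, x) = B x + A x). rewrite Ed. ring.
Qed.

(** ** Propagation of growth estimates *)

Lemma grows_preimage {V W : NormedModule R_AbsRing} (Q : R -> Prop) (K : W -> Prop) (K' : V -> Prop)
    (L : W -> V) (g : net V) :
  (forall w, K w -> K' (L w)) -> grows Q K' g -> grows Q K (fun e w => g e (L w)).
Proof.
  intros HK (b & Hb & C & HC). exists b. split; [exact Hb|]. exists C.
  apply filter_imp with (2 := HC). intros e H w Hw. apply H. now apply HK.
Qed.

Section Propagation.

Variable Q : R -> Prop.
Hypothesis HQ : rates Q.

Notation ctl K := (Ctl whole (grows Q K)).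
Notation ctl2 K := (Ctl (V := plane) (coordV := R2_coordinates) whole (grows Q K)).

Lemma on_values_whole {V : NormedModule R_AbsRing} (K : V -> Prop) : on_values whole (grows Q K).
Proof. apply on_values_grows. easy. Qed.

Section CtlWhole.

Context {V : NormedModule R_AbsRing} {coordV : Coordinates V}.
Variables (K : V -> Prop) (J : axis -> Prop).

Lemma Ctl_whole_value n (u : net V) : smooth_net whole u -> ctl K J n u -> grows Q K u.
Proof. apply Ctl_value; [apply dense_whole | apply on_values_whole]. Qed.

Lemma Ctl_whole_0 (u : net V) : smooth_net whole u -> grows Q K u -> ctl K J 0 u.
Proof. apply Ctl_0; [apply dense_whole | apply on_values_whole]. Qed.

Lemma Ctl_whole_S n (u : net V) :
  smooth_net whole u -> grows Q K u ->
  (forall i, J i -> ctl K J n (fun e => D whole [i] (u e))) -> ctl K J (S n) u.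
Proof. apply Ctl_S; [apply dense_whole | apply on_values_whole]. Qed.

Lemma Ctl_whole_D n i (u : net V) :
  smooth_net whole u -> J i -> ctl K J (S n) u -> ctl K J n (fun e => D whole [i] (u e)).
Proof.
  intros Su Hi. apply Ctl_D; [apply dense_whole | apply on_values_whole | exact Su | now constructor |].
  cbn. lia.
Qed.

Lemma Ctl_whole_ext n (u v : net V) :
  smooth_net whole u -> (forall e x, 0 < e <= 1 -> u e x = v e x) -> ctl K J n u -> ctl K J n v.
Proof.
  intros Su E. apply Ctl_ext; [apply dense_whole | apply on_values_whole | exact Su | auto].
Qed.

Lemma Ctl_whole_plus n (u v : net V) :
  smooth_net whole u -> smooth_net whole v -> ctl K J n u -> ctl K J n v ->
  ctl K J n (fun e x => u e x + v e x).
Proof. apply Ctl_plus; [apply dense_whole | apply on_values_whole | now apply additive_grows]. Qed.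

Lemma Ctl_const n (d : R) : ctl K J n (fun _ _ => d).
Proof.
  intros l _ _. destruct l as [|k l] using rev_ind.
  - apply (on_values_whole K) with (fun _ _ => d); [|apply grows_const, HQ].
    intros e He x Hx. symmetry. exact (D_nil whole (fun _ => d) x dense_whole (smooth_const _ d) Hx).
  - apply (on_values_whole K) with (fun _ _ => 0); [|apply grows_const, HQ].
    intros e He x Hx. symmetry. exact (D_const whole k l d x dense_whole Hx).
Qed.

Lemma Ctl_scal n (c : R -> R) (g : net V) :
  grows Q (@whole R_NormedModule) (fun e _ => c e) -> smooth_net whole g ->
  ctl K J n g -> ctl K J n (fun e x => c e * g e x).
Proof.
  intros Hc Sg H l Hl Hn. apply (on_values_whole K) with (fun e x => c e * D whole l (g e) x).
  - intros e He x Hx. rewrite (D_ext whole l (fun x => c e * g e x) (fun x => c e * g e x + 0 * g e x));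
      auto using dense_whole, smooth_scal, smooth_lin.
    + rewrite D_lin; auto using dense_whole. ring.
    + intros; ring.
  - apply (grows_mult Q K (fun e _ => c e)); [exact HQ | | now apply H].
    destruct Hc as (b & Hb & C & HC). exists b. split; [exact Hb|]. exists C.
    apply filter_imp with (2 := HC). intros e He x _. now apply (He 0).
Qed.

End CtlWhole.

Lemma Ctl_linear_change {W : NormedModule R_AbsRing} {coordW : Coordinates W}
    (L : W -> plane) (a b : @axis W coordW -> R) (K : W -> Prop) (K' : plane -> Prop)
    (J : @axis W coordW -> Prop) (J' : tx_axis -> Prop) n (G : net plane) :
  linear_coords L a b -> (forall w, K w -> K' (L w)) ->
  (forall i, J i -> (a i = 0 \/ J' ax_t) /\ (b i = 0 \/ J' ax_x)) ->
  smooth_net (coordV := R2_coordinates) whole G ->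
  ctl2 K' J' n G -> ctl K J n (fun e w => G e (L w)).
Proof.
  intros HL HK HJ. revert G. induction n as [|n IH]; intros G SG H.
  all: assert (SL : forall F : net plane, smooth_net (coordV := R2_coordinates) whole F ->
    smooth_net whole (fun e w => F e (L w)))
    by (intros F SF e He; apply (smooth_linear_change L a b HL); now apply SF).
  all: assert (V0 : grows Q K (fun e w => G e (L w)))
    by (apply grows_preimage with K'; [exact HK | exact (Ctl_whole_value _ _ _ _ SG H)]).
  - apply Ctl_whole_0; [now apply SL | exact V0].
  - apply Ctl_whole_S; [now apply SL | exact V0 |].
    intros i Hi. destruct (HJ i Hi) as [Ha Hb].
    assert (SD : forall j, smooth_net (coordV := R2_coordinates) whole
      (fun e => Dtx whole [j] (G e))) by (intros j; now apply smooth_net_D).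
    assert (Z : forall (d : R) (j : tx_axis), d = 0 \/ J' j ->
      ctl K J n (fun e w => d * Dtx whole [j] (G e) (L w))).
    { intros d j [-> | Hj].
      - apply Ctl_whole_ext with (fun _ _ => 0); [intros e He; apply smooth_const | intros; ring |].
        apply Ctl_const.
      - apply Ctl_scal with (c := fun _ => d); [apply grows_const, HQ | exact (SL _ (SD j)) |].
        apply IH; [apply SD|]. now apply (Ctl_whole_D (coordV := R2_coordinates)). }
    apply Ctl_whole_ext with (fun e w =>
      a i * Dt (G e) (L w) +
      b i * Dx (G e) (L w)).
    + intros e He. apply smooth_lin; [exact (SL _ (SD ax_t) e He) | exact (SL _ (SD ax_x) e He)].
    + intros e w He. symmetry. apply (D_linear_change L a b HL). now apply SG.
    + apply Ctl_whole_plus; [| | now apply Z | now apply Z]; intros e He; apply smooth_scal;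
        [exact (SL _ (SD ax_t) e He) | exact (SL _ (SD ax_x) e He)].
Qed.

Lemma Ctl_line_fst (K : line -> Prop) (K' : plane -> Prop) J n (a : net line) :
  (forall p, K' p -> K (fst p)) -> smooth_net whole a ->
  ctl K all_axes n a -> ctl2 K' J n (fun e p => a e (fst p)).
Proof.
  intros HK. revert a. induction n as [|n IH]; intros a Sa H.
  all: assert (SL : forall b : net line, smooth_net whole b ->
    smooth_net (V := plane) whole (fun e p => b e (fst p)))
    by (intros b Sb e He; apply smooth_line_fst; now apply Sb).
  all: assert (V0 : grows Q K' (fun e p => a e (fst p)))
    by (apply (grows_preimage Q K' K fst); [exact HK | exact (Ctl_whole_value _ _ _ _ Sa H)]).
  - apply Ctl_whole_0; [now apply SL | exact V0].
  - apply Ctl_whole_S; [now apply SL | exact V0 |]. intros [] _.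
    + assert (Sa' : smooth_net whole (fun e => D whole [ax1] (a e))) by now apply smooth_net_D.
      apply Ctl_whole_ext with (fun e p => D whole [ax1] (a e) (fst p)).
      * exact (SL _ Sa').
      * intros e p He. rewrite D_line_1 by now apply Sa.
        symmetry. apply (D_line_fst (a e) ax_t p). now apply Sa.
      * apply IH; [exact Sa'|]. now apply Ctl_whole_D.
    + apply Ctl_whole_ext with (fun _ _ => 0).
      * intros e He. apply smooth_const.
      * intros e p He. symmetry. apply (D_line_fst (a e) ax_x p). now apply Sa.
      * apply Ctl_const.
Qed.

(** All derivatives of the data are controlled on [reg].  Singularities at [xi]
    spread along the line of constant [xi], where they only affect the
    derivatives that involve [ax_t]. *)
Variables (reg : R -> Prop) (r : R).

Definition box (p : plane) : Prop := Rabs (fst p) <= r /\ Rabs (snd p) <= r.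
Definition box_t (p : plane) : Prop := box p /\ reg (fst p).
Definition box_x (p : plane) : Prop := box p /\ reg (snd p).
Definition box_tx (p : plane) : Prop := box p /\ reg (fst p) /\ reg (snd p).
Definition interval (x : R) : Prop := Rabs x <= r.
Definition reg_interval (x : R) : Prop := Rabs x <= r /\ reg x.

Definition only_t (i : tx_axis) : Prop := i = ax_t.
Definition only_x (i : tx_axis) : Prop := i = ax_x.

(** The bounds that a function of [(xi, eta)] inherits from the data. *)
Definition propagated (n : nat) (G : net plane) : Prop :=
  ctl2 box_t only_t n G /\
  ctl2 box_x only_x n G /\
  ctl2 box_tx all_axes n G.

Lemma smooth_net_char_int (G : net plane) :
  smooth_net whole G -> smooth_net whole (fun e => char_int (G e)).
Proof. intros H e He. apply smooth_char_int. now apply H. Qed.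

(** The path of integration stays on a line of constant [xi], and therefore in
    [box_t]. *)
Lemma grows_char_int (K : plane -> Prop) (G : net plane) :
  (forall p, K p -> box_t p) -> smooth_net whole G ->
  grows Q box_t G -> grows Q K (fun e => char_int (G e)).
Proof.
  intros HK SG (b & Hb & H). destruct (sup_bigO_pos _ _ _ H) as (C & HC & HG).
  exists b. split; [exact Hb|]. exists (2 * r * C).
  apply filter_imp with (2 := HG). intros e [He Be] p Hp. apply HK in Hp.
  destruct p as [x y]. destruct Hp as [[Hx Hy] Rx]. cbn in Hx, Hy, Rx.
  apply Rle_trans with (Rabs (x - y) * (C * Rpower e b)).
  - apply (char_int_bound (G e) (x, y)).
    + intros q. apply smooth_whole_continuous. apply SG. lra.
    + intros t Ht. cbn in Ht |- *. apply Be. repeat split; cbn; try assumption.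
      revert Ht Hx Hy. clear. unfold Rmin, Rmax. destruct (Rle_dec x y); unfold Rabs;
        repeat destruct Rcase_abs; intros; lra.
  - rewrite Rmult_assoc. apply Rmult_le_compat_r.
    + apply Rmult_le_pos; [easy | left; apply exp_pos].
    + revert Hx Hy. clear. unfold Rabs; repeat destruct Rcase_abs; intros; lra.
Qed.

(** The derivative in [xi] of the integral along the line of constant [xi] is
    a term on the diagonal and the integral of the derivative in [xi]. *)
Lemma Ctl_char_int (J : tx_axis -> Prop) (K : plane -> Prop) n (G : net plane) :
  (forall p, K p -> box_t p) -> smooth_net whole G ->
  ctl2 box_t only_t n G ->
  ctl2 box_tx all_axes n G ->
  (J ax_x -> ctl2 K J n G) ->
  ctl2 K J n (fun e => char_int (G e)).
Proof.
  intros HK. revert G. induction n as [|n IH]; intros G SG Ht Htx HG.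
  all: assert (SI := smooth_net_char_int G SG).
  all: assert (V0 : grows Q K (fun e => char_int (G e)))
    by (apply grows_char_int; [exact HK | exact SG | exact (Ctl_whole_value _ _ _ _ SG Ht)]).
  - now apply Ctl_whole_0.
  - apply Ctl_whole_S; [exact SI | exact V0 |]. intros i Hi. destruct i.
    + set (Gt := fun e => Dt (G e)).
      assert (St : smooth_net whole Gt) by (apply smooth_net_D; exact SG).
      assert (Sd : smooth_net (V := plane) whole (fun e p => G e (to_diag p)))
        by (intros e He; apply (smooth_linear_change to_diag _ _ linear_to_diag); now apply SG).
      assert (SIt := smooth_net_char_int Gt St).
      apply Ctl_whole_ext with (fun e p => G e (to_diag p) + char_int (Gt e) p).
      * now apply smooth_net_plus.
      * intros e p He. symmetry. apply D_t_char_int. now apply SG.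
      * apply Ctl_whole_plus; [exact Sd | exact SIt | |].
        -- apply (Ctl_linear_change (coordW := R2_coordinates) to_diag _ _ K box_tx J
             (all_axes (coordV := R2_coordinates)) n G linear_to_diag).
           ++ intros p Hp. destruct (HK p Hp) as [[H1 H2] H3]. now repeat split.
           ++ intros j _. split; right; exact I.
           ++ exact SG.
           ++ apply Ctl_le with (S n); [lia | exact Htx].
        -- apply IH; [exact St | | |].
           ++ now apply (Ctl_whole_D (coordV := R2_coordinates)).
           ++ now apply (Ctl_whole_D (coordV := R2_coordinates)).
           ++ intros Hx. apply (Ctl_whole_D (coordV := R2_coordinates)); auto.
    + apply Ctl_whole_ext with (fun e p => -1 * G e p).
      * intros e He. apply smooth_scal. now apply SG.
      * intros e p He. transitivity (- G e p); [ring|]. symmetry.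
        apply D_x_char_int. now apply SG.
      * apply Ctl_scal with (c := fun _ => -1); [apply grows_const, HQ | exact SG |].
        apply Ctl_le with (S n); [lia | now apply HG].
Qed.

Lemma smooth_net_swap (G : net plane) :
  smooth_net whole G -> smooth_net whole (fun e p => G e (swap p)).
Proof. intros H e He. apply smooth_swap. now apply H. Qed.

Lemma ctl_swap_x n (G : net plane) : smooth_net whole G ->
  ctl2 box_x only_x n G -> ctl2 box_t only_t n (fun e p => G e (swap p)).
Proof.
  apply (Ctl_linear_change (coordW := R2_coordinates) swap _ _ box_t box_x only_t only_x n G linear_swap).
  - intros p [[H1 H2] H3]. now repeat split.
  - intros j ->. split; [now left | now right].
Qed.

Lemma ctl_swap_t n (G : net plane) : smooth_net whole G ->
  ctl2 box_t only_t n G -> ctl2 box_x only_x n (fun e p => G e (swap p)).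
Proof.
  apply (Ctl_linear_change (coordW := R2_coordinates) swap _ _ box_x box_t only_x only_t n G linear_swap).
  - intros p [[H1 H2] H3]. now repeat split.
  - intros j ->. split; [now right | now left].
Qed.

Lemma ctl_swap_tx n (G : net plane) : smooth_net whole G ->
  ctl2 box_tx all_axes n G -> ctl2 box_tx all_axes n (fun e p => G e (swap p)).
Proof.
  apply (Ctl_linear_change (coordW := R2_coordinates) swap _ _ box_tx box_tx
    (all_axes (coordV := R2_coordinates)) (all_axes (coordV := R2_coordinates)) n G linear_swap).
  - intros p [[H1 H2] [H3 H4]]. now repeat split.
  - intros j _. split; right; exact I.
Qed.

Lemma propagated_swap n (G : net plane) :
  smooth_net whole G -> propagated n G -> propagated n (fun e p => G e (swap p)).
Proof.
  intros SG (Ht & Hx & Htx). repeat split;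
    [now apply ctl_swap_x | now apply ctl_swap_t | now apply ctl_swap_tx].
Qed.

Lemma propagated_comp n (f : R -> R) (v : net plane) :
  (forall k y, ex_derive_n f k y) -> smooth_net whole v ->
  (forall k, grows Q box (fun e p => Derive_n f k (v e p))) ->
  propagated n v -> propagated n (fun e p => f (v e p)).
Proof.
  intros Sf Sv Hk (Ht & Hx & Htx). repeat split;
    (apply Ctl_comp; [apply dense_whole | apply on_values_whole | apply additive_grows, HQ
      | apply pairing_grows, HQ | exact Sv | exact Sf | | assumption]);
    intros k _; apply grows_subset with box; auto; intros p Hp; apply Hp.
Qed.

(** Nets of solutions whose data have the growth [Q] on [reg]
    and which are themselves bounded well enough to enter the nonlinearity. *)
Record controlled_sol (f : R -> R) (c : R -> R) (A B : net line) (v : net plane) : Prop := {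
  controlled_f : forall k y, ex_derive_n f k y;
  controlled_c : grows Q (@whole R_NormedModule) (fun e _ => c e);
  controlled_smooth_A : smooth_net whole A;
  controlled_smooth_B : smooth_net whole B;
  controlled_A : forall n, ctl reg_interval all_axes n A;
  controlled_B : forall n, ctl reg_interval all_axes n B;
  controlled_char_sol : forall e, 0 < e <= 1 -> char_sol (c e) f (A e) (B e) (v e);
  controlled_value : grows Q box v;
  controlled_comp : forall k, grows Q box (fun e p => Derive_n f k (v e p))
}.

Lemma controlled_sol_smooth f c A B v : controlled_sol f c A B v -> smooth_net whole v.
Proof. intros H e He. apply (controlled_char_sol _ _ _ _ _ H e He). Qed.

Lemma box_swap p : box p -> box (swap p).
Proof. intros [H1 H2]. now split. Qed.

Lemma controlled_sol_swap f c A B v :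
  controlled_sol f c A B v -> controlled_sol f c B A (fun e p => v e (swap p)).
Proof.
  intros []. split; try assumption.
  - intros e He. apply char_sol_swap. auto.
  - now apply grows_preimage with (1 := box_swap).
  - intros k. now apply (grows_preimage Q box box swap (fun e p => Derive_n f k (v e p))) with (1 := box_swap).
Qed.

(** The nonlinear term has to be known to the order [n] only, and [A'] is
    controlled where [reg] holds. *)
Lemma propagated_Dt n f c A B v :
  controlled_sol f c A B v -> propagated n v ->
  ctl2 box_t only_t n (fun e => Dt (v e)) /\
  ctl2 box_tx all_axes n (fun e => Dt (v e)).
Proof.
  intros Hv Pv. assert (Sv := controlled_sol_smooth _ _ _ _ _ Hv).
  destruct Hv as [Sf Hc SA _ HA _ Hv _ Bf].
  assert (PG := propagated_comp n f v Sf Sv Bf Pv).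
  set (G := fun e p => f (v e p)) in PG.
  assert (SG : smooth_net whole G) by (apply smooth_net_comp; assumption).
  assert (SI := smooth_net_char_int G SG).
  assert (SA' : smooth_net whole (fun e => D whole [ax1] (A e))) by now apply smooth_net_D.
  assert (SAf : smooth_net (V := plane) whole (fun e p => D whole [ax1] (A e) (fst p)))
    by (intros e He; apply smooth_line_fst; now apply SA').
  assert (SIc : smooth_net (V := plane) whole (fun e p => c e * char_int (G e) p))
    by (intros e He; apply smooth_scal; now apply SI).
  assert (K : forall (S : plane -> Prop) (J : tx_axis -> Prop), (forall p, S p -> box_t p) ->
    (J ax_x -> ctl2 S J n G) ->
    ctl2 S J n (fun e => Dt (v e))).
  { intros S J HS HG.
    apply Ctl_whole_ext with (fun e p => D whole [ax1] (A e) (fst p) + c e * char_int (G e) p).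
    - now apply smooth_net_plus.
    - intros e p He. rewrite D_line_1 by now apply SA. symmetry. apply (Hv e He).
    - apply Ctl_whole_plus; [exact SAf | exact SIc | |].
      + apply Ctl_line_fst with reg_interval; [|exact SA'|].
        * intros p Hp. destruct (HS p Hp) as [[H1 H2] H3]. now split.
        * apply Ctl_whole_D; [exact SA | exact Logic.I | apply HA].
      + apply Ctl_scal; [exact Hc | exact SI |].
        apply Ctl_char_int; [exact HS | exact SG | apply PG | apply PG | exact HG]. }
  split; apply K.
  - easy.
  - intros E. discriminate E.
  - intros p (H1 & H2 & H3). now split.
  - intros _. apply PG.
Qed.

Lemma propagated_Dx n f c A B v :
  controlled_sol f c A B v -> propagated n v ->
  ctl2 box_x only_x n (fun e => Dx (v e)) /\
  ctl2 box_tx all_axes n (fun e => Dx (v e)).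
Proof.
  intros Hv Pv. assert (Sv := controlled_sol_smooth _ _ _ _ _ Hv).
  set (w := fun e p => v e (swap p)).
  destruct (propagated_Dt n f c B A w) as [Ht Htx].
  - now apply controlled_sol_swap.
  - now apply propagated_swap.
  - set (F := fun e => Dt (w e)) in Ht, Htx.
    assert (Sw : smooth_net whole w) by now apply smooth_net_swap.
    assert (SF : smooth_net whole F) by (intros e He; apply smooth_D; now apply Sw).
    assert (E : forall e p, 0 < e <= 1 ->
      F e (swap p) = Dx (v e) p).
    { intros e p He. unfold F, w. rewrite (Dt_swap (v e)) by now apply Sv. now rewrite swap_swap. }
    split; apply Ctl_whole_ext with (fun e p => F e (swap p)); try exact E;
      try (now apply smooth_net_swap).
    + now apply ctl_swap_t.
    + now apply ctl_swap_tx.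
Qed.

(** Every derivative of order [n + 1] is a derivative of order [n] of [Dt v] or
    [Dx v], and these are expressed through [v] and the data. *)
Theorem controlled_sol_propagated n f c A B v : controlled_sol f c A B v -> propagated n v.
Proof.
  intros Hv. assert (Sv := controlled_sol_smooth _ _ _ _ _ Hv).
  assert (Bv := controlled_value _ _ _ _ _ Hv).
  assert (Vt : forall S : plane -> Prop, (forall p, S p -> box p) -> grows Q S v)
    by (intros S HS; now apply grows_subset with box).
  induction n as [|n IH].
  - repeat split; (apply Ctl_whole_0; [exact Sv|]); apply Vt; intros p Hp; apply Hp.
  - destruct (propagated_Dt n f c A B v Hv IH) as [T1 T2].
    destruct (propagated_Dx n f c A B v Hv IH) as [X1 X2].
    repeat split; (apply Ctl_whole_S; [exact Sv | apply Vt; intros p Hp; apply Hp |]).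
    + intros i ->. exact T1.
    + intros i ->. exact X1.
    + intros [] _; assumption.
Qed.

End Propagation.

(** * Compact sets *)

Lemma compact_bounded {V : NormedModule R_AbsRing} (N : V -> R) (K : V -> Prop) :
  (forall x, continuous N x) -> compact_set K -> exists r, forall x, K x -> N x < r.
Proof.
  intros HN HK.
  destruct (HK (fun O => exists n, O = fun x => N x < n)) as (s & Hs & Hc).
  - intros O [n ->]. apply (open_comp N (fun y => y < n)); [|apply open_lt].
    intros x _. apply HN.
  - intros x Hx. exists (fun y => N y < N x + 1). split; [now eexists | lra].
  - assert (B : exists r, forall O, In O s -> forall x, O x -> N x < r).
    { clear Hc. induction s as [|O s IH]; [exists 0; easy|].
      destruct IH as [r Hr]; [intros; apply Hs; now right|].
      destruct (Hs O (or_introl eq_refl)) as [n Hn].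
      exists (Rmax n r). intros O' [<- | HO'] x Hx.
      - rewrite Hn in Hx. apply Rlt_le_trans with (1 := Hx). apply Rmax_l.
      - apply Rlt_le_trans with (1 := Hr O' HO' x Hx). apply Rmax_r. }
    destruct B as [r Hr]. exists r. intros x Hx.
    destruct (Hc x Hx) as (O & HO & HOx). now apply (Hr O).
Qed.

(** Finitely many neighbourhoods suffice, so the smallest of finitely many
    thresholds for the index works. *)
Lemma compact_eventually {V : NormedModule R_AbsRing} (K : V -> Prop) (P : R -> V -> Prop) :
  compact_set K ->
  (forall x, K x -> exists O, open O /\ O x /\ at_right 0 (fun e => forall y, O y -> P e y)) ->
  at_right 0 (fun e => forall y, K y -> P e y).
Proof.
  intros HK H.
  destruct (HK (fun O => open O /\ at_right 0 (fun e => forall y, O y -> P e y))) as (s & Hs & Hc).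
  - now intros O [HO _].
  - intros x Hx. destruct (H x Hx) as (O & H1 & H2 & H3). now exists O.
  - assert (B : at_right 0 (fun e => forall O, In O s -> forall y, O y -> P e y)).
    { clear Hc. induction s as [|O s IH]; [now apply filter_forall|].
      assert (B1 := IH (fun O' HO' => Hs O' (or_intror HO'))).
      assert (B2 := proj2 (Hs O (or_introl eq_refl))).
      apply filter_imp with (2 := filter_and _ _ B1 B2).
      intros e [E1 E2] O' [<- | HO'] y Hy; [now apply E2 | now apply (E1 O')]. }
    apply filter_imp with (2 := B). intros e He y Hy.
    destruct (Hc y Hy) as (O & HO & HOy). now apply (He O).
Qed.

Lemma compact_union {V : NormedModule R_AbsRing} (K K' : V -> Prop) :
  compact_set K -> compact_set K' -> compact_set (fun x => K x \/ K' x).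
Proof.
  intros H H' F HF Hc.
  destruct (H F HF (fun x Hx => Hc x (or_introl Hx))) as (s & Hs & Cs).
  destruct (H' F HF (fun x Hx => Hc x (or_intror Hx))) as (s' & Hs' & Cs').
  exists (s ++ s'). split.
  - intros O HO. apply in_app_or in HO. destruct HO; auto.
  - intros x [Hx | Hx].
    + destruct (Cs x Hx) as (O & HO & HOx). exists O. split; [|easy]. apply in_or_app. now left.
    + destruct (Cs' x Hx) as (O & HO & HOx). exists O. split; [|easy]. apply in_or_app. now right.
Qed.

Lemma compact_ext {V : NormedModule R_AbsRing} (K K' : V -> Prop) :
  (forall x, K x <-> K' x) -> compact_set K -> compact_set K'.
Proof.
  intros E H F HF Hc. destruct (H F HF) as (s & Hs & Cs).
  - intros x Hx. apply Hc. now apply E.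
  - exists s. split; [easy|]. intros x Hx. apply Cs. now apply E.
Qed.

Lemma compact_interval (a b : R) : compact_set (V := line) (fun x => a <= x <= b).
Proof.
  intros F HF Hc.
  assert (Hch : forall t : R, exists (O : R -> Prop) (d : posreal),
    a <= t <= b -> F O /\ forall y, Rabs (y - t) < d -> O y).
  { intros t. destruct (excluded_middle_informative (a <= t <= b)) as [Ht | Ht].
    - destruct (Hc t Ht) as (O & FO & Ot). destruct (HF O FO t Ot) as [d Hd].
      exists O, d. intros _. split; [easy|]. intros y Hy. now apply Hd.
    - exists (fun _ => True), (mkposreal 1 Rlt_0_1). easy. }
  assert (Hch1 : forall t : R, exists d : posreal, exists O : R -> Prop,
    a <= t <= b -> F O /\ forall y, Rabs (y - t) < d -> O y).
  { intros t. destruct (Hch t) as (O & d & H). now exists d, O. }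
  pose (delta := fun t => proj1_sig (constructive_indefinite_description _ (Hch1 t))).
  assert (Hdelta : forall t, exists O : R -> Prop,
    a <= t <= b -> F O /\ forall y, Rabs (y - t) < delta t -> O y).
  { intros t. exact (proj2_sig (constructive_indefinite_description _ (Hch1 t))). }
  clearbody delta.
  pose (cover := fun t => proj1_sig (constructive_indefinite_description _ (Hdelta t))).
  assert (Hcover : forall t, a <= t <= b -> F (cover t) /\ forall y, Rabs (y - t) < delta t -> cover t y).
  { intros t. exact (proj2_sig (constructive_indefinite_description _ (Hdelta t))). }
  clearbody cover.
  assert (Hl := compactness_list 1 (a, tt) (b, tt) (fun t => delta (fst t))).
  apply Classical_Prop.NNPP in Hl. destruct Hl as [l Hl]. cbn in Hl.
  set (l' := filter (fun t => if excluded_middle_informative (a <= t <= b) then true else false)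
    (map fst l)).
  exists (map cover l'). split.
  - intros O HO. apply in_map_iff in HO. destruct HO as (t & <- & Ht).
    apply filter_In in Ht. destruct Ht as [_ Ht].
    destruct (excluded_middle_informative (a <= t <= b)) as [Ht'|]; [|discriminate].
    now apply Hcover.
  - intros x Hx. destruct (Hl (x, tt)) as ([t []] & Hin & [Ht _] & [Hxt _]); [easy|].
    cbn in Hin, Ht, Hxt. exists (cover t). split.
    + apply in_map. apply filter_In. split.
      * apply in_map_iff. now exists (t, tt).
      * now destruct (excluded_middle_informative (a <= t <= b)).
    + now apply Hcover.
Qed.

(** * Smooth truncation *)

Lemma smooth_of_is_derive (u u' : line -> R) :
  (forall x, is_derive u x (u' x)) -> smooth whole u' -> smooth whole u.
Proof.
  intros H Su'. apply smooth_whole. intros [|n].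
  all: assert (C : forall x, continuous u x)
    by (intros x; apply ex_derive_continuous_R; now exists (u' x)).
  - now apply Cn_whole_0.
  - apply Cn_whole_S; [exact C|]. intros [].
    assert (P : forall x, has_pd ax1 u x) by (intros x; apply has_pd_line; now exists (u' x)).
    split; [exact P|]. apply Cn_whole_ext with u'; [|now apply smooth_Cn].
    intros x. symmetry. exact (eq_trans (pd_line u x (P x)) (is_derive_unique _ _ _ (H x))).
Qed.

(** The family [exp (- 1 / x) / x ^ n], extended by zero, is closed under
    differentiation up to linear combinations, hence consists of smooth
    functions. *)
Definition flat (n : nat) (x : R) : R :=
  if Rle_dec x 0 then 0 else exp (- / x) / x ^ n.

Lemma flat_neg n x : x <= 0 -> flat n x = 0.
Proof. intros H. unfold flat. now destruct (Rle_dec x 0). Qed.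

Lemma flat_pos n x : 0 < x -> flat n x = exp (- / x) / x ^ n.
Proof. intros H. unfold flat. destruct (Rle_dec x 0); [lra | easy]. Qed.

Lemma flat_ge_0 n x : 0 <= flat n x.
Proof.
  destruct (Rle_dec x 0) as [H | H].
  - rewrite flat_neg; lra.
  - rewrite flat_pos by lra. left. apply Rdiv_lt_0_compat; [apply exp_pos | apply pow_lt; lra].
Qed.

(** With [y = 1 / x] this says that [exp y] dominates its Taylor term of order
    [n + 1]. *)
Lemma flat_le n x : 0 < x -> flat n x <= INR (Factorial.fact (S n)) * x.
Proof.
  intros Hx. rewrite flat_pos by easy. set (y := / x).
  assert (Hy : 0 < y) by now apply Rinv_0_lt_compat.
  assert (T : y ^ S n / INR (Factorial.fact (S n)) <= exp y).
  { apply Rle_trans with (2 := exp_ge_taylor y (S n) (Rlt_le _ _ Hy)).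
    rewrite tech5. assert (0 <= sum_f_R0 (fun k => y ^ k / INR (Factorial.fact k)) n); [|lra].
    apply cond_pos_sum. intros k. apply Rmult_le_pos; [apply pow_le; lra|].
    left. apply Rinv_0_lt_compat. apply INR_fact_lt_0. }
  assert (F := INR_fact_lt_0 (S n)). assert (P := pow_lt y n Hy). assert (E := exp_pos y).
  replace (x ^ n) with (/ (y ^ n)) by (unfold y; rewrite pow_inv; apply Rinv_inv).
  replace x with (/ y) by (unfold y; apply Rinv_inv).
  rewrite exp_Ropp. apply Rmult_le_reg_r with (exp y * y); [now apply Rmult_lt_0_compat|].
  replace (/ exp y / / y ^ n * (exp y * y)) with (y ^ S n) by (cbn; field; lra).
  replace (INR (Factorial.fact (S n)) * / y * (exp y * y)) with (INR (Factorial.fact (S n)) * exp y) by (field; lra).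
  apply Rmult_le_reg_r with (/ INR (Factorial.fact (S n))); [now apply Rinv_0_lt_compat|].
  replace (INR (Factorial.fact (S n)) * exp y * / INR (Factorial.fact (S n))) with (exp y) by (field; lra).
  exact T.
Qed.

Lemma is_derive_flat n x :
  is_derive (flat n) x (- INR n * flat (S n) x + flat (S (S n)) x).
Proof.
  destruct (Rtotal_order x 0) as [Hx | [-> | Hx]].
  - rewrite !flat_neg by lra. replace (- INR n * 0 + 0) with 0 by ring.
    apply is_derive_ext_loc with (fun _ => 0).
    + apply (locally_interval _ x m_infty 0); [easy | exact Hx |].
      intros y _ Hy. cbn in Hy. rewrite flat_neg; lra.
    + apply (is_derive_const (K := R_AbsRing) (V := R_NormedModule)).
  - rewrite !flat_neg by lra. replace (- INR n * 0 + 0) with 0 by ring.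
    apply is_derive_Reals. intros eps He.
    assert (F := INR_fact_lt_0 (S (S n))).
    assert (Hd : 0 < eps / INR (Factorial.fact (S (S n)))) by now apply Rdiv_lt_0_compat.
    exists (mkposreal _ Hd). intros h Hh Hlt. cbn [pos] in Hlt.
    rewrite Rplus_0_l, (flat_neg n 0), !Rminus_0_r by lra.
    destruct (Rle_dec h 0) as [Hn | Hp].
    + rewrite flat_neg by easy. unfold Rdiv. rewrite Rmult_0_l, Rabs_R0. exact He.
    + assert (0 < h) by lra. rewrite Rabs_pos_eq in Hlt by lra.
      replace (flat n h / h) with (flat (S n) h).
      * rewrite Rabs_pos_eq by apply flat_ge_0.
        apply Rle_lt_trans with (1 := flat_le (S n) h H).
        apply Rmult_lt_compat_l with (r := INR (Factorial.fact (S (S n)))) in Hlt; [|exact F].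
        replace (INR (Factorial.fact (S (S n))) * (eps / INR (Factorial.fact (S (S n))))) with eps in Hlt by (field; lra).
        exact Hlt.
      * rewrite !flat_pos by easy. cbn. field. split; [|lra]. apply pow_nonzero. lra.
  - rewrite !flat_pos by easy.
    apply is_derive_ext_loc with (fun y => exp (- / y) / y ^ n).
    + apply (locally_interval _ x 0 p_infty); [exact Hx | easy |].
      intros y Hy _. cbn in Hy. now rewrite flat_pos.
    + auto_derive.
      * split; [lra|]. split; [|easy]. apply pow_nonzero. lra.
      * destruct n as [|n]; cbn [pow pred]; [cbn; field; lra|].
        field. split; [|lra]. apply pow_nonzero. lra.
Qed.

Lemma smooth_flat n : smooth (V := line) whole (flat n).
Proof.
  assert (C : forall n x, continuous (flat n) x).
  { intros m x. apply ex_derive_continuous_R.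
    eexists. apply is_derive_flat. }
  apply smooth_whole. intros k. revert n. induction k as [|k IH]; intros n.
  - now apply Cn_whole_0.
  - apply Cn_whole_S; [apply C|]. intros [].
    assert (P : forall x, has_pd ax1 (flat n) x).
    { intros x. apply has_pd_line. eexists. apply is_derive_flat. }
    split; [exact P|].
    apply Cn_whole_ext with (fun x => - INR n * flat (S n) x + 1 * flat (S (S n)) x).
    + intros x. rewrite Rmult_1_l. symmetry.
      exact (eq_trans (pd_line _ x (P x)) (is_derive_unique _ _ _ (is_derive_flat n x))).
    + apply (Cn_lin whole k (flat (S n)) (flat (S (S n)))); apply IH.
Qed.

Lemma smooth_line_continuous (u : line -> R) x : smooth whole u -> continuous u x.
Proof. intros H. now apply smooth_whole_continuous. Qed.

Lemma smooth_affine (a b : R) : smooth (V := line) whole (fun x : R => a * x + b).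
Proof.
  apply (smooth_of_is_derive (fun x : R => a * x + b) (fun _ => a)).
  - intros x. auto_derive; [easy | ring].
  - apply (smooth_const (V := line)).
Qed.

Lemma smooth_comp_affine (u : line -> R) (a b : R) :
  smooth whole u -> smooth (V := line) whole (fun x : R => u (a * x + b)).
Proof.
  intros Su. apply (smooth_comp (V := line) whole u (fun x : R => a * x + b)).
  - now apply smooth_line_iff.
  - apply smooth_affine.
Qed.

(** The normalized primitive of the bump function
    [exp (- 1 / x) * exp (- 1 / (1 - x))] on the unit interval. *)
Lemma smooth_step :
  exists S : R -> R, smooth (V := line) whole S /\
    (forall x, x <= 0 -> S x = 0) /\ (forall x, 1 <= x -> S x = 1).
Proof.
  set (b := fun x : R => flat 0 x * flat 0 (-1 * x + 1)).
  assert (Sb : smooth (V := line) whole b).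
  { apply (smooth_mult (V := line)); [apply smooth_flat|].
    apply (smooth_comp_affine (flat 0)). apply smooth_flat. }
  assert (Cb : forall x, continuous b x) by (intros; now apply smooth_line_continuous).
  assert (Z : forall x y, (forall t, Rmin x y < t < Rmax x y -> b t = 0) -> RInt b x y = 0).
  { intros x y H. rewrite (RInt_ext b (fun _ => 0)) by exact H.
    rewrite RInt_const. unfold scal; cbn; unfold mult; cbn. ring. }
  set (I := RInt b 0 1).
  assert (HI : 0 < I).
  { apply RInt_gt_0; [lra | | auto]. intros x Hx. unfold b. apply Rmult_lt_0_compat.
    - rewrite flat_pos by lra. cbn. rewrite Rdiv_1_r. apply exp_pos.
    - rewrite flat_pos by lra. cbn. rewrite Rdiv_1_r. apply exp_pos. }
  exists (fun x => / I * RInt b 0 x). split; [|split].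
  - apply (smooth_of_is_derive _ (fun x => / I * b x)).
    + intros x. apply (is_derive_scal (fun x => RInt b 0 x) x (/ I)). now apply is_derive_RInt_R.
    + now apply (smooth_scal (V := line)).
  - intros x Hx. rewrite Z; [ring|]. intros t. rewrite Rmin_right, Rmax_left by lra.
    intros Ht. unfold b. rewrite (flat_neg 0 t) by lra. ring.
  - intros x Hx. rewrite <- (RInt_Chasles_R b 0 1 x Cb), (Z 1 x).
    + fold I. field. lra.
    + intros t. rewrite Rmin_left, Rmax_right by lra. intros Ht.
      unfold b. rewrite (flat_neg 0 (-1 * t + 1)) by lra. ring.
Qed.

Lemma bounded_of_support (g : R -> R) (N : R) :
  0 <= N -> (forall x, continuous g x) -> (forall x, N < Rabs x -> g x = 0) ->
  exists B, forall x, Rabs (g x) <= B.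
Proof.
  intros HN Cg Zg.
  destruct (continuity_ab_maj (fun x => Rabs (g x)) (- N) N) as (m & Hm & _); [lra | |].
  - intros x _. apply continuity_pt_filterlim.
    apply (continuous_comp g Rabs); [apply Cg | apply continuous_Rabs].
  - exists (Rabs (g m)). intros x. destruct (Rle_dec (Rabs x) N) as [H | H].
    + apply Hm. revert H. unfold Rabs. destruct Rcase_abs; lra.
    + rewrite Zg by lra. rewrite Rabs_R0. apply Rabs_pos.
Qed.

(** A smooth nonlinearity agrees on any bounded interval with one for which
    the equation is globally solvable. *)
Lemma truncation (f : R -> R) (M : R) :
  0 <= M -> (forall k y, ex_derive_n f k y) ->
  exists g : R -> R, (forall k y, ex_derive_n g k y) /\
    (forall s, Rabs s <= M -> g s = f s) /\
    (exists B, forall s, Rabs (g s) <= B) /\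
    (exists L, forall s t, Rabs (g s - g t) <= L * Rabs (s - t)).
Proof.
  intros HM Sf. destruct smooth_step as (S & SS & S0 & S1).
  (* [chi] is [1] on [- M, M] and vanishes outside [- M - 1, M + 1]. *)
  set (chi := fun s : R => S (1 * s + (M + 1)) * S (-1 * s + (M + 1))).
  set (g := fun s : R => f s * chi s).
  assert (Sg : smooth (V := line) whole g).
  { apply (smooth_mult (V := line)); [now apply smooth_line_iff|].
    apply (smooth_mult (V := line)); now apply (smooth_comp_affine S). }
  assert (Z : forall s, M + 1 < Rabs s -> g s = 0).
  { intros s Hs. unfold g, chi. destruct (Rle_dec 0 s) as [H | H].
    - rewrite Rabs_pos_eq in Hs by easy. rewrite (S0 (-1 * s + (M + 1))) by lra. ring.
    - rewrite Rabs_left in Hs by lra. rewrite (S0 (1 * s + (M + 1))) by lra. ring. }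
  exists g. repeat split.
  - now apply smooth_line_iff.
  - intros s Hs. assert (H : - M <= s <= M) by (revert Hs; unfold Rabs; destruct Rcase_abs; lra).
    unfold g, chi. rewrite !S1 by lra. ring.
  - apply bounded_of_support with (M + 1); [lra | | exact Z].
    intros x. now apply smooth_line_continuous.
  - assert (Sg' := smooth_line_Derive g Sg).
    destruct (bounded_of_support (Derive g) (M + 1)) as [L HL].
    + lra.
    + intros x. now apply smooth_line_continuous.
    + intros x Hx. rewrite <- (Derive_const 0 x). apply Derive_ext_loc.
      assert (Hd : 0 < Rabs x - (M + 1)) by lra. exists (mkposreal _ Hd). intros y Hy.
      apply Z. change (Rabs (y - x) < Rabs x - (M + 1)) in Hy.
      assert (T := Rabs_triang_inv x y). rewrite Rabs_minus_sym in T. lra.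
    + exists L. intros s t.
      destruct (MVT_gen g t s (Derive g)) as (z & _ & E).
      * intros z _. apply Derive_correct. now apply smooth_line_ex_derive.
      * intros z _. apply continuity_pt_filterlim. now apply smooth_line_continuous.
      * rewrite E, Rabs_mult. apply Rmult_le_compat_r; [apply Rabs_pos | apply HL].
Qed.

(** * Operations on classes *)

Section Classes.

Context {V : NormedModule R_AbsRing} {coordV : Coordinates V}.

Lemma compact_in_sub (X Y K : V -> Prop) :
  (forall x, X x -> Y x) -> compact_in X K -> compact_in Y K.
Proof. intros H [H1 H2]. split; auto. Qed.

Lemma moderate_sub (X Y : V -> Prop) (u : net V) :
  dense_interior X -> (forall x, X x -> Y x) -> moderate Y u -> moderate X u.
Proof.
  intros HX HXY [Su Cu].
  assert (HD : forall l e, 0 < e <= 1 -> smooth X (u e) /\ forall x, X x -> D X l (u e) x = D Y l (u e) x).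
  { intros l e He. apply D_sub; auto. }
  split; [intros e He; now apply (HD [] e)|].
  intros K l HK. destruct (Cu K l (compact_in_sub X Y K HXY HK)) as [b Hb]. exists b.
  apply sup_bigO_le with (2 := Hb). apply eventually_eq_le.
  intros e He x Hx. apply HD; [exact He | now apply HK].
Qed.

Lemma negligible_sub (X Y : V -> Prop) (u : net V) :
  dense_interior X -> (forall x, X x -> Y x) -> negligible Y u -> negligible X u.
Proof.
  intros HX HXY [Su Cu].
  assert (HD : forall l e, 0 < e <= 1 -> smooth X (u e) /\ forall x, X x -> D X l (u e) x = D Y l (u e) x).
  { intros l e He. apply D_sub; auto. }
  split; [intros e He; now apply (HD [] e)|].
  intros K l a HK Ha. apply sup_bigO_le with (2 := Cu K l a (compact_in_sub X Y K HXY HK) Ha).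
  apply eventually_eq_le. intros e He x Hx. apply HD; [exact He | now apply HK].
Qed.

Lemma gderiv_cls (X : V -> Prop) l (u : net V) :
  dense_interior X -> moderate X u ->
  gderiv X l (cls X u) = cls X (fun e => D X l (u e)).
Proof.
  intros HX Hu. apply (lift_cls X X (fun u e => D X l (u e))); try assumption.
  intros u' [Hu' Hn]. now apply negligible_D_diff.
Qed.

Lemma grestrict_cls (X w : V -> Prop) (u : net V) :
  dense_interior X -> dense_interior w -> (forall x, w x -> X x) -> moderate X u ->
  grestrict w (cls X u) = cls w u.
Proof.
  intros HX Hw HwX Hu. apply (lift_cls X w (fun u => u)); try assumption.
  intros u' [Hu' Hn]. now apply negligible_sub with X.
Qed.

Lemma gcomp_cls (X : V -> Prop) (f : R -> R) (u : net V) :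
  dense_interior X -> O_M f -> moderate X u ->
  gcomp X f (cls X u) = cls X (fun e x => f (u e x)).
Proof.
  intros HX Hf Hu. apply (lift_cls X X (fun u e x => f (u e x))); try assumption.
  intros u' [Hu' Hn]. now apply negligible_comp_diff.
Qed.

Lemma gsub_cls (X : V -> Prop) (u v : net V) :
  dense_interior X -> moderate X u -> moderate X v ->
  gsub X (cls X u) (cls X v) = cls X (fun e x => u e x - v e x).
Proof.
  intros HX Hu Hv. apply functional_extensionality. intros w.
  apply propositional_extensionality. split.
  - intros (u' & v' & [Hu' Nu] & [Hv' Nv] & Hw). revert Hw.
    rewrite (cls_eq X HX (fun e x => u' e x - v' e x) (fun e x => u e x - v e x)); [easy|].
    apply negligible_ext with (fun e x => (u' e x - u e x) - (v' e x - v e x)); [exact HX | |].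
    + now apply negligible_minus.
    + intros; ring.
  - intros Hw. exists u, v. split; [now apply cls_refl|]. split; [now apply cls_refl | exact Hw].
Qed.

(** [s v - r u = (v - u) s + (s - r) u], with one negligible factor in each
    term. *)
Lemma gscal_cls (X : V -> Prop) (r : R -> R) (u : net V) :
  dense_interior X -> num_moderate r -> moderate X u ->
  gscal X (num_cls r) (cls X u) = cls X (fun e x => r e * u e x).
Proof.
  intros HX Hr Hu. apply functional_extensionality. intros w.
  apply propositional_extensionality. split.
  - intros (s & v & [Hs Ns] & [Hv Nv] & Hw). revert Hw.
    rewrite (cls_eq X HX (fun e x => s e * v e x) (fun e x => r e * u e x)); [easy|].
    apply negligible_ext with (fun e x => (v e x - u e x) * s e + (s e - r e) * u e x);
      [exact HX | |].
    + apply negligible_plus; [exact HX | |].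
      * apply (negligible_mult X HX _ (fun e _ => s e)); [exact Nv | now apply moderate_num].
      * apply (negligible_mult X HX (fun e _ => s e - r e) u); [|exact Hu].
        now apply (negligible_num X HX (fun e => s e - r e)).
    + intros; ring.
  - intros Hw. exists r, u. split; [|split; [now apply cls_refl | exact Hw]].
    split; [exact Hr|]. intros a Ha. exists 0. apply filter_forall.
    intros e. rewrite Rminus_diag, Rabs_R0. lra.
Qed.

Lemma eventually_small (C : R) : 0 <= C -> at_right 0 (fun e => C * e <= 1).
Proof.
  intros HC. apply filter_imp with (2 := at_right_0_lt (/ (C + 1)) (Rinv_0_lt_compat _ (Rle_lt_0_plus_1 _ HC))).
  intros e [He Hlt]. apply Rmult_lt_compat_l with (r := C + 1) in Hlt; [|lra].
  rewrite Rinv_r in Hlt by lra. lra.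
Qed.

(** A positive power of [eps] absorbs the constant, so that the bound does not
    depend on the compact set. *)
Lemma negligible_small (X K : V -> Prop) (u : net V) :
  dense_interior X -> negligible X u -> compact_in X K ->
  at_right 0 (fun e => forall x, K x -> Rabs (u e x) <= 1).
Proof.
  intros HX [Su Cu] HK.
  destruct (sup_bigO_pos _ _ _ (Cu K [] 1 HK Rle_0_1)) as (C & HC & H).
  apply filter_imp with (2 := filter_and _ _ H (eventually_small C HC)).
  intros e [[He Hb] Hs] x Hx. specialize (Hb x Hx).
  rewrite Rpower_1 in Hb by lra. rewrite D_nil in Hb; [lra | exact HX | | now apply HK].
  apply Su. lra.
Qed.

(** Representatives differ by arbitrarily little on compact sets, so a bound
    for one of them holds up to [1] for every other one, for small indices
    that depend on the compact set. *)
Lemma bounded_type_cls (X L : V -> Prop) (u : net V) :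
  dense_interior X -> bounded_type L (cls X u) ->
  exists C, 0 <= C /\ forall K, compact_in X K -> (forall x, K x -> L x) ->
    at_right 0 (fun e => forall x, K x -> Rabs (u e x) <= C).
Proof.
  intros HX (w & [Hw Nw] & C & HC). exists (Rabs C + 1). split.
  - assert (H := Rabs_pos C). lra.
  - intros K HK HL.
    apply filter_imp with (2 := filter_and _ _ HC (negligible_small X K _ HX Nw HK)).
    intros e [H1 H2] x Hx. specialize (H1 x (HL x Hx)). specialize (H2 x Hx).
    replace (u e x) with (w e x - (w e x - u e x)) by ring.
    apply Rle_trans with (1 := Rabs_triang _ _). rewrite Rabs_Ropp.
    assert (H := Rle_abs C). lra.
Qed.

Lemma bounded_type_grows (X K : V -> Prop) (u : net V) :
  dense_interior X -> compact_in X K -> bounded_type K (cls X u) -> grows rate_0 K u.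
Proof.
  intros HX HK H. destruct (bounded_type_cls X K u HX H) as (C & _ & HC).
  exists 0. split; [easy|]. apply sup_bigO_0_iff. exists C. now apply HC.
Qed.

(** All sets on which classes are considered below are relatively open in the
    line or in the strip. *)
Lemma dense_rel_open (X w : V -> Prop) :
  dense_interior X -> rel_open X w -> dense_interior w.
Proof.
  intros HX (O & HO & Hw) x Hx P HP. apply Hw in Hx. destruct Hx as [HXx HOx].
  destruct (HX x HXx _ (filter_and _ _ HP (HO x HOx))) as (y & [HPy HOy] & Hy).
  exists y. split; [exact HPy|].
  apply filter_imp with (2 := filter_and _ _ Hy (HO y HOy)). intros z Hz. now apply Hw.
Qed.

End Classes.

Lemma compact_image {V W : NormedModule R_AbsRing} (L : V -> W) (K : V -> Prop) :
  (forall x, continuous L x) -> compact_set K -> compact_set (fun y => exists x, K x /\ y = L x).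
Proof.
  intros HL HK F HF Hc.
  destruct (HK (fun O => exists O', F O' /\ O = fun x => O' (L x))) as (s & Hs & Cs).
  - intros O (O' & FO & ->). apply (open_comp L O'); [intros x _; apply HL | now apply HF].
  - intros x Hx. destruct (Hc (L x)) as (O & FO & HO); [now exists x|].
    exists (fun x => O (L x)). split; [now exists O | exact HO].
  - assert (B : exists s', (forall O, In O s' -> F O) /\
      forall x, (exists O, In O s /\ O x) -> exists O, In O s' /\ O (L x)).
    { clear Cs. induction s as [|O s IH].
      - exists []. split; [easy|]. intros x (O & [] & _).
      - destruct IH as (s' & Fs' & Hs'); [intros; apply Hs; now right|].
        destruct (Hs O (or_introl eq_refl)) as (O' & FO & ->).
        exists (O' :: s'). split.
        + intros O [<- | HO]; auto.
        + intros x (O & [<- | HO] & Hx).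
          * exists O'. split; [now left | exact Hx].
          * destruct (Hs' x (ex_intro _ O (conj HO Hx))) as (O1 & H1 & H2).
            exists O1. split; [now right | exact H2]. }
    destruct B as (s' & Fs' & Hs'). exists s'. split; [exact Fs'|].
    intros y (x & Hx & ->). apply Hs'. now apply Cs.
Qed.

(** * The strip and its initial line *)

Lemma strip_interior (T t x : R) : 0 < t < T -> locally (t, x) (strip T).
Proof.
  intros Ht. assert (Hd : 0 < Rmin t (T - t)) by (apply Rmin_pos; lra).
  exists (mkposreal _ Hd). intros [s y] [Hs _]. unfold strip. cbn.
  change (Rabs (s - t) < Rmin t (T - t)) in Hs. revert Hs.
  unfold Rmin, Rabs. destruct Rle_dec, Rcase_abs; lra.
Qed.

Lemma dense_strip (T : R) : 0 < T -> dense_interior (strip T).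
Proof.
  intros HT [t x] Ht P [d Hd]. unfold strip in Ht. cbn in Ht.
  set (s := Rmin d T). assert (Hs : 0 < s) by (apply Rmin_pos; [apply d | exact HT]).
  assert (s <= d) by apply Rmin_l. assert (s <= T) by apply Rmin_r. clearbody s.
  assert (Hb : forall t', Rabs (t' - t) < d -> P (t', x)).
  { intros t' Ht'. apply Hd. split; [exact Ht' | apply ball_center]. }
  destruct (Rle_dec t (T / 2)) as [H1 | H1].
  - exists (t + s / 4, x). split; [|apply strip_interior; lra].
    apply Hb. rewrite Rabs_pos_eq; lra.
  - exists (t - s / 4, x). split; [|apply strip_interior; lra].
    apply Hb. rewrite Rabs_left; lra.
Qed.

Section Trace.

Variables (T : R) (HT : 0 < T).

Lemma strip_0 (x : R) : strip T (0, x).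
Proof. unfold strip. cbn. lra. Qed.

Lemma continuous_on_strip_0 (w : plane -> R) (x eta : R) :
  continuous_on (strip T) w -> 0 < eta ->
  exists d, 0 < d /\ forall t y, 0 <= t <= T -> t < d -> Rabs (y - x) < d ->
    Rabs (w (t, y) - w (0, x)) < eta.
Proof.
  intros Hw He.
  assert (H := proj1 (filterlim_locally w (w (0, x))) (Hw (0, x) (strip_0 x)) (mkposreal eta He)).
  destruct H as [d Hd]. exists d. split; [apply d|].
  intros t y Ht Htd Hy. apply Hd; [|exact Ht]. split; [|exact Hy].
  change (Rabs (t - 0) < d). rewrite Rminus_0_r, Rabs_pos_eq; lra.
Qed.

(** By the mean value theorem on the lines [t > 0] and continuity up to
    [t = 0], restriction to the initial line commutes with [d/dx]. *)
Lemma is_derive_trace (w : plane -> R) (x : R) :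
  smooth (strip T) w ->
  is_derive (fun y : R => w (0, y)) x
    (Dtx (strip T) [ax_x] w (0, x)).
Proof.
  intros Sw. set (wx := Dtx (strip T) [ax_x] w).
  assert (Cw := smooth_continuous_on _ _ Sw).
  assert (Cwx : continuous_on (strip T) wx)
    by exact (D_continuous_on (coordV := R2_coordinates) (strip T) [ax_x] w Sw).
  assert (Dw : forall t y, 0 < t < T -> is_derive (fun y : R => w (t, y)) y (wx (t, y))).
  { intros t y Ht. assert (Hi := strip_interior T t y Ht). unfold wx.
    rewrite D_interior by assumption. apply pd_x_is_derive.
    destruct (smooth_Cn _ _ 1 Sw) as [_ H]. exact (proj1 (H ax_x) (t, y) Hi). }
  apply is_derive_Reals. intros eta He.
  destruct (continuous_on_strip_0 wx x (eta / 2) Cwx) as (d & Hd & Hc); [lra|].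
  exists (mkposreal d Hd). intros h Hh Hhd. cbn [pos] in Hhd.
  assert (B : Rabs (w (0, x + h) - w (0, x) - h * wx (0, x)) <= eta / 2 * Rabs h).
  { apply le_epsilon. intros eta2 He2.
    destruct (continuous_on_strip_0 w x (eta2 / 2) Cw) as (d1 & Hd1 & H1); [lra|].
    destruct (continuous_on_strip_0 w (x + h) (eta2 / 2) Cw) as (d2 & Hd2 & H2); [lra|].
    set (s := Rmin (Rmin d T) (Rmin d1 d2)).
    assert (Hs : 0 < s /\ s <= d /\ s <= T /\ s <= d1 /\ s <= d2).
    { unfold s, Rmin. repeat destruct Rle_dec; lra. }
    clearbody s. set (t := s / 2). assert (Ht : 0 < t < s) by (unfold t; lra). clearbody t.
    specialize (H1 t x). rewrite Rminus_diag, Rabs_R0 in H1.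
    assert (G1 : Rabs (w (t, x) - w (0, x)) < eta2 / 2) by (apply H1; lra).
    specialize (H2 t (x + h)). rewrite Rminus_diag, Rabs_R0 in H2.
    assert (G2 : Rabs (w (t, x + h) - w (0, x + h)) < eta2 / 2) by (apply H2; lra).
    destruct (MVT_gen (fun y => w (t, y)) x (x + h) (fun y => wx (t, y))) as (z & Hz & E).
    - intros z _. apply Dw. lra.
    - intros z _. apply continuity_pt_filterlim.
      apply (ex_derive_continuous_R (fun y => w (t, y))).
      exists (wx (t, z)). apply Dw. lra.
    - assert (G3 : Rabs (wx (t, z) - wx (0, x)) < eta / 2).
      { apply Hc; [lra | lra |]. revert Hz Hhd. unfold Rmin, Rmax.
        destruct Rle_dec; unfold Rabs; repeat destruct Rcase_abs; intros; lra. }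
      replace (w (0, x + h) - w (0, x) - h * wx (0, x)) with
        ((wx (t, z) - wx (0, x)) * h - (w (t, x + h) - w (0, x + h)) + (w (t, x) - w (0, x))).
      + apply Rle_trans with (1 := Rabs_triang _ _).
        assert (T1 := Rabs_triang ((wx (t, z) - wx (0, x)) * h) (- (w (t, x + h) - w (0, x + h)))).
        rewrite Rabs_Ropp, Rabs_mult in T1.
        assert (G4 : Rabs (wx (t, z) - wx (0, x)) * Rabs h <= eta / 2 * Rabs h)
          by (apply Rmult_le_compat_r; [apply Rabs_pos | lra]).
        unfold Rminus in *. lra.
      + replace ((wx (t, z) - wx (0, x)) * h) with (wx (t, z) * (x + h - x) - h * wx (0, x)) by ring.
        rewrite <- E. ring. }
  change (Rabs ((w (0, x + h) - w (0, x)) / h - wx (0, x)) < eta).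
  replace ((w (0, x + h) - w (0, x)) / h - wx (0, x))
    with ((w (0, x + h) - w (0, x) - h * wx (0, x)) / h) by (field; exact Hh).
  unfold Rdiv. rewrite Rabs_mult, Rabs_inv.
  assert (Hp := Rabs_pos_lt h Hh).
  apply Rle_lt_trans with (eta / 2 * Rabs h * / Rabs h).
  - apply Rmult_le_compat_r; [|exact B]. left. now apply Rinv_0_lt_compat.
  - rewrite Rmult_assoc, Rinv_r by lra. lra.
Qed.

Lemma smooth_trace (w : plane -> R) :
  smooth (strip T) w -> smooth (V := line) whole (fun y : R => w (0, y)).
Proof.
  intros Sw. apply smooth_whole. intros n. revert w Sw.
  induction n as [|n IH]; intros w Sw.
  all: assert (C : forall x, continuous (fun y : R => w (0, y)) x)
    by (intros x; apply ex_derive_continuous_R;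
        eexists; now apply is_derive_trace).
  - now apply Cn_whole_0.
  - apply Cn_whole_S; [exact C|]. intros [].
    assert (P : forall x, has_pd ax1 (fun y : R => w (0, y)) x).
    { intros x. apply has_pd_line. eexists. now apply is_derive_trace. }
    split; [exact P|].
    apply Cn_whole_ext with (fun x => Dtx (strip T) [ax_x] w (0, x)).
    + intros x. symmetry.
      exact (eq_trans (pd_line _ x (P x)) (is_derive_unique _ _ _ (is_derive_trace w x Sw))).
    + apply IH. now apply smooth_D.
Qed.

Lemma D_trace (l : list unit) (w : plane -> R) (x : R) :
  smooth (strip T) w ->
  D (V := line) (coordV := R_coordinates) whole l (fun y : R => w (0, y)) x =
  Dtx (strip T) (map (fun _ => ax_x) l) w (0, x).
Proof.
  revert w x. induction l as [|[] l IH] using rev_ind; intros w x Sw.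
  - assert (E := D_nil whole (fun y : R => w (0, y)) x dense_whole (smooth_trace w Sw) Logic.I).
    transitivity (w (0, x)); [exact E|]. symmetry.
    apply (D_nil (coordV := R2_coordinates)); [now apply dense_strip | exact Sw | apply strip_0].
  - rewrite map_app.
    assert (S' := smooth_D (coordV := R2_coordinates) (strip T) [ax_x] w Sw).
    transitivity (D (V := line) (coordV := R_coordinates) whole l
      (fun y : R => Dtx (strip T) [ax_x] w (0, y)) x).
    + transitivity (D (V := line) (coordV := R_coordinates) whole l
        (D (V := line) whole [ax1] (fun y : R => w (0, y))) x).
      { exact (D_app (V := line) (coordV := R_coordinates) whole l [ax1] (fun y : R => w (0, y)) x dense_whole (smooth_trace w Sw) Logic.I). }
      apply D_ext; [apply dense_whole | | now apply smooth_trace | | easy].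
      * apply smooth_D. now apply smooth_trace.
      * intros y _.
        exact (eq_trans (D_line_1 _ y (smooth_trace w Sw))
          (is_derive_unique _ _ _ (is_derive_trace w y Sw))).
    + rewrite (IH _ x S'). symmetry.
      apply (D_app (coordV := R2_coordinates) (strip T) (map (fun _ => ax_x) l) [ax_x]); [now apply dense_strip | exact Sw | apply strip_0].
Qed.

Lemma negligible_trace (w : net plane) :
  negligible (strip T) w -> negligible (V := line) whole (fun e x => w e (0, x)).
Proof.
  intros [Sw Cw]. split.
  - intros e He. apply smooth_trace. now apply Sw.
  - intros K l a [HK _] Ha.
    assert (HK' : compact_in (strip T) (fun p : plane => exists x : R, K x /\ p = (0, x))).
    { split.
      - apply (compact_image (fun x : line => (0, x) : plane)); [|exact HK].
        intros x. apply continuous_pair; [apply continuous_const | apply continuous_id].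
      - intros p (x & _ & ->). apply strip_0. }
    destruct (Cw _ (map (fun _ => ax_x) l) a HK' Ha) as [C HC]. exists C.
    apply filter_imp with (2 := filter_and _ _ HC (at_right_0_lt 1 Rlt_0_1)).
    intros e [H He] x Hx. rewrite D_trace by (apply Sw; lra). apply H. now exists x.
Qed.

Lemma at_time_0_cls (u : net plane) :
  moderate (strip T) u -> at_time_0 (cls (strip T) u) = cls real_line (fun e (x : R) => u e (0, x)).
Proof.
  intros Hu. apply (lift_cls (strip T) real_line (fun u e x => u e (0, x))).
  - now apply dense_strip.
  - exact dense_whole.
  - exact Hu.
  - intros u' [_ Hn]. exact (negligible_trace _ Hn).
Qed.

End Trace.

(** * The initial data *)

Lemma compact_interval_abs (r : R) : compact_set (V := line) (fun x => Rabs x <= r).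
Proof.
  apply compact_ext with (2 := compact_interval (- r) r). intros x.
  split; unfold Rabs; destruct Rcase_abs; lra.
Qed.

Lemma compact_annulus (d r : R) : compact_set (V := line) (fun x => Rabs x <= r /\ d <= Rabs x).
Proof.
  apply compact_ext with
    (fun x => (Rmax d 0 <= x <= r) \/ (- r <= x <= - Rmax d 0)).
  - intros x. unfold Rmax, Rabs. destruct Rle_dec, Rcase_abs; lra.
  - apply (compact_union (V := line)); apply compact_interval.
Qed.

(** A compactly supported datum with bounded derivative is bounded, uniformly
    in the compact set on which it is looked at: outside the support it is
    negligible, and from there one integrates the derivative. *)
Lemma data_bounded (u : net line) :
  moderate whole u -> compact_set (gsupp whole (cls whole u)) ->
  bounded_type whole (cls whole (fun e => D whole [ax1] (u e))) ->
  exists M, 0 <= M /\ forall r, at_right 0 (fun e => forall x, Rabs x <= r -> Rabs (u e x) <= M).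
Proof.
  intros Hu Hsupp Hd.
  destruct (compact_bounded (V := line) Rabs _ continuous_Rabs Hsupp) as [r0' Hr0'].
  set (r0 := Rmax r0' 0). assert (P0 : 0 <= r0) by apply Rmax_r.
  assert (Hr0 : forall x, gsupp whole (cls whole u) x -> Rabs x < r0).
  { intros x Hx. apply Rlt_le_trans with (1 := Hr0' x Hx). apply Rmax_l. }
  clearbody r0. clear Hr0'.
  destruct (bounded_type_cls whole whole _ dense_whole Hd) as (C & HC & HCK).
  assert (Out : forall r, at_right 0 (fun e => forall x, Rabs x <= r /\ r0 <= Rabs x -> Rabs (u e x) <= 1)).
  { intros r. apply (compact_eventually (V := line) _ (fun e x => Rabs (u e x) <= 1) (compact_annulus r0 r)).
    intros x [_ Hx].
    assert (Hns : exists w, rel_open whole w /\ w x /\ grestrict w (cls whole u) = gzero w).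
    { apply Classical_Prop.NNPP. intros N. apply (Rlt_not_le _ _ (Hr0 x (conj Logic.I N))). exact Hx. }
    destruct Hns as (w & Hw & Hwx & E).
    assert (HwD := dense_rel_open whole w dense_whole Hw).
    destruct Hw as (O & HO & HwO).
    assert (Mw : moderate w u) by (apply moderate_sub with whole; easy).
    rewrite grestrict_cls in E; [|apply dense_whole | exact HwD | easy | exact Hu].
    assert (Nw : cls w u u) by (now apply cls_refl).
    rewrite E in Nw. destruct Nw as [_ Nw].
    destruct (HO x (proj2 (proj1 (HwO x) Hwx))) as [d Hd'].
    exists (fun y => Rabs (y - x) < d / 2). split; [|split].
    - intros y Hy. assert (Hp : 0 < d / 2 - Rabs (y - x)) by lra.
      exists (mkposreal _ Hp). intros z Hz.
      change (Rabs (z - y) < d / 2 - Rabs (y - x)) in Hz.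
      replace (z - x) with ((z - y) + (y - x)) by ring.
      apply Rle_lt_trans with (1 := Rabs_triang _ _). lra.
    - rewrite Rminus_diag, Rabs_R0. assert (H := cond_pos d). lra.
    - assert (HK : compact_in w (fun y => x - d / 2 <= y <= x + d / 2)).
      { split; [apply compact_interval|]. intros y Hy. apply HwO. split; [easy|].
        apply Hd'. change (Rabs (y - x) < d). assert (H := cond_pos d).
        unfold Rabs. destruct Rcase_abs; lra. }
      assert (B := negligible_small w _ _ HwD Nw HK).
      apply filter_imp with (2 := B). intros e He y Hy. rewrite <- (Rminus_0_r (u e y)).
      apply He. revert Hy. unfold Rabs. destruct Rcase_abs; lra. }
  exists (1 + C * (2 * r0)). split.
  - assert (0 <= C * (2 * r0)) by (apply Rmult_le_pos; lra). lra.
  - intros r.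
    assert (HK : compact_in whole (fun x => Rabs x <= r0)) by (split; [apply compact_interval_abs | easy]).
    assert (B := HCK _ HK (fun _ _ => Logic.I)).
    assert (Pos : 0 <= C * (2 * r0)) by (apply Rmult_le_pos; lra).
    apply filter_imp with (2 := filter_and _ _ (at_right_0_lt 1 Rlt_0_1)
      (filter_and _ _ B (filter_and _ _ (Out r) (Out r0)))).
    intros e (He & H1 & H2 & H3) x Hx.
    assert (Se : smooth whole (u e)) by (apply Hu; lra).
    destruct (Rle_dec r0 (Rabs x)) as [Hx0 | Hx0].
    + assert (H := H2 x (conj Hx Hx0)). lra.
    + assert (Er : Rabs (u e r0) <= 1) by (apply H3; rewrite Rabs_pos_eq; lra).
      destruct (MVT_gen (u e) r0 x (Derive (u e))) as (z & Hz & E).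
      * intros z _. apply Derive_correct. now apply smooth_line_ex_derive.
      * intros z _. apply continuity_pt_filterlim. now apply smooth_line_continuous.
      * replace (u e x) with (u e r0 + (u e x - u e r0)) by ring. rewrite E.
        apply Rle_trans with (1 := Rabs_triang _ _). rewrite Rabs_mult.
        assert (Hx1 : - r0 < x < r0) by (revert Hx0; unfold Rabs; destruct Rcase_abs; lra).
        apply Rplus_le_compat; [exact Er|]. apply Rmult_le_compat; try apply Rabs_pos.
        -- rewrite <- D_line_1 by exact Se. apply H1.
           revert Hz. rewrite Rmin_right, Rmax_left by lra. unfold Rabs. destruct Rcase_abs; lra.
        -- unfold Rabs. destruct Rcase_abs; lra.
Qed.

Lemma moderate_data (u : net line) (r : R) n :
  moderate whole u ->
  Ctl whole (grows any_rate (reg_interval (fun _ => True) r)) all_axes n u.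
Proof.
  intros Hu. apply moderate_iff; [exact Hu|]. split; [|easy].
  apply compact_ext with (2 := compact_interval_abs r). unfold reg_interval. tauto.
Qed.

Lemma open_punctured : open (fun x : R => x <> 0).
Proof. apply open_neq. Qed.

Lemma dense_punctured : dense_interior (V := line) punctured_line.
Proof.
  apply (dense_rel_open whole); [apply dense_whole|].
  exists (fun x => x <> 0). split; [apply open_punctured | unfold whole, punctured_line; tauto].
Qed.

(** The bound holds for some representative of each derivative, hence for all
    of them. *)
Lemma regular_data (u : net line) (d r : R) n :
  0 < d -> moderate whole u -> G0 punctured_line (cls punctured_line u) ->
  Ctl whole (grows rate_0 (reg_interval (fun x => d <= Rabs x) r)) all_axes n u.
Proof.
  intros Hd Hu [_ H] l _ _.
  assert (HK : compact_in punctured_line (reg_interval (fun x => d <= Rabs x) r)).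
  { split; [apply compact_annulus|]. intros x [_ Hx] ->. rewrite Rabs_R0 in Hx. lra. }
  specialize (H l _ HK).
  assert (Hp : moderate punctured_line u)
    by (apply moderate_sub with whole; [apply dense_punctured | easy | exact Hu]).
  rewrite gderiv_cls in H; [|apply dense_punctured | exact Hp].
  apply bounded_type_grows in H; [|apply dense_punctured | exact HK].
  apply grows_le with (2 := H). apply eventually_eq_le. intros e He x Hx.
  symmetry. apply (D_sub punctured_line whole); [apply dense_punctured | easy | | now apply HK].
  now apply Hu.
Qed.

(** The two travelling waves of d'Alembert's formula, for [s] equal to [1]
    and to [- 1]. *)
Definition wave_part (s : R) (u0 u1 : R -> R) (x : R) : R :=
  / 2 * (u0 x + s * RInt u1 0 x).

Lemma is_derive_wave_part s (u0 u1 : line -> R) x :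
  smooth whole u0 -> smooth whole u1 ->
  is_derive (wave_part s u0 u1) x (/ 2 * (Derive u0 x + s * u1 x)).
Proof.
  intros S0 S1. unfold wave_part. apply (is_derive_scal (fun x => u0 x + s * RInt u1 0 x) x (/ 2)).
  apply (is_derive_plus (V := R_NormedModule)).
  - apply Derive_correct. now apply smooth_line_ex_derive.
  - apply (is_derive_scal (fun x => RInt u1 0 x) x s). apply is_derive_RInt_R.
    intros y. now apply smooth_line_continuous.
Qed.

Lemma smooth_wave_part s (u0 u1 : line -> R) :
  smooth whole u0 -> smooth whole u1 -> smooth (V := line) whole (wave_part s u0 u1).
Proof.
  intros S0 S1. apply (smooth_of_is_derive _ (fun x => / 2 * (Derive u0 x + s * u1 x))).
  - intros x. now apply is_derive_wave_part.
  - apply (smooth_scal (V := line) whole (fun x => Derive u0 x + s * u1 x)).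
    apply (smooth_plus (V := line)); [now apply smooth_line_Derive|].
    now apply (smooth_scal (V := line)).
Qed.

Lemma grows_wave_part s (u0 u1 : net line) r M0 M1 :
  0 <= r -> 0 <= M1 -> smooth_net whole u1 ->
  at_right 0 (fun e => forall x, Rabs x <= r -> Rabs (u0 e x) <= M0) ->
  at_right 0 (fun e => forall x, Rabs x <= r -> Rabs (u1 e x) <= M1) ->
  grows rate_0 (interval r) (fun e => wave_part s (u0 e) (u1 e)).
Proof.
  intros Hr HM1 S1 B0 B1. exists 0. split; [easy|]. apply sup_bigO_0_iff.
  exists (/ 2 * (M0 + Rabs s * (r * M1))).
  apply filter_imp with (2 := filter_and _ _ (at_right_0_lt 1 Rlt_0_1) (filter_and _ _ B0 B1)).
  intros e (He & H0 & H1) x Hx. unfold wave_part. rewrite Rabs_mult, (Rabs_pos_eq (/ 2)) by lra.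
  apply Rmult_le_compat_l; [lra|]. apply Rle_trans with (1 := Rabs_triang _ _).
  apply Rplus_le_compat; [now apply H0|]. rewrite Rabs_mult.
  apply Rmult_le_compat_l; [apply Rabs_pos|].
  apply Rle_trans with (Rabs (x - 0) * M1).
  - apply abs_RInt_bound.
    + intros y. apply smooth_line_continuous. apply S1. lra.
    + intros t Ht. apply H1. revert Ht Hx. unfold interval, Rmin, Rmax.
      destruct Rle_dec; unfold Rabs; repeat destruct Rcase_abs; intros; lra.
  - rewrite Rminus_0_r. now apply Rmult_le_compat_r.
Qed.

Lemma Ctl_wave_part Q (K : R -> Prop) s (u0 u1 : net line) n :
  rates Q -> smooth_net whole u0 -> smooth_net whole u1 ->
  (forall m, Ctl whole (grows Q K) all_axes m u0) ->
  (forall m, Ctl whole (grows Q K) all_axes m u1) ->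
  grows Q K (fun e => wave_part s (u0 e) (u1 e)) ->
  Ctl (V := line) whole (grows Q K) all_axes n (fun e => wave_part s (u0 e) (u1 e)).
Proof.
  intros HQ S0 S1 C0 C1 HV.
  assert (SW : smooth_net (V := line) whole (fun e => wave_part s (u0 e) (u1 e)))
    by (intros e He; apply smooth_wave_part; [now apply S0 | now apply S1]).
  destruct n as [|n]; [now apply Ctl_whole_0|].
  apply Ctl_whole_S; [exact SW | exact HV |]. intros [] _.
  assert (S0' : smooth_net whole (fun e => D whole [ax1] (u0 e))) by now apply smooth_net_D.
  assert (S1' : smooth_net (V := line) whole (fun e x => s * u1 e x))
    by (intros e He; apply smooth_scal; now apply S1).
  apply Ctl_whole_ext with (fun e x => / 2 * (D whole [ax1] (u0 e) x + s * u1 e x)).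
  - intros e He. apply (smooth_scal (V := line) whole (fun x => D whole [ax1] (u0 e) x + s * u1 e x)).
    apply (smooth_plus (V := line)); [now apply S0' | now apply S1'].
  - intros e x He. rewrite D_line_1 by now apply S0. symmetry.
    refine (eq_trans (D_line_1 _ x (SW e He)) _).
    apply is_derive_unique. apply is_derive_wave_part; [now apply S0 | now apply S1].
  - apply (Ctl_scal (V := line) Q HQ K all_axes n (fun _ => / 2)
      (fun e x => D whole [ax1] (u0 e) x + s * u1 e x));
      [now apply grows_const | now apply smooth_net_plus |].
    apply Ctl_whole_plus; [exact HQ | exact S0' | exact S1' | now apply Ctl_whole_D |].
    apply (Ctl_scal (V := line) Q HQ K all_axes n (fun _ => s));
      [now apply grows_const | exact S1 | apply C1].
Qed.

(** * Back to time and space *)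

Lemma smooth_f_comp (c : R) (f A B : R -> R) (v : plane -> R) :
  (forall k y, ex_derive_n f k y) -> char_sol c f A B v -> smooth whole (fun p => f (v p)).
Proof. intros Sf Hv. apply smooth_comp; [exact Sf | apply Hv]. Qed.

Lemma char_sol_Dx_Dt (c : R) (f A B : R -> R) (v : plane -> R) p :
  (forall k y, ex_derive_n f k y) -> smooth (V := line) whole A -> char_sol c f A B v ->
  Dx (Dt v) p = - c * f (v p).
Proof.
  intros Sf SA Hv. assert (SG := smooth_f_comp c f A B v Sf Hv).
  assert (SA' : smooth whole (fun q : plane => Derive A (fst q)))
    by (apply smooth_line_fst; now apply smooth_line_Derive).
  assert (SI : smooth whole (char_int (fun q => f (v q)))) by apply smooth_char_int, SG.
  transitivity (Dx (fun q : plane => 1 * Derive A (fst q) + c * char_int (fun q => f (v q)) q) p).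
  - apply D_ext; [apply dense_whole | | now apply smooth_lin | | easy].
    + apply smooth_D, Hv.
    + intros q _. rewrite Rmult_1_l. apply Hv.
  - rewrite D_lin; [|apply dense_whole | exact SA' | exact SI | easy].
    assert (E1 := D_line_fst (Derive A) ax_x p (smooth_line_Derive A SA)). cbv beta iota in E1.
    assert (E2 := D_x_char_int (fun q => f (v q)) p SG).
    assert (R : forall X Y, X = 0 -> Y = - f (v p) -> 1 * X + c * Y = - c * f (v p))
      by (intros X Y -> ->; ring).
    exact (R _ _ E1 E2).
Qed.

(** Time reversal reduces this to the other order of differentiation. *)
Lemma char_sol_Dt_Dx (c : R) (f A B : R -> R) (v : plane -> R) p :
  (forall k y, ex_derive_n f k y) -> smooth (V := line) whole B -> char_sol c f A B v ->
  Dt (Dx v) p = - c * f (v p).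
Proof.
  intros Sf SB Hv. assert (Sv := char_sol_smooth _ _ _ _ _ Hv).
  assert (Hw := char_sol_swap _ _ _ _ _ Hv). set (w := fun q => v (swap q)) in Hw.
  assert (Sw := smooth_D (coordV := R2_coordinates) whole [ax_t] w (char_sol_smooth _ _ _ _ _ Hw)).
  transitivity (Dt (fun q => Dt w (swap q)) p).
  - apply D_ext; [apply dense_whole | now apply smooth_D | now apply smooth_swap | | easy].
    intros q _. unfold w. rewrite (Dt_swap v) by exact Sv. now rewrite swap_swap.
  - rewrite Dt_swap by exact Sw. rewrite (char_sol_Dx_Dt c f B A w) by assumption.
    unfold w. now rewrite swap_swap.
Qed.

Section Wave.

Variables (c : R) (f A B : R -> R) (v : plane -> R).
Hypothesis Sf : forall k y, ex_derive_n f k y.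
Hypothesis SA : smooth (V := line) whole A.
Hypothesis SB : smooth (V := line) whole B.
Hypothesis Hv : char_sol c f A B v.

Let u (p : plane) : R := v (char_coords p).

Lemma smooth_char_sol_comp : smooth whole u.
Proof. apply (smooth_linear_change char_coords _ _ linear_char_coords v). apply Hv. Qed.

Lemma Dt_char_sol p : Dt u p = Dt v (char_coords p) - Dx v (char_coords p).
Proof.
  assert (E := D_linear_change char_coords _ _ linear_char_coords v ax_t p (char_sol_smooth _ _ _ _ _ Hv)).
  cbv beta iota in E. transitivity (1 * Dt v (char_coords p) + -1 * Dx v (char_coords p)); [exact E | ring].
Qed.

Lemma Dx_char_sol p : Dx u p = Dt v (char_coords p) + Dx v (char_coords p).
Proof.
  assert (E := D_linear_change char_coords _ _ linear_char_coords v ax_x p (char_sol_smooth _ _ _ _ _ Hv)).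
  cbv beta iota in E. transitivity (1 * Dt v (char_coords p) + 1 * Dx v (char_coords p)); [exact E | ring].
Qed.

(** [(D_xi - D_eta)^2 - (D_xi + D_eta)^2 = - 4 D_xi D_eta]. *)
Lemma char_sol_wave p :
  Dtx whole [ax_t; ax_t] u p -
  Dtx whole [ax_x; ax_x] u p = 4 * c * f (u p).
Proof.
  assert (Sv := char_sol_smooth _ _ _ _ _ Hv). assert (Su := smooth_char_sol_comp).
  assert (Sp := smooth_D (coordV := R2_coordinates) whole [ax_t] v Sv).
  assert (Sq := smooth_D (coordV := R2_coordinates) whole [ax_x] v Sv).
  assert (Ett : Dtx whole [ax_t; ax_t] u p =
    Dt (Dt v) (char_coords p) - Dt (Dx v) (char_coords p) -
    (Dx (Dt v) (char_coords p) - Dx (Dx v) (char_coords p))).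
  { set (w := fun q => Dt v q - Dx v q).
    assert (Sw : smooth whole w) by (unfold w; now apply smooth_minus).
    transitivity (Dt (Dt u) p);
      [exact (D_app (coordV := R2_coordinates) whole [ax_t] [ax_t] u p dense_whole Su Logic.I)|].
    transitivity (Dt (fun q => w (char_coords q)) p).
    - apply D_ext; [apply dense_whole | now apply smooth_D | | | easy].
      + exact (smooth_linear_change char_coords _ _ linear_char_coords w Sw).
      + intros q _. apply Dt_char_sol.
    - assert (E := D_linear_change char_coords _ _ linear_char_coords w ax_t p Sw). cbv beta iota in E.
      transitivity (1 * Dt w (char_coords p) + -1 * Dx w (char_coords p)); [exact E|].
      unfold w. rewrite !D_minus by (try apply dense_whole; easy). ring. }
  assert (Exx : Dtx whole [ax_x; ax_x] u p =
    Dt (Dt v) (char_coords p) + Dt (Dx v) (char_coords p) +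
    (Dx (Dt v) (char_coords p) + Dx (Dx v) (char_coords p))).
  { set (w := fun q => 1 * Dt v q + 1 * Dx v q).
    assert (Sw : smooth whole w) by (unfold w; now apply smooth_lin).
    transitivity (Dx (Dx u) p);
      [exact (D_app (coordV := R2_coordinates) whole [ax_x] [ax_x] u p dense_whole Su Logic.I)|].
    transitivity (Dx (fun q => w (char_coords q)) p).
    - apply D_ext; [apply dense_whole | now apply smooth_D | | | easy].
      + exact (smooth_linear_change char_coords _ _ linear_char_coords w Sw).
      + intros q _. unfold w. rewrite !Rmult_1_l. apply Dx_char_sol.
    - assert (E := D_linear_change char_coords _ _ linear_char_coords w ax_x p Sw). cbv beta iota in E.
      transitivity (1 * Dt w (char_coords p) + 1 * Dx w (char_coords p)); [exact E|].
      unfold w. rewrite !D_lin by (try apply dense_whole; easy). ring. }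
  rewrite Ett, Exx, (char_sol_Dt_Dx c f A B v _ Sf SB Hv), (char_sol_Dx_Dt c f A B v _ Sf SA Hv).
  unfold u. ring.
Qed.

End Wave.

(** * The solution and its singular support *)

Lemma grows_of_bounded {V : NormedModule R_AbsRing} (K : V -> Prop) (g : net V) C :
  at_right 0 (fun e => forall x, K x -> Rabs (g e x) <= C) -> grows rate_0 K g.
Proof. intros H. exists 0. split; [easy|]. apply sup_bigO_0_iff. now exists C. Qed.

Lemma grows_rate_0 {V : NormedModule R_AbsRing} (Q : R -> Prop) (K : V -> Prop) (g : net V) :
  rates Q -> grows rate_0 K g -> grows Q K g.
Proof. intros [HQ _] (b & -> & H). now exists 0. Qed.

Lemma grows_continuous_comp {V : NormedModule R_AbsRing} (K : V -> Prop) (h : R -> R) (g : net V) :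
  (forall s, continuous h s) -> grows rate_0 K g -> grows rate_0 K (fun e x => h (g e x)).
Proof.
  intros Hh (b & -> & H). apply sup_bigO_0_iff in H. destruct H as [C HC].
  destruct (continuity_ab_maj (fun x => Rabs (h x)) (- Rabs C) (Rabs C)) as (m & Hm & _).
  - assert (P := Rabs_pos C). lra.
  - intros x _. apply continuity_pt_filterlim.
    apply (continuous_comp h Rabs); [apply Hh | apply continuous_Rabs].
  - apply grows_of_bounded with (Rabs (h m)).
    apply filter_imp with (2 := HC). intros e He x Hx. apply Hm.
    specialize (He x Hx). assert (HA := Rle_abs C). revert He.
    generalize (Rabs C) HA. intros D HD. unfold Rabs. destruct Rcase_abs; lra.
Qed.

Section Solution.

Variables (u0 u1 : net line) (g : R -> R) (M0 M1 B L T : R).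
Hypothesis Hu0 : moderate whole u0.
Hypothesis Hu1 : moderate whole u1.
Hypothesis HM1 : 0 <= M1.
Hypothesis B0 : forall r, at_right 0 (fun e => forall x, Rabs x <= r -> Rabs (u0 e x) <= M0).
Hypothesis B1 : forall r, at_right 0 (fun e => forall x, Rabs x <= r -> Rabs (u1 e x) <= M1).
Hypothesis Sg : forall k y, ex_derive_n g k y.
Hypothesis HB : forall s, Rabs (g s) <= B.
Hypothesis HL : forall s t, Rabs (g s - g t) <= L * Rabs (s - t).
Hypothesis HT : 0 < T.

Let A1 : net line := fun e => wave_part 1 (u0 e) (u1 e).
Let A2 : net line := fun e => wave_part (-1) (u0 e) (u1 e).

Lemma smooth_net_wave_part s : smooth_net (V := line) whole (fun e => wave_part s (u0 e) (u1 e)).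
Proof. intros e He. apply smooth_wave_part; [now apply Hu0 | now apply Hu1]. Qed.

Definition truncated_sol (e : R) : plane -> R :=
  epsilon (inhabits (fun _ => 0)) (fun v => char_sol (e / 4) g (A1 e) (A2 e) v /\
    forall p, Rabs (v p - (A1 e (fst p) + A2 e (snd p))) <=
      e / 4 * (B * weight 1 p)).

Lemma truncated_sol_spec e : 0 < e <= 1 ->
  char_sol (e / 4) g (A1 e) (A2 e) (truncated_sol e) /\
  forall p, Rabs (truncated_sol e p - (A1 e (fst p) + A2 e (snd p))) <=
    e / 4 * (B * weight 1 p).
Proof.
  intros He. unfold truncated_sol. apply epsilon_spec. apply char_sol_exists with L; try assumption.
  - lra.
  - now apply smooth_net_wave_part.
  - now apply smooth_net_wave_part.
Qed.

Definition sol : net plane := fun e p => truncated_sol e (char_coords p).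

Lemma B_ge_0 : 0 <= B.
Proof. apply Rle_trans with (2 := HB 0), Rabs_pos. Qed.

Lemma truncated_sol_bounded r : 0 <= r -> grows rate_0 (box r) truncated_sol.
Proof.
  intros Hr.
  assert (G : forall s, grows rate_0 (interval r) (fun e => wave_part s (u0 e) (u1 e))).
  { intros s. apply grows_wave_part with M0 M1; try assumption; [apply Hu1 | apply B0 | apply B1]. }
  destruct (G 1) as (b1 & -> & G1). apply sup_bigO_0_iff in G1. destruct G1 as [C1 G1].
  destruct (G (-1)) as (b2 & -> & G2). apply sup_bigO_0_iff in G2. destruct G2 as [C2 G2].
  apply grows_of_bounded with (C1 + C2 + B * exp (2 * r)).
  apply filter_imp with (2 := filter_and _ _ (at_right_0_lt 1 Rlt_0_1) (filter_and _ _ G1 G2)).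
  intros e (He & H1 & H2) p [Hx Hy].
  destruct (truncated_sol_spec e) as [_ Hb]; [lra|]. specialize (Hb p).
  specialize (H1 (fst p) Hx). specialize (H2 (snd p) Hy). fold (A1 e) in H1. fold (A2 e) in H2.
  assert (Hd : Rabs (fst p - snd p) <= 2 * r).
  { apply Rle_trans with (1 := Rabs_triang _ _). rewrite Rabs_Ropp. lra. }
  assert (Hq : B * weight 1 p <= B * exp (2 * r)).
  { apply Rmult_le_compat_l; [exact B_ge_0 | now apply weight_le]. }
  assert (Hq0 : 0 <= B * weight 1 p).
  { apply Rmult_le_pos; [exact B_ge_0 | left; apply exp_pos]. }
  replace (truncated_sol e p) with
    ((truncated_sol e p - (A1 e (fst p) + A2 e (snd p))) + (A1 e (fst p) + A2 e (snd p))) by ring.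
  apply Rle_trans with (1 := Rabs_triang _ _).
  assert (Ht := Rabs_triang (A1 e (fst p)) (A2 e (snd p))). nra.
Qed.

(** Up to a term of order [eps], the solution is the free wave, whose size in
    the strip does not depend on the compact set.  The summand [1] absorbs that
    term. *)
Lemma sol_bounded r :
  at_right 0 (fun e => forall p, strip T p -> Rabs (snd p) <= r ->
    Rabs (sol e p) <= M0 + T * M1 + 1).
Proof.
  assert (Hs : 0 <= B * exp (2 * T)) by (apply Rmult_le_pos; [exact B_ge_0 | left; apply exp_pos]).
  apply filter_imp with (2 := filter_and _ _ (filter_and _ _ (at_right_0_lt 1 Rlt_0_1) (eventually_small _ Hs))
    (filter_and _ _ (B0 (r + T)) (B1 (r + T)))).
  intros e ([He Hsm] & H0 & H1) [t x] Ht Hx. unfold strip in Ht. cbn in Ht, Hx.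
  unfold sol, char_coords. cbn [fst snd].
  destruct (truncated_sol_spec e) as [_ Hb]; [lra|]. specialize (Hb (x + t, x - t)). cbn [fst snd] in Hb.
  assert (C1 : forall y, continuous (u1 e) y)
    by (intros y; apply smooth_line_continuous; apply Hu1; lra).
  assert (EW : A1 e (x + t) + A2 e (x - t) =
    / 2 * (u0 e (x + t) + u0 e (x - t) + RInt (u1 e) (x - t) (x + t))).
  { unfold A1, A2, wave_part.
    rewrite <- (RInt_Chasles_R (u1 e) 0 (x - t) (x + t) C1). ring. }
  rewrite EW in Hb. clear EW.
  assert (Hp : - r <= x <= r) by (revert Hx; unfold Rabs; destruct Rcase_abs; lra).
  assert (U1 : Rabs (u0 e (x + t)) <= M0) by (apply H0; unfold Rabs; destruct Rcase_abs; lra).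
  assert (U2 : Rabs (u0 e (x - t)) <= M0) by (apply H0; unfold Rabs; destruct Rcase_abs; lra).
  assert (U3 : Rabs (RInt (u1 e) (x - t) (x + t)) <= (2 * T) * M1).
  { apply Rle_trans with (Rabs (x + t - (x - t)) * M1).
    - apply abs_RInt_bound; [exact C1|]. intros s. rewrite Rmin_left, Rmax_right by lra. intros Hs'.
      apply H1. unfold Rabs; destruct Rcase_abs; lra.
    - apply Rmult_le_compat_r; [exact HM1|]. rewrite Rabs_pos_eq; lra. }
  assert (Hq : B * weight 1 (x + t, x - t) <= B * exp (2 * T)).
  { apply Rmult_le_compat_l; [exact B_ge_0|]. apply weight_le. cbn [fst snd].
    rewrite Rabs_pos_eq; lra. }
  assert (Hq0 : 0 <= B * weight 1 (x + t, x - t)).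
  { apply Rmult_le_pos; [exact B_ge_0 | left; apply exp_pos]. }
  set (w := / 2 * (u0 e (x + t) + u0 e (x - t) + RInt (u1 e) (x - t) (x + t))) in Hb.
  assert (Hw : Rabs w <= M0 + T * M1).
  { unfold w. rewrite Rabs_mult, (Rabs_pos_eq (/ 2)) by lra.
    assert (T1 := Rabs_triang (u0 e (x + t) + u0 e (x - t)) (RInt (u1 e) (x - t) (x + t))).
    assert (T2 := Rabs_triang (u0 e (x + t)) (u0 e (x - t))). lra. }
  replace (truncated_sol e (x + t, x - t)) with ((truncated_sol e (x + t, x - t) - w) + w) by ring.
  apply Rle_trans with (1 := Rabs_triang _ _). nra.
Qed.

Lemma smooth_net_truncated_sol : smooth_net whole truncated_sol.
Proof. intros e He. apply (truncated_sol_spec e He). Qed.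

Lemma smooth_net_sol : smooth_net whole sol.
Proof.
  intros e He. apply (smooth_linear_change char_coords _ _ linear_char_coords).
  now apply smooth_net_truncated_sol.
Qed.

(** Taking all points as regular and any power of [eps] as growth yields
    moderateness; taking the points away from the origin and bounded growth
    yields regularity off the light cone. *)
Lemma Ctl_sol Q reg r n :
  rates Q -> 0 <= r ->
  (forall m, Ctl whole (grows Q (reg_interval reg r)) all_axes m u0) ->
  (forall m, Ctl whole (grows Q (reg_interval reg r)) all_axes m u1) ->
  Ctl whole (grows Q (fun p => box_tx reg r (char_coords p))) all_axes n sol.
Proof.
  intros HQ Hr C0 C1.
  apply (Ctl_linear_change (coordW := R2_coordinates) Q HQ char_coords _ _ _ (box_tx reg r)
    all_axes (all_axes (coordV := R2_coordinates)) n truncated_sol linear_char_coords).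
  - easy.
  - intros i _. split; right; exact Logic.I.
  - exact smooth_net_truncated_sol.
  - assert (CW : forall s m, Ctl (V := line) whole (grows Q (reg_interval reg r)) all_axes m
      (fun e => wave_part s (u0 e) (u1 e))).
    { intros s m. apply Ctl_wave_part; try assumption; [apply Hu0 | apply Hu1 |].
      apply grows_subset with (interval r); [intros x Hx; apply Hx|].
      apply grows_rate_0; [exact HQ|].
      apply grows_wave_part with M0 M1; try assumption; [apply Hu1 | apply B0 | apply B1]. }
    assert (P : propagated Q reg r n truncated_sol).
    { apply (controlled_sol_propagated Q HQ reg r n g (fun e => e / 4) A1 A2). split.
      - exact Sg.
      - apply grows_rate_0; [exact HQ|]. apply grows_of_bounded with 1.
        apply filter_imp with (2 := at_right_0_lt 1 Rlt_0_1). intros e He x _.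
        rewrite Rabs_pos_eq; lra.
      - apply smooth_net_wave_part.
      - apply smooth_net_wave_part.
      - apply CW.
      - apply CW.
      - intros e He. now apply truncated_sol_spec.
      - apply grows_rate_0; [exact HQ | now apply truncated_sol_bounded].
      - intros k. apply grows_rate_0; [exact HQ|].
        apply (grows_continuous_comp (V := plane) (box r) (Derive_n g k)); [|now apply truncated_sol_bounded].
        intros s. apply ex_derive_continuous_R.
        exact (Sg (S k) s). }
    apply P.
Qed.

Lemma compact_plane_bounded (K : plane -> Prop) :
  compact_set K -> exists r, 0 <= r /\ forall p, K p -> Rabs (fst p) < r /\ Rabs (snd p) < r.
Proof.
  intros HK.
  destruct (compact_bounded (V := plane) (fun p => Rabs (fst p)) K) as [r1 H1]; [|exact HK|].
  { intros p. apply (continuous_comp (fun p : plane => fst p) Rabs);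
      [apply continuous_fst_plane | apply continuous_Rabs]. }
  destruct (compact_bounded (V := plane) (fun p => Rabs (snd p)) K) as [r2 H2]; [|exact HK|].
  { intros p. apply (continuous_comp (fun p : plane => snd p) Rabs);
      [apply continuous_snd_plane | apply continuous_Rabs]. }
  exists (Rmax 0 (Rmax r1 r2)). split; [apply Rmax_l|].
  intros p Hp. specialize (H1 p Hp). specialize (H2 p Hp).
  assert (G1 := Rmax_r 0 (Rmax r1 r2)). assert (G2 := Rmax_l r1 r2). assert (G3 := Rmax_r r1 r2).
  cbv beta in H1, H2. split; lra.
Qed.

Lemma box_char_coords r (p : plane) :
  Rabs (fst p) < r -> Rabs (snd p) < r -> box (r + r) (char_coords p).
Proof.
  intros H1 H2. unfold box, char_coords. cbn [fst snd].
  split; [|unfold Rminus]; apply Rle_trans with (1 := Rabs_triang _ _); try rewrite Rabs_Ropp; lra.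
Qed.

Lemma moderate_sol : moderate whole sol.
Proof.
  apply moderate_iff. split; [exact smooth_net_sol|]. intros K n [HK _].
  destruct (compact_plane_bounded K HK) as (r & Hr & Hb).
  apply (Ctl_imp whole (grows any_rate (fun p => box_tx (fun _ => True) (r + r) (char_coords p)))
    (grows any_rate K) all_axes all_axes).
  - intros h. apply grows_subset. intros p Hp. destruct (Hb p Hp) as [H1 H2].
    split; [now apply box_char_coords | easy].
  - easy.
  - apply Ctl_sol; [apply rates_any | lra | |]; intros m; now apply moderate_data.
Qed.

Lemma moderate_sol_strip : moderate (strip T) sol.
Proof.
  apply moderate_sub with whole; [now apply dense_strip | easy | exact moderate_sol].
Qed.

Lemma sol_wave e p : 0 < e <= 1 -> strip T p ->
  Dtx (strip T) [ax_t; ax_t] (sol e) p -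
  Dtx (strip T) [ax_x; ax_x] (sol e) p = e * g (sol e p).
Proof.
  intros He Hp.
  assert (E : forall l, Dtx (strip T) l (sol e) p =
    Dtx whole l (sol e) p).
  { intros l. apply (D_sub (strip T) whole); [now apply dense_strip | easy | | exact Hp].
    now apply smooth_net_sol. }
  rewrite !E. replace (e * g (sol e p)) with (4 * (e / 4) * g (sol e p)) by field.
  apply (char_sol_wave (e / 4) g (A1 e) (A2 e) (truncated_sol e) Sg).
  - now apply smooth_net_wave_part.
  - now apply smooth_net_wave_part.
  - now apply truncated_sol_spec.
Qed.

Lemma sol_initial e (x : R) : 0 < e <= 1 -> sol e (0, x) = u0 e x.
Proof.
  intros He. unfold sol, char_coords. cbn [fst snd]. rewrite Rplus_0_r, Rminus_0_r.
  destruct (truncated_sol_spec e He) as [Hs _]. rewrite (char_sol_diag _ _ _ _ _ Hs).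
  unfold A1, A2, wave_part. field.
Qed.

Lemma sol_initial_t e (x : R) : 0 < e <= 1 ->
  Dtx (strip T) [ax_t] (sol e) (0, x) = u1 e x.
Proof.
  intros He. destruct (truncated_sol_spec e He) as [Hs _].
  assert (E : Dtx (strip T) [ax_t] (sol e) (0, x) = Dt (sol e) (0, x)).
  { apply (D_sub (strip T) whole); [now apply dense_strip | easy | | now apply strip_0].
    now apply smooth_net_sol. }
  rewrite E. refine (eq_trans (Dt_char_sol _ _ _ _ _ Hs (0, x)) _).
  rewrite (char_sol_t _ _ _ _ _ Hs), (char_sol_x _ _ _ _ _ Hs).
  unfold char_coords, swap. cbn [fst snd]. rewrite Rplus_0_r, Rminus_0_r, !char_int_diag.
  assert (S0 : smooth whole (u0 e)) by now apply Hu0.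
  assert (S1 : smooth whole (u1 e)) by now apply Hu1.
  unfold A1, A2. rewrite !(is_derive_unique _ _ _ (is_derive_wave_part _ _ _ x S0 S1)). field.
Qed.

(** For small indices the solution only takes values where [g] and [f] agree. *)
Lemma truncation_negligible (f : R -> R) :
  (forall k y, ex_derive_n f k y) ->
  (forall s, Rabs s <= M0 + T * M1 + 1 -> g s = f s) ->
  negligible (strip T) (fun e p => g (sol e p) - f (sol e p)).
Proof.
  intros Sf Egf. assert (HS := dense_strip T HT).
  assert (Sd : smooth_net (strip T) (fun e p => g (sol e p) - f (sol e p))).
  { apply smooth_net_minus; apply smooth_net_comp; try assumption; apply moderate_sol_strip. }
  split; [exact Sd|]. intros K l a [HK HKs] Ha.
  destruct (compact_plane_bounded K HK) as (r & Hr & Hb).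
  (* derivatives need an open set on which [g] and [f] agree along the solution *)
  set (w := fun p : plane => strip T p /\ Rabs (snd p) < r).
  assert (Hw : dense_interior w).
  { apply (dense_rel_open (strip T)); [exact HS|].
    exists (fun p : plane => Rabs (snd p) < r). split; [|easy].
    apply (open_comp (fun p : plane => Rabs (snd p)) (fun y => y < r)); [|apply open_lt].
    intros p _. apply (continuous_comp (fun p : plane => snd p) Rabs);
      [apply continuous_snd_plane | apply continuous_Rabs]. }
  exists 0. apply filter_imp with (2 := filter_and _ _ (at_right_0_lt 1 Rlt_0_1) (sol_bounded r)).
  intros e [He Hbd] p Hp.
  assert (Hpw : w p) by (split; [now apply HKs | now apply Hb]).
  assert (He' : 0 < e <= 1) by lra.
  destruct (D_sub w (strip T) l _ Hw (fun q Hq => proj1 Hq) (Sd e He')) as [Sw Ew].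
  rewrite <- (Ew p Hpw).
  assert (Z : D w l (fun p => g (sol e p) - f (sol e p)) p = D w l (fun _ => 0) p).
  { apply D_ext; try assumption; [apply smooth_const|]. intros q [Hq1 Hq2].
    rewrite Egf; [ring|]. apply Hbd; [exact Hq1 | left; exact Hq2]. }
  rewrite Z, Rmult_0_l. right.
  destruct l as [|i l] using rev_ind.
  - assert (E := D_nil w (fun _ : plane => 0) p Hw (smooth_const w 0) Hpw).
    exact (eq_trans (f_equal Rabs E) Rabs_R0).
  - exact (eq_trans (f_equal Rabs (D_const w i l 0 p Hw Hpw)) Rabs_R0).
Qed.

(** The set [w] stays away from the two lines [xi = 0] and [eta = 0], the only
    places where derivatives of the solution can fail to be bounded. *)
Lemma G0_sol d :
  0 < d ->
  (forall r m, Ctl whole (grows rate_0 (reg_interval (fun x => d <= Rabs x) r)) all_axes m u0) ->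
  (forall r m, Ctl whole (grows rate_0 (reg_interval (fun x => d <= Rabs x) r)) all_axes m u1) ->
  forall w : plane -> Prop, dense_interior w ->
  (forall p, w p -> strip T p /\ d <= Rabs (snd p + fst p) /\ d <= Rabs (snd p - fst p)) ->
  G0 w (cls w sol).
Proof.
  intros Hd C0 C1 w Hw Hwd.
  assert (Mw : moderate w sol) by (apply moderate_sub with whole; [exact Hw | easy | exact moderate_sol]).
  split; [now exists sol|]. intros l K HK. rewrite gderiv_cls; [|exact Hw | exact Mw].
  exists (fun e => D w l (sol e)). split; [apply cls_refl; [exact Hw | now apply moderate_D]|].
  destruct (compact_plane_bounded K (proj1 HK)) as (r & Hr & Hb).
  assert (C := Ctl_sol rate_0 (fun x => d <= Rabs x) (r + r) (length l) rates_0
    (Rplus_le_le_0_compat _ _ Hr Hr) (C0 _) (C1 _) l (Forall_all_axes l) (le_n _)).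
  assert (CK : grows rate_0 K (fun e => D w l (sol e))).
  { apply grows_le with (fun e => D whole l (sol e)).
    - apply eventually_eq_le. intros e He p Hp.
      apply (D_sub w whole); [exact Hw | easy | now apply smooth_net_sol | now apply HK].
    - apply grows_subset with (2 := C). intros p Hp. destruct (Hb p Hp) as [H1 H2].
      split; [now apply box_char_coords|]. now apply Hwd, HK. }
  destruct CK as (b & -> & H). now apply sup_bigO_0_iff in H.
Qed.

End Solution.

Lemma num_moderate_id : num_moderate (fun e => e).
Proof.
  exists 1, 1. apply filter_imp with (2 := at_right_0_lt 1 Rlt_0_1). intros e He.
  rewrite Rpower_1, Rabs_pos_eq; lra.
Qed.

Lemma open_off_cone (d : R) :
  open (fun p : plane => d < Rabs (snd p + fst p) /\ d < Rabs (snd p - fst p)).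
Proof.
  apply open_and.
  - apply (open_comp (fun p : plane => Rabs (snd p + fst p)) (fun y => d < y)); [|apply open_gt].
    intros p _. apply (continuous_comp (fun p : plane => snd p + fst p) Rabs); [|apply continuous_Rabs].
    apply (continuous_plus (V := R_NormedModule)); [apply continuous_snd_plane | apply continuous_fst_plane].
  - apply (open_comp (fun p : plane => Rabs (snd p - fst p)) (fun y => d < y)); [|apply open_gt].
    intros p _. apply (continuous_comp (fun p : plane => snd p - fst p) Rabs); [|apply continuous_Rabs].
    apply (continuous_minus (V := R_NormedModule)); [apply continuous_snd_plane | apply continuous_fst_plane].
Qed.

Theorem theorem3p1
    (f : R -> R)
    (U0 U1 : net line -> Prop) :
  O_M f -> f 0 = 0 ->
  G real_line U0 -> G real_line U1 ->
  compact_set (gsupp real_line U0) ->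
  compact_set (gsupp real_line U1) ->
  G0 punctured_line (grestrict punctured_line U0) ->
  G0 punctured_line (grestrict punctured_line U1) ->
  bounded_type real_line (gderiv real_line [tt] U0) ->
  bounded_type real_line U1 ->
  forall T : R, 0 < T ->
  exists U : net plane -> Prop,
    G (strip T) U /\
    gsub (strip T) (gderiv (strip T) [ax_t; ax_t] U)
                   (gderiv (strip T) [ax_x; ax_x] U)
      = gscal (strip T) E_eps (gcomp (strip T) f U) /\
    at_time_0 U = U0 /\
    at_time_0 (gderiv (strip T) [ax_t] U) = U1 /\
    (forall t x, singsupp_G0 (strip T) U (t, x) -> Rabs x = t /\ 0 <= t <= T).
Proof.
  intros Hf _ [u0 [Hu0 ->]] [u1 [Hu1 ->]] Hs0 _ Hg0 Hg1 Hb0 Hb1 T HT.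
  change real_line with (whole (V := line)) in *.
  assert (HS := dense_strip T HT). assert (HP := dense_punctured).
  rewrite grestrict_cls in Hg0; [|apply dense_whole | exact HP | easy | exact Hu0].
  rewrite grestrict_cls in Hg1; [|apply dense_whole | exact HP | easy | exact Hu1].
  assert (Hb0' : bounded_type whole (cls whole (fun e => D whole [ax1] (u0 e)))).
  { rewrite <- gderiv_cls; [exact Hb0 | apply dense_whole | exact Hu0]. }
  destruct (data_bounded u0 Hu0 Hs0 Hb0') as (M0 & HM0 & B0).
  destruct (bounded_type_cls whole whole u1 dense_whole Hb1) as (M1 & HM1 & B1K).
  assert (B1 : forall r, at_right 0 (fun e => forall x, Rabs x <= r -> Rabs (u1 e x) <= M1)).
  { intros r. apply (B1K (fun x => Rabs x <= r)); [|easy]. split; [apply compact_interval_abs | easy]. }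
  assert (HM : 0 <= M0 + T * M1 + 1) by (assert (0 <= T * M1) by (apply Rmult_le_pos; lra); lra).
  destruct (truncation f (M0 + T * M1 + 1) HM (proj1 Hf)) as (g & Sg & Eg & [B HB] & [L HL]).
  set (u := sol u0 u1 g B).
  assert (Mu : moderate (strip T) u)
    by exact (moderate_sol_strip u0 u1 g M0 M1 B L T Hu0 Hu1 HM1 B0 B1 Sg HB HL HT).
  exists (cls (strip T) u). split; [now exists u|].
  assert (EG := fun l => gderiv_cls (strip T) l u HS Mu).
  split; [|split; [|split]].
  - rewrite !EG.
    rewrite (gsub_cls (strip T) _ _ HS (moderate_D _ HS _ _ Mu) (moderate_D _ HS _ _ Mu)).
    rewrite (gcomp_cls (strip T) f u HS Hf Mu).
    unfold E_eps.
    rewrite (gscal_cls (strip T) (fun e => e) (fun e p => f (u e p)) HS num_moderate_id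
      (moderate_comp (strip T) HS f u Hf Mu)).
    apply cls_eq; [exact HS|].
    apply negligible_ext with (fun e p => (g (u e p) - f (u e p)) * (fun e (_ : plane) => e) e p).
    + exact HS.
    + apply (negligible_mult (strip T) HS (fun e p => g (u e p) - f (u e p)) (fun e (_ : plane) => e)).
      * apply (truncation_negligible u0 u1 g M0 M1 B L T Hu0 Hu1 HM1 B0 B1 Sg HB HL HT f); [apply Hf | exact Eg].
      * apply moderate_num; [exact HS | apply num_moderate_id].
    + intros e He p Hp. unfold u.
      rewrite (sol_wave u0 u1 g B L T Hu0 Hu1 Sg HB HL HT e p He Hp). ring.
  - rewrite (at_time_0_cls T HT u Mu). apply cls_eq; [apply dense_whole|].
    apply negligible_ext with (fun _ _ => 0); [apply dense_whole | apply negligible_0, dense_whole |].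
    intros e He x _. unfold u. rewrite (sol_initial u0 u1 g B L Hu0 Hu1 Sg HB HL e x He). ring.
  - rewrite EG. rewrite (at_time_0_cls T HT _ (moderate_D (strip T) HS _ u Mu)).
    apply cls_eq; [apply dense_whole|].
    apply negligible_ext with (fun _ _ => 0); [apply dense_whole | apply negligible_0, dense_whole |].
    intros e He x _. unfold u. rewrite (sol_initial_t u0 u1 g B L T Hu0 Hu1 Sg HB HL HT e x He). ring.
  - intros t x [Ht Hns]. unfold strip in Ht. cbn in Ht. split; [|exact Ht].
    apply Classical_Prop.NNPP. intros Hne. apply Hns.
    assert (N1 : x + t <> 0).
    { intros E. apply Hne. replace x with (- t) by lra. rewrite Rabs_Ropp. apply Rabs_pos_eq. lra. }
    assert (N2 : x - t <> 0).
    { intros E. apply Hne. replace x with t by lra. apply Rabs_pos_eq. lra. }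
    apply Rabs_pos_lt in N1. apply Rabs_pos_lt in N2.
    (* half the distance from the light cone in characteristic coordinates *)
    set (d := Rmin (Rabs (x + t)) (Rabs (x - t)) / 2).
    assert (Hd : 0 < d /\ d < Rabs (x + t) /\ d < Rabs (x - t)).
    { unfold d, Rmin. destruct Rle_dec; lra. }
    clearbody d. destruct Hd as (Hd & Hd1 & Hd2).
    set (w := fun p : plane => strip T p /\ (d < Rabs (snd p + fst p) /\ d < Rabs (snd p - fst p))).
    assert (Hw : rel_open (strip T) w).
    { exists (fun p : plane => d < Rabs (snd p + fst p) /\ d < Rabs (snd p - fst p)).
      split; [apply open_off_cone | easy]. }
    assert (HwD := dense_rel_open (strip T) w HS Hw).
    exists w. split; [exact Hw|]. split; [now repeat split|].
    rewrite grestrict_cls; [|exact HS | exact HwD | now intros p [H _] | exact Mu].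
    apply (G0_sol u0 u1 g M0 M1 B L T Hu0 Hu1 HM1 B0 B1 Sg HB HL d); try assumption.
    + intros r m. now apply regular_data.
    + intros r m. now apply regular_data.
    + intros p (H1 & H2 & H3). split; [exact H1 | split; lra].
Qed.
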